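(* Let $W$ be a finite-dimensional complex vector space and let $A\subset GL(W)$ be a connected reductive algebraic group with one-dimensional center and Lie algebra $\mathfrak a$; put $\mathfrak a'=[\mathfrak a,\mathfrak a]$. Suppose that $(A,W)$ is an irreducible regular prehomogeneous vector space, with fundamental relative invariant $P$ of degree $p$, and suppose that $$\mathfrak a=\{U\in\mathfrak{gl}(W)\mid\exists\,\mu\in\mathbb C,\ U.P=\mu P\},\quad\text{or equivalently}\quad \mathfrak a'=\{U\in\mathfrak{gl}(W)\mid U.P=0\}.$$ Let $P^*$ be the fundamental relative invariant of the dual prehomogeneous vector space $(A,W^* )$ (defined up to a multiplicative constant). Let $\lambda\in\mathbb C^*$, let $B_0$ be a non-degenerate invariant symmetric bilinear form on $\mathfrak{gl}(W)$, and let $\widetilde{\mathfrak b}$ be the centralizer of $\mathfrak a'$ in the Lie algebra of polynomial type $\mathfrak p^p(W,B_0,\lambda)$. 1) One can choose $P^*$ such that $(P^*,H_0=\frac2\lambda\mathrm{Id}_W,P)$ is an $\mathfrak{sl}_2$-triple in $\mathfrak p^p(W,B_0,\lambda)$. Then, if $\mathfrak b$ is the Lie subalgebra of $\mathfrak p^p(W,B_0,\lambda)$, isomorphic to $\mathfrak{sl}(2)$, generated by this triple, we have $$\mathfrak b=\widetilde{\mathfrak b}\cap\Gamma(\mathfrak p^p(W,B_0,\lambda)),$$ where $\Gamma(\mathfrak p^p(W,B_0,\lambda))$ is the local part (sum of the components of degree $-1,0,1$). 2) Moreover $(\mathfrak a',\widetilde{\mathfrak b})$ is a dual pair in $\mathfrak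 p^p(W,B_0,\lambda)$, i.e. each of $\mathfrak a'$, $\widetilde{\mathfrak b}$ is the centralizer of the other in $\mathfrak p^p(W,B_0,\lambda)$.
   Context: All vector spaces and Lie algebras are over $\mathbb C$. For a finite-dimensional Lie algebra $\mathfrak g_0$ with a non-degenerate invariant symmetric bilinear form $B_0$ and a finite-dimensional representation $(\rho,V)$, let $\Gamma(\mathfrak g_0,B_0,\rho)=V^*\oplus\mathfrak g_0\oplus V$ (degrees $-1,0,1$) be the local Lie algebra with the bracket of $\mathfrak g_0$, the anticommutative brackets $[U,X]=\rho(U)X$, $[U,Y]=\rho^*(U)Y$ ($\rho^*$ contragredient), and $[X,Y]\in\mathfrak g_0$ defined by $B_0([X,Y],U)=Y(\rho(U)X)$ for all $U\in\mathfrak g_0$ ($X\in V$, $Y\in V^*$). $\mathfrak g_{min}(\Gamma)$ denotes the minimal graded Lie algebra with local part $\Gamma$: the unique $\mathbb Z$-graded Lie algebra generated by its degree $-1,0,1$ part, this part being $\Gamma$, and having no nonzero graded ideal that meets $\Gamma$ trivially. For an integer $p\ge1$ let $\mathbb C^p[W]$ be the space of homogeneous polynomials of degree $p$ on $W$; $U.P$ denotes the natural action of $U\in\mathfrak{gl}(W)$ on polynomials (derived from $(g.P)(x)=P(g^{-1}x)$). For $\lambda\in\mathbb C^*$, $\rho_\lambda$ is the representation of $\mathfrak{gl}(W)$ on $\mathbb C^p[W]$ whose restriction to $\mathfrak{sl}(W)$ is the natural representation and with $\rho_\lambda(\mathrm{Id}_W)=\lambda\,\mathrm{Id}_{\mathbb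 C^p[W]}$. The Lie algebra of polynomial type is $\mathfrak p^p(W,B_0,\lambda)=\mathfrak g_{min}(\Gamma(\mathfrak{gl}(W),B_0,\rho_\lambda))$; thus its degree $0$ part is $\mathfrak{gl}(W)\supset\mathfrak a'$, its degree $1$ part is $\mathbb C^p[W]\ni P$, and its degree $-1$ part is $(\mathbb C^p[W])^*$, identified with $\mathbb C^p[W^*]$ by letting $Q\in\mathbb C^p[W^*]$ correspond to the linear form $P\mapsto Q(\partial)P$, where $Q(\partial)$ is the constant coefficient differential operator on $W$ with $Q(\partial)e^{\langle x,y\rangle}=Q(y)e^{\langle x,y\rangle}$ ($x\in W$, $y\in W^*$). A triple $(y,h,x)$ is an $\mathfrak{sl}_2$-triple if $[h,x]=2x$, $[h,y]=-2y$, $[y,x]=h$. $(A,W)$ is prehomogeneous if $A$ has a Zariski open orbit in $W$; irreducible if $W$ is an irreducible $A$-module; regular if there is a relative invariant (a polynomial or rational function $f$ with $f(g.x)=\chi(g)f(x)$ for a rational character $\chi$ of $A$) whose Hessian matrix is generically non-degenerate. The fundamental relative invariant $P$ is the irreducible polynomial relative invariant (unique up to a scalar), every relative invariant being of the form $cP^m$. When $(A,W)$ is regular the dual space $(A,W^* )$ is also prehomogeneous with a non-trivial relative invariant, and its fundamental relative invariant $P^*$ also has degree $p$. *)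

(* Defs.v *)
From HB Require Import structures.
From mathcomp Require Import all_boot all_order all_algebra.
From mathcomp Require Import complex.
From mathcomp Require Import boolp classical_sets reals.
From mathcomp Require Import mpoly.
From mathcomp Require Import ring.

Set Implicit Arguments.
Unset Strict Implicit.
Unset Printing Implicit Defensive.

Import GRing.Theory Num.Theory.

Local Open Scope ring_scope.
Local Open Scope classical_set_scope.

HB.mixin Record Lmodule_isLieAlgebra (K : fieldType) L of GRing.Lmodule K L := {
  lie : L -> L -> L;
  lie_linearl : forall y, linear (lie^~ y);
  lie_linearr : forall x, linear (lie x);
  liexx : forall x, lie x x = 0;
  lie_jacobi : forall x y z,
    lie x (lie y z) + lie y (lie z x) + lie z (lie x y) = 0
}.

#[short(type="lieAlgType")]
HB.structure Definition LieAlgebra (K : fieldType) :=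
  {L of Lmodule_isLieAlgebra K L & GRing.Lmodule K L}.

Section Gl.
Variables (K : fieldType) (n : nat).

Definition mxlie (x y : 'M[K]_n) := x *m y - y *m x.

Lemma mxlie_linearl y : linear (mxlie^~ y).
Proof.
move=> a u v; rewrite /mxlie mulmxDl mulmxDr -scalemxAl -scalemxAr scalerBr.
by rewrite opprD addrACA.
Qed.

Lemma mxlie_linearr x : linear (mxlie x).
Proof.
move=> a u v; rewrite /mxlie mulmxDl mulmxDr -scalemxAl -scalemxAr scalerBr.
by rewrite opprD addrACA.
Qed.

Lemma mxliexx x : mxlie x x = 0.
Proof. exact: subrr. Qed.

Lemma mxlie_jacobi x y z :
  mxlie x (mxlie y z) + mxlie y (mxlie z x) + mxlie z (mxlie x y) = 0.
Proof.
rewrite /mxlie !mulmxBl !mulmxBr !mulmxA !opprB.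
set a := x *m y *m z; set b := x *m z *m y; set c := y *m z *m x.
set d := z *m y *m x; set e := y *m x *m z; set f := z *m x *m y.
rewrite !addrA; apply/matrixP => i j; rewrite !mxE.
ring.
Qed.

HB.instance Definition _ := Lmodule_isLieAlgebra.Build K 'M[K]_n
  mxlie_linearl mxlie_linearr mxliexx mxlie_jacobi.

End Gl.

Section LieTheory.
Variables (K : fieldType) (L : lieAlgType K).
Implicit Types (S T G : set L).

Definition subspace S :=
  S 0 /\ forall (a : K) x y, S x -> S y -> S (a *: x + y).

Definition lie_subalgebra S :=
  subspace S /\ forall x y, S x -> S y -> S (lie x y).

Definition lie_ideal S :=
  subspace S /\ forall x y, S y -> S (lie x y).

Definition lie_generated G : set L := smallest lie_subalgebra G.

Definition derived_algebra S : set L :=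
  smallest subspace [set z | exists x y, [/\ S x, S y & z = lie x y]].

Definition centralizer S : set L :=
  [set x | forall y, S y -> lie x y = 0].

Definition dual_pair S T := centralizer S = T /\ centralizer T = S.

Definition sl2_triple (y h x : L) :=
  [/\ lie h x = 2 *: x, lie h y = - 2 *: y & lie y x = h].

Definition isomorphic_sl2 S := exists phi : {linear 'M[K]_2 -> L},
  [/\ forall U V, \tr U = 0 -> \tr V = 0 -> phi (lie U V) = lie (phi U) (phi V),
      forall U, \tr U = 0 -> phi U = 0 -> U = 0
    & S = phi @` [set U | \tr U = 0]].

Definition nondeg_invariant_form (B : L -> L -> K) :=
  [/\ forall y, scalar (B^~ y),
      forall x y, B x y = B y x,
      forall x y z, B (lie x y) z = B x (lie y z)
    & forall x, (forall y, B x y = 0) -> x = 0].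

Definition lie_grading (G : int -> set L) :=
  [/\ forall i, subspace (G i),
      forall i j x y, G i x -> G j y -> G (i + j) (lie x y),
      forall x, exists (s : seq int) (c : int -> L),
        (forall i, G i (c i)) /\ x = \sum_(i <- s) c i
    & forall (s : seq int) (c : int -> L), uniq s -> (forall i, G i (c i)) ->
        \sum_(i <- s) c i = 0 -> forall i, i \in s -> c i = 0].

Definition graded_ideal (G : int -> set L) (I : set L) :=
  lie_ideal I /\ forall x, I x -> exists (s : seq int) (c : int -> L),
    (forall i, G i (c i) /\ I (c i)) /\ x = \sum_(i <- s) c i.

Definition local_part (G : int -> set L) : set L :=
  [set x | exists y z t, [/\ G (-1) y, G 0 z, G 1 t & x = y + z + t]].

End LieTheory.

Section MinimalGraded.
Variables (K : fieldType) (g0 : lieAlgType K) (V : vectType K).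
Variables (B0 : g0 -> g0 -> K) (rho : g0 -> 'End(V)).

Definition contragredient (U : g0) (Y : 'Hom(V, K^o)) : 'Hom(V, K^o) :=
  - (Y \o rho U)%VF.

(** The minimal graded Lie algebra with local part V^* + g0 + V, given by its
    defining properties, which determine it up to isomorphism.
    [mg_m], [mg_0], [mg_p] identify V^*, g0, V with the components of degree
    -1, 0, 1.  As [B0] is non-degenerate, [mg_pm] determines [X, Y]. *)
Record minimal_graded := MinimalGraded {
  mg_alg :> lieAlgType K;
  mg_comp : int -> set mg_alg;
  mg_m : {linear 'Hom(V, K^o) -> mg_alg};
  mg_0 : {linear g0 -> mg_alg};
  mg_p : {linear V -> mg_alg};
  mg_grading : lie_grading mg_comp;
  mg_m_inj : injective mg_m;
  mg_0_inj : injective mg_0;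
  mg_p_inj : injective mg_p;
  mg_m_range : range mg_m = mg_comp (-1);
  mg_0_range : range mg_0 = mg_comp 0;
  mg_p_range : range mg_p = mg_comp 1;
  mg_00 : forall U U', lie (mg_0 U) (mg_0 U') = mg_0 (lie U U');
  mg_0p : forall U X, lie (mg_0 U) (mg_p X) = mg_p (rho U X);
  mg_0m : forall U Y, lie (mg_0 U) (mg_m Y) = mg_m (contragredient U Y);
  mg_pm : forall X Y, exists2 Z, lie (mg_p X) (mg_m Y) = mg_0 Z &
            forall U, B0 Z U = Y (rho U X);
  mg_generated : lie_generated (local_part mg_comp) = setT;
  mg_minimal : forall I, graded_ideal mg_comp I ->
    I `&` local_part mg_comp = [set 0] -> I = [set 0]
}.

End MinimalGraded.

Section PolynomialType.
Variables (K : fieldType) (n p : nat).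

(** Derivative at g = 1 of (g.P)(x) = P(g^-1 x):
    (U.P)(x) = - \sum_i (U x)_i (d_i P)(x). *)
Definition gl_act (m : nat) (U : 'M[K]_m) (P : {mpoly K[m]}) : {mpoly K[m]} :=
  - \sum_i \sum_j U i j *: ('X_j * P^`M(i)).

Lemma gl_act_homog (U : 'M[K]_n.+1) (P : dhomog n.+1 K p) :
  gl_act U P \is p.-homog.
Proof.
rewrite /gl_act rpredN; apply: rpred_sum => i _; apply: rpred_sum => j _.
apply: rpredZ; case: p P => [|q] P.
  suff -> : (P : {mpoly K[_]})^`M(i) = 0 by rewrite mulr0 rpred0.
  apply/mpolyP => m; rewrite mcoeff_mderiv mcoeff0.
  rewrite (dhomog_nemf_coeff (dhomog_is_dhomog P)) ?mul0rn //=.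
  by rewrite mdegD mdeg1 addn1.
suff hq : (P : {mpoly K[_]})^`M(i) \is q.-homog.
  have hX : 'X_j \is [in K[n.+1], 1.-homog] by rewrite dhomogX /= mdeg1.
  exact: dhomogM hX hq.
apply/dhomogP => m; rewrite mcoeff_msupp mcoeff_mderiv /= => nz.
apply/eqP; apply: contraNT nz => ne.
rewrite (dhomog_nemf_coeff (dhomog_is_dhomog P)) ?mul0rn //=.
by rewrite mdegD mdeg1 addn1 eqSS.
Qed.

Definition gl_act_dhomog U P : dhomog n.+1 K p := DHomog (gl_act_homog U P).

Lemma gl_act_dhomog_is_linear U : linear (gl_act_dhomog U).
Proof.
move=> a P Q; apply: val_inj => /=; rewrite /gl_act scalerN -opprD.
congr (- _); rewrite scaler_sumr -big_split; apply: eq_bigr => i _ /=.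
rewrite scaler_sumr -big_split; apply: eq_bigr => j _ /=.
rewrite mderivD mderivZ mulrDr scalerDr -scalerAr !scalerA.
by rewrite [U i j * a]mulrC.
Qed.

HB.instance Definition _ U := GRing.isLinear.Build K (dhomog n.+1 K p)
  (dhomog n.+1 K p) _ (gl_act_dhomog U) (gl_act_dhomog_is_linear U).

(** U = (U - (tr U / dim W) Id) + (tr U / dim W) Id; the first summand, in sl(W),
    acts naturally and Id acts by [lambda]. *)
Definition rho_lambda (lambda : K) (U : 'M[K]_n.+1) : 'End(dhomog n.+1 K p) :=
  let t := \tr U / n.+1%:R in
  linfun (gl_act_dhomog (U - t%:M)) + (lambda * t) *: \1%VF.

Definition polynomial_type (B0 : 'M[K]_n.+1 -> 'M[K]_n.+1 -> K) (lambda : K) :=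
  minimal_graded B0 (rho_lambda lambda).

Definition diffop (m : nat) (Q P : {mpoly K[m]}) : {mpoly K[m]} :=
  \sum_(k <- msupp Q) Q@_k *: P^`M[k].

(** Q(d)P is a constant polynomial when Q and P have the same degree. *)
Definition pairing (Q P : dhomog n.+1 K p) : K^o := (diffop Q P)@_0.

Lemma pairing_is_linear Q : linear (pairing Q).
Proof.
move=> a P P'; rewrite -[RHS]/(a * (diffop Q P)@_0 + (diffop Q P')@_0).
rewrite -mcoeffZ -mcoeffD /pairing /diffop scaler_sumr -big_split.
congr (_@__); apply: eq_bigr => k _ /=.
by rewrite mderivmD mderivmZ scalerDr !scalerA mulrC.
Qed.

HB.instance Definition _ Q := GRing.isLinear.Build K (dhomog n.+1 K p)
  K^o _ (pairing Q) (pairing_is_linear Q).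

Definition dual_form (Q : dhomog n.+1 K p) : 'Hom(dhomog n.+1 K p, K^o) :=
  linfun (pairing Q).

End PolynomialType.

Section Zariski.
Variables (K : fieldType) (m k : nat).
Implicit Types (S T F : set 'M[K]_(m, k)).

Definition mxeval (f : {mpoly K[m * k]}) (x : 'M[K]_(m, k)) : K :=
  f.@[fun i => mxvec x 0 i].

Definition zariski_closed S := exists F : set {mpoly K[m * k]},
  S = [set x | forall f, F f -> mxeval f x = 0].

Definition zariski_open S := zariski_closed (~` S).

(** Connectedness, irreducibility and dimension of [S] refer to the topology
    induced on [S] by the Zariski topology. *)
Definition zariski_connected S := forall F F', zariski_closed F ->
  zariski_closed F' -> S `<=` F `|` F' -> S `&` F `&` F' = set0 ->
  S `<=` F \/ S `<=` F'.

Definition zariski_irreducible S := S !=set0 /\ forall F F',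
  zariski_closed F -> zariski_closed F' -> S `<=` F `|` F' ->
  S `<=` F \/ S `<=` F'.

Definition irreducible_chain S (d : nat) := exists c : nat -> set 'M[K]_(m, k),
  (forall i, (i <= d)%N -> zariski_irreducible (c i) /\
     exists2 F, zariski_closed F & c i = S `&` F) /\
  (forall i, (i < d)%N -> c i `<` c i.+1).

Definition zariski_dim S (d : nat) :=
  irreducible_chain S d /\ ~ irreducible_chain S d.+1.

End Zariski.

Section AlgebraicGroups.
Variables (K : fieldType) (n : nat).
Implicit Types (A N : set 'M[K]_n.+1).

Definition algebraic_group A :=
  [/\ A `<=` [set g | g \in unitmx], A 1%:M,
      forall g h, A g -> A h -> A (g *m h),
      forall g, A g -> A (invmx g)
    & exists2 F, zariski_closed F & A = [set g | g \in unitmx] `&` F].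

Definition group_center A : set 'M[K]_n.+1 :=
  [set g | A g /\ forall h, A h -> g *m h = h *m g].

Definition unipotent_group N :=
  forall g, N g -> exists d : nat, (g - 1) ^+ d = 0.

(** The unipotent radical of [A] is trivial. *)
Definition reductive A := forall N, algebraic_group N -> zariski_connected N ->
  N `<=` A -> (forall g h, A g -> N h -> N (g *m h *m invmx g)) ->
  unipotent_group N -> N = [set 1%:M].

(** Tangent space at 1, inside gl(W), to the zero set of the ideal of [A]. *)
Definition lie_of_group A : set 'M[K]_n.+1 :=
  [set U | forall f, (forall g, A g -> mxeval f g = 0) ->
     \sum_i mxvec U 0 i * mxeval f^`M(i) 1%:M = 0].

(** From here on [A] acts on W = K^(n+1) seen as column vectors. *)
Definition irreducible_module A := forall S : {vspace 'cV[K]_n.+1},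
  (forall g x, A g -> x \in S -> g *m x \in S) -> S = 0%VS \/ S = fullv.

Definition prehomogeneous A := exists x : 'cV[K]_n.+1,
  zariski_open [set g *m x | g in A].

(** The regular functions on GL(W) are the polynomials divided by powers of the
    determinant. *)
Definition rational_character A (chi : 'M[K]_n.+1 -> K) :=
  [/\ forall g, A g -> chi g != 0,
      forall g h, A g -> A h -> chi (g *m h) = chi g * chi h
    & exists (q : {mpoly K[n.+1 * n.+1]}) (d : nat),
        forall g, A g -> chi g = mxeval q g / \det g ^+ d].

Definition veval (f : {mpoly K[n.+1]}) (x : 'cV[K]_n.+1) : K :=
  f.@[fun i => x i 0].

(** The pair [(a, b)] with [b != 0] stands for the rational function a / b. *)
Implicit Type f : {mpoly K[n.+1]} * {mpoly K[n.+1]}.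

Definition relative_invariant A f :=
  [/\ f.1 != 0, f.2 != 0 & exists2 chi, rational_character A chi &
      forall g x, A g -> veval f.1 (g *m x) * veval f.2 x =
        chi g * (veval f.1 x * veval f.2 (g *m x))].

Definition rat_mderiv (i : 'I_n.+1) f : {mpoly K[n.+1]} * {mpoly K[n.+1]} :=
  (f.1^`M(i) * f.2 - f.1 * f.2^`M(i), f.2 ^+ 2).

Definition hessian f : 'M[{fraction {mpoly K[n.+1]}}]_n.+1 :=
  \matrix_(i, j) let h := rat_mderiv i (rat_mderiv j f) in
    tofrac h.1 / tofrac h.2.

Definition regular A := exists2 f, relative_invariant A f &
  \det (hessian f) != 0.

Definition irreducible_mpoly (P : {mpoly K[n.+1]}) :=
  [/\ P != 0, P \isn't a GRing.unit
    & forall Q Q', P = Q * Q' -> Q \is a GRing.unit \/ Q' \is a GRing.unit].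

Definition fundamental_relative_invariant A (P : {mpoly K[n.+1]}) :=
  irreducible_mpoly P /\ relative_invariant A (P, 1).

(** Image of [A] in the general linear group of the dual space of W, in the dual
    basis: (g.y)(x) = y(g^-1 x). *)
Definition dual_group A : set 'M[K]_n.+1 := [set (invmx g)^T | g in A].

End AlgebraicGroups.

(* Main.v *)
Require Import Defs.
From HB Require Import structures.
From mathcomp Require Import all_boot all_order all_algebra.
From mathcomp Require Import complex.
From mathcomp Require Import boolp classical_sets reals.
From mathcomp Require topology normedtype derive.

(** Let C be the field of complex numbers, V the space of polynomials of degree
    p on W, and s the annihilator of P in gl(W). Euler's formula splits the Lie
    algebra a of A as C Id + s. The theorem rests on two facts about s.

    - Whatever the connected group A can see, s can see. A family of functions
      on A that solves a homogeneous linear differential system along a and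
      vanishes at 1 vanishes on A ([connected_linear_system]). This is
      Cartier's argument in characteristic 0: the family lies in every power of
      the maximal ideal of the point, hence is zero nearby by Krull's
      intersection theorem, and connectedness spreads the vanishing. Applied to
      matrix coefficients it shows that the image of a matrix preserved by s is
      trivial ([stab_image_irreducible]) and that the centralizer of s is made
      of scalars ([stab_centralizer_scalar]); applied to Q / P on the open
      orbit it shows that the invariants of s in V are the multiples of P
      ([stab_invariants]).

    - There is a Hermitian metric on W for which s is stable under adjoints.
      Following Kempf and Ness, minimise the Fischer norm of P o k over
      det k = 1. At a minimum k the polynomial x = P o k is orthogonal to U.x
      for every traceless U, and if V.x = 0 then |V^*.x|^2 = <[V, V^*].x, x> = 0.
      The minimum exists ([norm_min]): the same computation for the norm plus
      e |k|^2 shows that, were the minimisers to diverge as e tends to 0, the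
      limit of k / |k| would be a singular matrix with image preserved by s,
      against irreducibility.

    Write (X, Y) for the Fischer form, so that pairing with Q is Q(d), and let
    l(Q) = <Q o k, x>, the linear form given by the polynomial
    P^* = conj(x) o k^T ([dual_invariant]). Orthogonality gives at once that l
    kills s.V and sl(W).P, that l(P) = |x|^2 is not 0, that every linear form
    killing s.V is a multiple of l, that P^* is a relative invariant of the dual
    group, and that s is traceless and equal to [a, a]. As P^* is the image of
    P under a ring automorphism, it is irreducible. An invariant form pairs Id
    with a nonzero multiple of the trace, so that [P^*, P] is a nonzero multiple
    of Id, which a rescaling of P^* turns into H_0.

    The local part of the centralizer of a' = s is read off degree by degree
    from these facts: C P^*, scalars, C P. Finally H_0 acts on the component of
    degree i as 2 i, since the local part generates; so the centralizer of the
    sl(2)-triple lies in gl(W) and kills P, which puts it in s. *)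

(** * Extreme values of real polynomial functions of a complex matrix *)

Set Implicit Arguments.
Unset Strict Implicit.
Unset Printing Implicit Defensive.

Import Order.TTheory GRing.Theory Num.Theory.

Local Open Scope ring_scope.
Local Open Scope classical_set_scope.


(** Polynomial functions of the entries of a matrix and of their conjugates,
    that is, real polynomial functions. *)
Inductive mxpolyfun (C : numClosedFieldType) (n : nat) : ('M[C]_n -> C) -> Prop :=
| mxpolyfun_cst c : mxpolyfun (fun=> c)
| mxpolyfun_entry i j : mxpolyfun (fun k => k i j)
| mxpolyfun_add f g : mxpolyfun f -> mxpolyfun g -> mxpolyfun (fun k => f k + g k)
| mxpolyfun_mul f g : mxpolyfun f -> mxpolyfun g -> mxpolyfun (fun k => f k * g k)
| mxpolyfun_conj f : mxpolyfun f -> mxpolyfun (fun k => (f k)^*).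

Module ExtremeValue.
Import topology normedtype derive.
Import numFieldNormedType.Exports.

Section S.
Variables (R : realType) (n : nat).
Local Notation C := R[i].

(** Compactness is available in real coordinates, so matrices are encoded by the
    real and imaginary parts of their entries. *)
Definition mx_of_coords (v : 'rV[R]_(n * n + n * n)) : 'M[C]_n :=
  \matrix_(i, j) (v 0 (lshift _ (mxvec_index i j)) +i* v 0 (rshift _ (mxvec_index i j)))%C.

Definition coords_of_mx (k : 'M[C]_n) : 'rV[R]_(n * n + n * n) :=
  row_mx (mxvec (map_mx (@complex.Re R) k)) (mxvec (map_mx (@complex.Im R) k)).

Lemma coords_of_mxK : cancel coords_of_mx mx_of_coords.
Proof.
move=> k; apply/matrixP => i j; rewrite mxE row_mxEl row_mxEr !mxvecE !mxE.
by case: (k i j).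
Qed.

Lemma mxpolyfun_continuous (f : 'M[C]_n -> C) : mxpolyfun f ->
  continuous (fun v => complex.Re (f (mx_of_coords v))) /\
  continuous (fun v => complex.Im (f (mx_of_coords v))).
Proof.
elim=> [c|i j|{}f g _ [cf cf'] _ [cg cg']|{}f g _ [cf cf'] _ [cg cg']|{}f _ [cf cf']].
- by split=> v; exact: cst_continuous.
- split=> v /=.
    have -> : (fun v => complex.Re (mx_of_coords v i j)) = (fun v => v 0 (lshift _ (mxvec_index i j))).
      by apply/funext => w; rewrite mxE.
    exact: coord_continuous.
  have -> : (fun v => complex.Im (mx_of_coords v i j)) = (fun v => v 0 (rshift _ (mxvec_index i j))).
    by apply/funext => w; rewrite mxE.
  exact: coord_continuous.
- have -> : (fun v => complex.Re (f (mx_of_coords v) + g (mx_of_coords v))) =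
     (fun v => complex.Re (f (mx_of_coords v))) \+ (fun v => complex.Re (g (mx_of_coords v))).
    by apply/funext => w; rewrite raddfD.
  have -> : (fun v => complex.Im (f (mx_of_coords v) + g (mx_of_coords v))) =
     (fun v => complex.Im (f (mx_of_coords v))) \+ (fun v => complex.Im (g (mx_of_coords v))).
    by apply/funext => w; rewrite raddfD.
  by split=> v; apply: continuousD; [exact: cf|exact: cg|exact: cf'|exact: cg'].
- pose fR v := complex.Re (f (mx_of_coords v)); pose fI v := complex.Im (f (mx_of_coords v)).
  pose gR v := complex.Re (g (mx_of_coords v)); pose gI v := complex.Im (g (mx_of_coords v)).
  have -> : (fun v => complex.Re (f (mx_of_coords v) * g (mx_of_coords v))) =
     (fR \* gR) \- (fI \* gI).
    by apply/funext => w; rewrite /fR /fI /gR /gI /=; case: (f _); case: (g _).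
  have -> : (fun v => complex.Im (f (mx_of_coords v) * g (mx_of_coords v))) =
     (fR \* gI) \+ (fI \* gR).
    by apply/funext => w; rewrite /fR /fI /gR /gI /=; case: (f _); case: (g _).
  split=> v.
    by apply: (@continuousB _ _ _ (fR \* gR) (fI \* gI)); apply: continuousM;
      [exact: cf|exact: cg|exact: cf'|exact: cg'].
  by apply: (@continuousD _ _ _ (fR \* gI) (fI \* gR)); apply: continuousM;
    [exact: cf|exact: cg'|exact: cf'|exact: cg].
- have -> : (fun v => complex.Re (f (mx_of_coords v))^*) =
     (fun v => complex.Re (f (mx_of_coords v))).
    by apply/funext => w; case: (f _).
  have -> : (fun v => complex.Im (f (mx_of_coords v))^*) =
     (fun v => - complex.Im (f (mx_of_coords v))).
    by apply/funext => w; case: (f _).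
  split=> // v.
  by apply: (@continuousN _ _ _ (fun v => complex.Im (f (mx_of_coords v)))); exact: cf'.
Qed.

(** The constraints are inequalities 0 <= c k of complex numbers, which force
    c k to be real; an equation is a pair of opposite constraints. *)
Lemma mxpolyfun_min (S : set 'M[C]_n) (Cs : set ('M[C]_n -> C)) (F : 'M[C]_n -> C) (M : C) :
  S !=set0 -> S = [set k | forall c, Cs c -> 0 <= c k] ->
  (forall c, Cs c -> mxpolyfun c) -> mxpolyfun F ->
  (forall k i j, S k -> `|k i j| <= M) ->
  (forall k, S k -> F k \is Num.real) ->
  exists2 k0, S k0 & forall k, S k -> F k0 <= F k.
Proof.
move=> [k1 Sk1] SE polC polF Sbd Freal.
pose f v := complex.Re (F (mx_of_coords v)).
have [contF _] := mxpolyfun_continuous polF.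
pose T := [set v | S (mx_of_coords v)].
have Tclosed : closed T.
  have -> : T = \bigcap_(c in Cs) ([set v | 0 <= complex.Re (c (mx_of_coords v))]
       `&` [set v | complex.Im (c (mx_of_coords v)) = 0]).
    rewrite /T SE; apply/seteqP; split=> v /= h c cC.
      by have := h c cC; rewrite lecE /= => /andP[/eqP -> ->].
    by have [h1 h2] := h c cC; rewrite lecE /= h1 h2 eqxx.
  apply: closed_bigI => c /polC/mxpolyfun_continuous[c1 c2].
  apply: closedI.
    by apply: (@closed_comp _ _ _ [set x : R | 0 <= x]) => [v _|]; [exact: c1|exact: closed_ge].
  by apply: (@closed_comp _ _ _ [set x : R | x = 0]) => [v _|]; [exact: c2|exact: closed_eq].
have Tbd : bounded_set T.
  exists `|complex.Re M|; split; first exact: num_real.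
  move=> M' ltM' v Tv; rewrite /Num.norm /= mx_normrE.
  have entry_le i j : `|v 0 (lshift _ (mxvec_index i j))| <= M' /\
                      `|v 0 (rshift _ (mxvec_index i j))| <= M'.
    have := Sbd _ i j Tv; rewrite mxE lecE /= => /andP[_ leM].
    split; apply: le_trans (ltW ltM'); apply: le_trans (ler_norm _);
      by apply: le_trans leM; rewrite -sqrtr_sqr ler_wsqrtr // ?lerDl ?lerDr sqr_ge0.
  apply: bigmax_le => [|[a b] _ /=]; first exact: le_trans (normr_ge0 _) (ltW ltM').
  rewrite ord1; case: (splitP b) => c bc.
    have -> : b = lshift _ c by apply: val_inj.
    by case/mxvec_indexP: c {bc} => i j; case: (entry_le i j).
  have -> : b = rshift _ c by apply: val_inj.
  by case/mxvec_indexP: c {bc} => i j; case: (entry_le i j).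
have Tcpt := bounded_closed_compact Tbd Tclosed.
have T0 : T !=set0 by exists (coords_of_mx k1); rewrite /T /= coords_of_mxK.
have [v0 v0T vmin] := @EVT_min_rV R _ f T T0 Tcpt (continuous_subspaceT contF).
rewrite inE in v0T.
exists (mx_of_coords v0) => // k Sk.
have := vmin (coords_of_mx k); rewrite inE /T /= coords_of_mxK /f => /(_ Sk).
rewrite coords_of_mxK => h.
have := Freal _ Sk; have := Freal _ v0T.
move: h; rewrite !realE !lecE /=; case: (F _) => a b; case: (F k) => c d /=.
by move=> -> /orP[]/andP[/eqP -> _] /orP[]/andP[/eqP -> _]; rewrite eqxx.
Qed.
End S.
End ExtremeValue.

From mathcomp Require Import ssrcomplements mpoly.
From mathcomp Require Import ring.

(** * Noetherian rings *)

Section Noetherian.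

(** The finiteness of ideals, in the form used by Krull's theorem: some term of
    any sequence is a combination of the earlier ones. *)
Definition noetherian (B : comNzRingType) := forall F : nat -> B,
  exists (r : nat) (G : nat -> B), F r = \sum_(i < r) G i * F i.

Definition in_ideal (B : comNzRingType) (s : seq B) (p : B) :=
  exists G : nat -> B, p = \sum_(i < size s) G i * s`_i.

Lemma in_idealD (B : comNzRingType) (s : seq B) a p q : in_ideal s p -> in_ideal s q -> in_ideal s (a * p + q).
Proof.
move=> [G ->] [H ->]; exists (fun i => a * G i + H i).
by rewrite mulr_sumr -big_split; apply: eq_bigr => i _; rewrite mulrDl mulrA.
Qed.

Lemma in_ideal0 (B : comNzRingType) (s : seq B) : in_ideal s 0.
Proof. by exists (fun=> 0); rewrite big1 // => i _; rewrite mul0r. Qed.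

Lemma in_ideal_sum (B : comNzRingType) (s : seq B) r (a p : nat -> B) :
  (forall i, (i < r)%N -> in_ideal s (p i)) -> in_ideal s (\sum_(i < r) a i * p i).
Proof.
elim: r => [|r IHr] sp; first by rewrite big_ord0; exact: in_ideal0.
rewrite big_ord_recr /= addrC; apply: in_idealD; first exact: sp.
by apply: IHr => i ir; apply: sp; exact: ltnW.
Qed.

Lemma in_ideal_nth (B : comNzRingType) (s : seq B) i : (i < size s)%N -> in_ideal s s`_i.
Proof.
move=> ir; exists (fun j => (j == i)%:R).
rewrite (bigD1 (Ordinal ir)) //= eqxx mul1r big1 ?addr0 // => j ji.
by rewrite -val_eqE /= in ji; rewrite (negPf ji) mul0r.
Qed.

Lemma noetherian_field (K : fieldType) : noetherian K.
Proof.
move=> F; have [F0|F0] := eqVneq (F 0%N) 0.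
  by exists 0%N, (fun=> 0); rewrite big_ord0.
by exists 1%N, (fun=> F 1%N / F 0%N); rewrite big_ord1 divfK.
Qed.

(** Hilbert's basis theorem: in an ideal without finite generation, choose
    successive elements of minimal degree outside the ideal of the previous
    ones; a relation between leading coefficients lowers a degree. *)
Lemma noetherian_poly (B : comNzRingType) : noetherian B -> noetherian {poly B}.
Proof.
move=> nB F; apply: contrapT => noF.
pose Fs r := mkseq F r.
pose I p := exists r, in_ideal (Fs r) p.
have Fsub r s p : (r <= s)%N -> in_ideal (Fs r) p -> in_ideal (Fs s) p.
  move=> rs [G ->]; apply: (@in_ideal_sum _ _ _ G (fun i => (Fs r)`_i)) => i; rewrite size_mkseq => ir.
  have -> : (Fs r)`_i = (Fs s)`_i by rewrite !nth_mkseq // (leq_trans ir).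
  by apply: in_ideal_nth; rewrite size_mkseq (leq_trans ir).
have ID a p q : I p -> I q -> I (a * p + q).
  move=> [r rp] [s sq]; exists (maxn r s); apply: in_idealD.
    by apply: Fsub rp; exact: leq_maxl.
  by apply: Fsub sq; exact: leq_maxr.
(* next s has minimal size among the elements of I that s does not generate *)
have /choice[next nextP] : forall s, exists p, (forall i, (i < size s)%N -> I s`_i) ->
    [/\ I p, ~ in_ideal s p &
       forall q, I q -> ~ in_ideal s q -> (size p <= size q)%N].
  move=> s.
  have [Is|nIs] := pselect (forall i, (i < size s)%N -> I s`_i); last by exists 0.
  have [r Ir] : exists r, forall i, (i < size s)%N -> in_ideal (Fs r) s`_i.
    elim: s Is => [|p s IHs] Is; first by exists 0%N.
    have [r Ir] := IHs (fun i => Is i.+1); have [r' Ir'] := Is 0%N isT.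
    exists (maxn r r') => -[|i] /= ilt.
      by apply: Fsub Ir'; exact: leq_maxr.
    by apply: Fsub (Ir _ ilt); exact: leq_maxl.
  have nFr : ~ in_ideal s (F r).
    move=> [G FrG]; apply: noF; exists r.
    have : in_ideal (Fs r) (F r) by rewrite FrG; apply: (@in_ideal_sum _ _ _ G (fun i => s`_i)).
    move=> [H HF]; exists H; rewrite HF size_mkseq; apply: eq_bigr => i _.
    by rewrite nth_mkseq.
  have IFr : I (F r).
    exists r.+1; have -> : F r = (Fs r.+1)`_r by rewrite nth_mkseq.
    by apply: in_ideal_nth; rewrite size_mkseq.
  pose Q n := `[< exists p, [/\ I p, ~ in_ideal s p & size p = n] >].
  have exQ : exists n, Q n by exists (size (F r)); apply/asboolP; exists (F r).
  case: (ex_minnP exQ) => n /asboolP[p [Ip np <-]] pmin.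
  by exists p => _; split=> // q Iq nq; apply: pmin; apply/asboolP; exists q.
pose L := fix L k := if k is k'.+1 then rcons (L k') (next (L k')) else [::].
pose f k := next (L k).
have szL k : size (L k) = k by elim: k => //= k IHk; rewrite size_rcons IHk.
have nthL k i : (i < k)%N -> (L k)`_i = f i.
  elim: k => // k IHk; rewrite ltnS leq_eqVlt /= nth_rcons szL => /orP[/eqP ->|ik].
    by rewrite ltnn eqxx.
  by rewrite ik IHk.
have fP k : [/\ I (f k), ~ in_ideal (L k) (f k) &
    forall q, I q -> ~ in_ideal (L k) q -> (size (f k) <= size q)%N].
  elim/ltn_ind: k => k IHk; apply: nextP => i; rewrite szL => ik.
  by rewrite nthL //; have [] := IHk _ ik.
have Lmono j k p : (j <= k)%N -> in_ideal (L j) p -> in_ideal (L k) p.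
  move=> jk [G ->]; apply: (@in_ideal_sum _ _ _ G (fun i => (L j)`_i)) => i; rewrite szL => ij.
  have ik := leq_trans ij jk.
  by rewrite nthL // -(nthL k) //; apply: in_ideal_nth; rewrite szL.
have fmono j k : (j <= k)%N -> (size (f j) <= size (f k))%N.
  move=> jk; have [_ _ ] := fP j; apply; first by have [] := fP k.
  by have [_ nk _] := fP k; apply: contra_not nk; exact: Lmono.
have [r [u ru]] := nB (fun k => lead_coef (f k)).
(* q cancels the leading term of f r, against the minimality of its size *)
pose q := f r - \sum_(i < r) (u i)%:P * 'X^(size (f r) - size (f i)) * f i.
have [Ir nr minr] := fP r.
have sumI r' : (r' <= r)%N ->
    I (\sum_(i < r') (u i)%:P * 'X^(size (f r) - size (f i)) * f i).
  elim: r' => [|r' IHr] r'r; first by rewrite big_ord0; exists 0%N; exact: in_ideal0.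
  rewrite big_ord_recr /= addrC; apply: ID; last by apply: IHr; exact: ltnW.
  by have [] := fP r'.
have Iq : I q by rewrite /q addrC -mulN1r; apply: ID => //; exact: sumI.
have nq : ~ in_ideal (L r) q.
  move=> rq; apply: nr; rewrite -(subrK (\sum_(i < r) (u i)%:P * 'X^(size (f r) - size (f i)) * f i) (f r)).
  rewrite -/q -[q]mul1r; apply: in_idealD => //.
  apply: (@in_ideal_sum _ _ _ (fun i => (u i)%:P * 'X^(size (f r) - size (f i))) f) => i ir.
  by rewrite -(nthL r) //; apply: in_ideal_nth; rewrite szL.
have f0 : f r != 0 by apply/eqP => fr0; apply: nr; rewrite fr0; exact: in_ideal0.
have := minr q Iq nq; rewrite leqNgt => /negP; apply.
rewrite -(ltn_predK (m := 0) (n := size (f r))) ?size_poly_gt0 // ltnS.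
apply/leq_sizeP => j; rewrite leq_eqVlt => /orP[/eqP <-|jlt].
  rewrite /q coefB -lead_coefE ru coef_sum; apply/eqP; rewrite subr_eq0; apply/eqP.
  apply: eq_bigr => i _; rewrite -mulrA coefCM coefXnM.
  have fi0 : f i != 0.
    apply/eqP => fi0; have [_ + _] := fP i; apply; rewrite fi0; exact: in_ideal0.
  have := fmono _ _ (ltnW (ltn_ord i)); move: (fi0) f0; rewrite -!size_poly_gt0 lead_coefE.
  case: (size (f i)) => // a; case: (size (f r)) => // b _ _; rewrite ltnS subSS /= => ab.
  by rewrite ltnNge leq_subr /= subKn.
have rj : (size (f r) <= j)%N by move: jlt; case: (size (f r)).
rewrite /q coefB coef_sum nth_default // big1 ?subrr // => i _.
rewrite -mulrA coefCM coefXnM; case: ltnP => _; first by rewrite mulr0.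
rewrite nth_default ?mulr0 //; have := fmono _ _ (ltnW (ltn_ord i)) => ir.
by rewrite leq_subRL ?subnK // (leq_trans (leq_subr _ _)).
Qed.

(** Hilbert's theorem for the subalgebra generated by s, which need not be a
    type of its own; Q records that the covering ring maps into it. This covers
    both polynomial rings and Rees algebras. *)
Lemma noetherian_cover (K : fieldType) (B : comNzRingType) (phi0 : {rmorphism K -> B}) (s : seq B) :
  exists (S : comNzRingType) (phi : {rmorphism S -> B}), [/\ noetherian S,
    forall c, exists z, phi z = phi0 c, forall b, b \in s -> exists z, phi z = b
    & forall Q : B -> Prop, (forall c, Q (phi0 c)) -> (forall b, b \in s -> Q b) ->
      (forall a b, Q a -> Q b -> Q (a + b)) -> (forall a b, Q a -> Q b -> Q (a * b)) ->
      forall z, Q (phi z)].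
Proof.
elim: s => [|b s [S [phi [nS phiK phis phiQ]]]].
  by exists K, phi0; split=> // [|c]; [exact: noetherian_field|exists c].
have cb : commr_rmorph phi b by move=> z; exact: mulrC.
exists {poly S}, (horner_morph cb); split; first exact: noetherian_poly.
- by move=> c; have [z <-] := phiK c; exists z%:P; exact: horner_morphC.
- move=> x; rewrite inE => /orP[/eqP ->|/phis[z <-]].
    by exists 'X; exact: horner_morphX.
  by exists z%:P; exact: horner_morphC.
- move=> Q QK Qs QD QM.
  have QS : forall z, Q (phi z).
    by apply: phiQ => // x xs; apply: Qs; rewrite inE xs orbT.
  elim/poly_ind => [|p z Qp].
    by rewrite rmorph0 -(rmorph0 phi0).
  rewrite rmorphD rmorphM /= horner_morphX horner_morphC.
  by apply: QD => //; apply: QM => //; apply: Qs; exact: mem_head.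
Qed.

End Noetherian.

Lemma mpoly_ring_ind (n : nat) (B : nzRingType) (Q : {mpoly B[n]} -> Prop) :
  (forall c, Q c%:MP) -> (forall i, Q 'X_i) ->
  (forall p q, Q p -> Q q -> Q (p + q)) -> (forall p q, Q p -> Q q -> Q (p * q)) ->
  forall p, Q p.
Proof.
move=> QC QX QD QM p; rewrite (mpolyE p).
elim: (msupp p : seq 'X_{1..n}) => [|m s IHs]; first by rewrite big_nil -mpolyC0; exact: QC.
rewrite big_cons; apply: (QD) => //; rewrite -mul_mpolyC; apply: (QM); first exact: QC.
rewrite mpolyXE_id; elim: (index_enum _) => [|i t IHt].
  by rewrite big_nil; exact: QC.
rewrite big_cons; apply: (QM) => //; elim: (m i) => [|d IHd]; first by rewrite expr0; exact: QC.
by rewrite exprS; apply: (QM).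
Qed.

(** * Linear differential systems near a point *)

Section Cartier.
Variables (K : numFieldType) (m : nat).
Local Notation B := {mpoly K[m]}.
Variables (c : 'I_m -> K) (I : B -> Prop).
Hypotheses (I0 : I 0) (ID : forall a p q, I p -> I q -> I (a * p + q))
  (Ic : forall p, I p -> p.@[c] = 0).

Definition centered (e : 'I_m) : B := 'X_e - (c e)%:MP.
Local Notation x := centered.

(** The powers of the maximal ideal of the point c. *)
Fixpoint maxpow (k : nat) (f : B) : Prop :=
  if k is k'.+1 then
    exists q : 'I_m -> B, (forall e, maxpow k' (q e)) /\ f = \sum_e x e * q e
  else True.

Lemma maxpow_lin k a p q : maxpow k p -> maxpow k q -> maxpow k (a * p + q).
Proof.
elim: k a p q => //= k IHk a p q [p' [kp ->]] [q' [kq ->]].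
exists (fun e => a * p' e + q' e); split=> [e|]; first exact: IHk.
rewrite mulr_sumr -big_split; apply: eq_bigr => e _ /=.
by rewrite mulrDr mulrCA.
Qed.

Lemma maxpow0 k : maxpow k 0.
Proof.
elim: k => //= k IHk; exists (fun=> 0); split=> //.
by rewrite big1 // => e _; rewrite mulr0.
Qed.

Lemma maxpowMl k a p : maxpow k p -> maxpow k (a * p).
Proof. by move=> kp; rewrite -[a * p]addr0; apply: maxpow_lin => //; exact: maxpow0. Qed.

Lemma maxpowD k p q : maxpow k p -> maxpow k q -> maxpow k (p + q).
Proof. by move=> kp; rewrite -[p]mul1r; exact: maxpow_lin. Qed.

Lemma maxpow_sum (J : finType) k (F : J -> B) : (forall i, maxpow k (F i)) ->
  maxpow k (\sum_i F i).
Proof. by move=> kF; apply: big_ind => [|p q|i _]; [exact: maxpow0|exact: maxpowD|]. Qed.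

Lemma maxpowX e k p : maxpow k p -> maxpow k.+1 (x e * p).
Proof.
move=> kp; exists (fun a => (a == e)%:R * p); split=> [a|]; first exact: maxpowMl.
rewrite (bigD1 e) //= eqxx mul1r big1 ?addr0 // => a /negPf ->.
by rewrite mul0r mulr0.
Qed.

Lemma maxpowM j k p q : maxpow j p -> maxpow k q -> maxpow (j + k) (p * q).
Proof.
elim: j p => [|j IHj] p; first by move=> _; exact: maxpowMl.
move=> [p' [jp ->]] kq; rewrite mulr_suml addSn.
by apply: maxpow_sum => e; rewrite -mulrA; apply: maxpowX; exact: (IHj _ (jp e)  kq).
Qed.

Lemma maxpow1P p : maxpow 1 p <-> p.@[c] = 0.
Proof.
split=> [[q [_ ->]]|pc].
  rewrite raddf_sum big1 // => e _.
  by rewrite /= mevalM mevalB mevalXU mevalC subrr mul0r.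
suff : maxpow 1 (p - (p.@[c])%:MP) by rewrite pc mpolyC0 subr0.
elim/mpoly_ring_ind: p {pc} => [a|e|p q p1 q1|p q p1 q1].
- by rewrite mevalC subrr; exact: maxpow0.
- by rewrite mevalXU -[X in maxpow 1 X]mulr1; exact: maxpowX.
- by rewrite mevalD mpolyCD opprD addrACA; exact: maxpowD.
- rewrite mevalM mpolyCM.
  have -> : p * q - (p.@[c])%:MP * (q.@[c])%:MP =
    p * (q - (q.@[c])%:MP) + (q.@[c])%:MP * (p - (p.@[c])%:MP).
    by rewrite !mulrBr addrA [p * _%:MP]mulrC subrK [X in _ - X]mulrC.
  by apply: maxpow_lin => //; exact: maxpowMl.
Qed.

Lemma mderiv_centered e a : (x a)^`M(e) = (a == e)%:R.
Proof.
rewrite mderivB mderivC subr0 mderivX mnm1E.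
case: eqVneq => [->|_]; last by rewrite scale0r.
rewrite scale1r (_ : (U_(e) - U_(e))%MM = 0%MM) ?mpolyX0 //; by apply/mnmP => i; rewrite mnmBE mnm0E subnn.
Qed.

Lemma maxpow_mderiv k p e : maxpow k.+1 p -> maxpow k p^`M(e).
Proof.
elim: k p => // k IHk p [q [kq ->]]; rewrite raddf_sum.
apply: maxpow_sum => a /=; rewrite mderivM mderiv_centered.
by apply: (@maxpowD k.+1); [exact: maxpowMl|apply: maxpowX; exact: IHk].
Qed.

(** Euler's vector field at c acts on the k-th graded piece as k. *)
Lemma maxpow_euler k p : maxpow k p -> maxpow k.+1 (\sum_e x e * p^`M(e) - p *+ k).
Proof.
elim: k p => [|k IHk] p.
  by move=> _; rewrite mulr0n subr0; exists (fun e => p^`M(e)).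
move=> [q [kq ->]].
have -> : \sum_e x e * (\sum_a x a * q a)^`M(e) - (\sum_a x a * q a) *+ k.+1 =
    \sum_a x a * (\sum_e x e * (q a)^`M(e) - q a *+ k).
  rewrite -sumrMnl.
  under [X in X - _]eq_bigr do rewrite raddf_sum mulr_sumr.
  rewrite exchange_big /= -sumrB; apply: eq_bigr => a _.
  under eq_bigr do rewrite mderivM mderiv_centered mulrDr.
  rewrite big_split /= (bigD1 a) //= eqxx mul1r big1 ?addr0; last first.
    by move=> e /negPf ea; rewrite eq_sym ea mul0r mulr0.
  rewrite mulrS opprD addrACA subrr add0r mulrBr mulrnAr mulr_sumr.
  by congr (_ - _); apply: eq_bigr => e _; rewrite mulrCA.
by apply: maxpow_sum => a; apply: maxpowX; exact: (IHk _ (kq a)).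
Qed.

(** The k-th power of the maximal ideal in the quotient by I. *)
Definition modpow k p := exists phi, maxpow k phi /\ I (p - phi).

Lemma I_modpow k p : I p -> modpow k p.
Proof. by move=> Ip; exists 0; split; [exact: maxpow0|rewrite subr0]. Qed.

Lemma maxpow_modpow k p : maxpow k p -> modpow k p.
Proof. by move=> kp; exists p; rewrite subrr. Qed.

Lemma modpow_lin k a p q : modpow k p -> modpow k q -> modpow k (a * p + q).
Proof.
move=> [p' [kp Ip]] [q' [kq Iq]]; exists (a * p' + q'); split; first exact: maxpow_lin.
by rewrite opprD addrACA -mulrBr; exact: ID.
Qed.

Lemma modpowMl k a p : modpow k p -> modpow k (a * p).
Proof. by move=> kp; rewrite -[a * p]addr0; apply: modpow_lin => //; exact: I_modpow. Qed.

Lemma modpowD k p q : modpow k p -> modpow k q -> modpow k (p + q).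
Proof. by move=> kp; rewrite -[p]mul1r; exact: modpow_lin. Qed.

Lemma modpowB k p q : modpow k p -> modpow k q -> modpow k (p - q).
Proof. by move=> kp kq; rewrite addrC -mulN1r; exact: modpow_lin. Qed.

Lemma modpow_sum (J : finType) k (F : J -> B) : (forall i, modpow k (F i)) ->
  modpow k (\sum_i F i).
Proof. by move=> kF; apply: big_ind => [|p q|i _]; [exact: I_modpow|exact: modpowD|]. Qed.

Lemma modpowM j k p q : modpow j p -> maxpow k q -> modpow (j + k) (p * q).
Proof.
move=> [p' [jp Ip]] kq; exists (p' * q); split; first exact: maxpowM.
by rewrite -mulrBl mulrC -[_ * _]addr0; exact: ID.
Qed.

Lemma maxpowW j k p : (j <= k)%N -> maxpow k p -> maxpow j p.
Proof.
elim: j k p => // j IHj [//|k] p jk [q [kq ->]].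
by exists q; split=> // e; exact: (IHj k _ jk (kq e)).
Qed.

(** Krull's intersection theorem. For each k write f = F k modulo I with F k in
    the k-th power of the maximal ideal m; the Rees algebra of m is Noetherian,
    so (F r) T^r is a combination of the (F i) T^i with i < r, and the
    coefficient of T^r exhibits f as an element of m f modulo I. *)
Lemma krull_intersection f : (forall k, modpow k f) -> exists2 q, q.@[c] != 0 & I (q * f).
Proof.
move=> /choice[F] /all_and2[kF IF].
pose gens := [seq ('X_e)%:P | e : 'I_m] ++ [seq (x e)%:P * 'X | e : 'I_m].
have [S [phi [nS phiK phis phiQ]]] := noetherian_cover (polyC \o @mpolyC m K) gens.
have phiC p : exists z, phi z = p%:P.
  elim/mpoly_ring_ind: p => [a|e|p q [y yp] [z zq]|p q [y yp] [z zq]].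
  - by have [z za] := phiK a; exists z.
  - by apply: phis; rewrite mem_cat; apply/orP; left; apply/mapP; exists e; rewrite ?mem_enum.
  - by exists (y + z); rewrite rmorphD /= yp zq polyCD.
  - by exists (y * z); rewrite rmorphM /= yp zq polyCM.
have phiX k p : maxpow k p -> exists z, phi z = p%:P * 'X^k.
  elim: k p => [|k IHk] p.
    by move=> _; have [z <-] := phiC p; exists z; rewrite expr0 mulr1.
  move=> [q [kq ->]].
  have /choice[y yx] : forall e : 'I_m, exists y, phi y = (x e)%:P * 'X.
    move=> e; apply: phis; rewrite mem_cat; apply/orP; right; apply/mapP.
    by exists e; rewrite ?mem_enum.
  have /choice[z zq] : forall e, exists z, phi z = (q e)%:P * 'X^k by move=> e; exact: (IHk _ (kq e)).
  exists (\sum_e y e * z e); rewrite rmorph_sum /= rmorph_sum mulr_suml.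
  by apply: eq_bigr => e _; rewrite rmorphM /= yx zq polyCM exprS mulrACA.
have /choice[Z ZF] : forall k, exists z, phi z = (F k)%:P * 'X^k by move=> k; exact: phiX.
have [r [G ZG]] := nS Z.
(* the covering ring maps into the Rees algebra *)
have rees : forall z k, maxpow k (phi z)`_k.
  apply: (phiQ (fun p => forall k, maxpow k p`_k)) => [a k|b|p q kp kq k|p q kp kq k].
  - by rewrite /= coefC; case: eqP => [->|_] //; exact: maxpow0.
  - rewrite mem_cat => /orP[] /mapP[e _ ->] k.
      by rewrite coefC; case: eqP => [->|_] //; exact: maxpow0.
    rewrite coefCM coefX; case: eqP => [->|_]; last by rewrite mulr0; exact: maxpow0.
    exact: maxpowX.
  - by rewrite coefD; exact: maxpowD.
  - rewrite coefM; apply: maxpow_sum => i.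
    by rewrite -{1}(subnKC (ltnSE (ltn_ord i))); exact: maxpowM.
have FE : F r = \sum_(i < r) (phi (G i))`_(r - i) * F i.
  have := congr1 (fun p => (phi p)`_r) ZG.
  rewrite ZF coefCM coefXn eqxx mulr1 => ->; rewrite rmorph_sum coef_sum.
  apply: eq_bigr => i _ /=; rewrite rmorphM /= ZF mulrA coefMXn ltnNge (ltnW (ltn_ord i)) /=.
  by rewrite coefMC.
exists (1 - \sum_(i < r) (phi (G i))`_(r - i)).
  rewrite mevalB meval1 (_ : (\sum_(i < r) _).@[c] = 0) ?subr0 ?oner_neq0 //.
  apply/maxpow1P; apply: maxpow_sum => i; apply: maxpowW (rees _ _).
  by rewrite subn_gt0.
have -> : (1 - \sum_(i < r) (phi (G i))`_(r - i)) * f =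
   1 * (f - F r) + - 1 * \sum_(i < r) (phi (G i))`_(r - i) * (f - F i).
  rewrite mulrBl !mul1r mulN1r; under [in RHS]eq_bigr do rewrite mulrBr.
  by rewrite sumrB -FE opprB addrA subrK mulr_suml.
apply: (ID _ (IF r)); rewrite -[_ * _]addr0; apply: ID => //.
apply: big_ind => [//|p q Ip Iq|i _]; first by rewrite -[p]mul1r; exact: ID.
by rewrite -[_ * _]addr0; exact: ID.
Qed.

Definition gradient (p : B) : 'rV[K]_m := \row_e (p^`M(e)).@[c].

Definition tangent (V : 'I_m -> K) := forall p, I p -> \sum_e V e * (p^`M(e)).@[c] = 0.

(** Taylor's formula to the first order. *)
Lemma maxpow2_taylor p : p.@[c] = 0 ->
  maxpow 2 (p - \sum_e (p^`M(e)).@[c] *: x e).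
Proof.
move=> /maxpow1P[q [_ pE]]; rewrite {1}pE -sumrB.
apply: maxpow_sum => e; rewrite -mul_mpolyC [_%:MP * _]mulrC -mulrBr; apply: maxpowX; apply/maxpow1P.
rewrite mevalB mevalC pE (linear_sum (mderiv e)) (raddf_sum (meval c)) /= (bigD1 e) //= [X in _ - (_ + X)]big1 => [|a /negPf ae].
  rewrite mderivM mderiv_centered eqxx mul1r mevalD mevalM mevalB mevalXU mevalC.
  by rewrite subrr mul0r !addr0 subrr.
rewrite mderivM mderiv_centered ae mul0r add0r mevalM mevalB mevalXU mevalC.
by rewrite subrr mul0r.
Qed.

End Cartier.

(** Turns a subspace given as a predicate into a matrix, on which the theory of
    row spaces applies. *)
Lemma subspace_rowspace (K : fieldType) (m : nat) (S : 'rV[K]_m -> Prop) :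
  S 0 -> (forall a u v, S u -> S v -> S (a *: u + v)) ->
  exists G : 'M[K]_m, forall v, (v <= G)%MS <-> S v.
Proof.
move=> S0 SD; pose Q d := `[< exists G : 'M[K]_m, \rank G = d /\ forall v : 'rV_m, (v <= G)%MS -> S v >].
have exQ : exists d, Q d.
  exists 0%N; apply/asboolP; exists 0; split; first exact: mxrank0.
  by move=> v; rewrite submx0 => /eqP ->.
have Qle d : Q d -> (d <= m)%N by move=> /asboolP[G [<- _]]; exact: rank_leq_row.
case: (ex_maxnP exQ Qle) => d /asboolP[G [<- GS]] Gmax; exists G => v; split=> [/GS//|Sv].
have : Q (\rank (G + v)%MS).
  apply/asboolP; exists (G + v)%MS; split=> // u /sub_addsmxP[[u1 u2] /= ->].
  rewrite -[u1 *m G]scale1r; apply: (SD); first by apply: GS; exact: submxMl.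
  by rewrite [u2]mx11_scalar mul_scalar_mx -[_ *: v]addr0; exact: SD.
move=> /Gmax rk; have [_] := mxrank_leqif_sup (addsmxSl G v).
rewrite eqn_leq (mxrankS (addsmxSl _ _)) rk /= => /esym.
by rewrite addsmx_sub => /andP[].
Qed.

(** Cartier's argument. The coordinates at c agree, modulo I and to the second
    order, with their projections on the tangent space. If all the f i lie in
    the k-th power of the maximal ideal of the zero set of I, so do, by the
    system, their derivatives along that zero set; Euler's field then puts
    k f i in the next power. Characteristic 0 is used to divide by k. *)
Lemma linear_system_vanishing (K : numFieldType) (m : nat) (c : 'I_m -> K)
    (I : {mpoly K[m]} -> Prop) (J : finType) (f : J -> {mpoly K[m]}) :
  I 0 -> (forall a p q, I p -> I q -> I (a * p + q)) ->
  (forall p, I p -> p.@[c] = 0) -> (forall i, (f i).@[c] = 0) ->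
  (forall V, tangent c I V -> exists v : 'I_m -> {mpoly K[m]},
    [/\ forall e, (v e).@[c] = V e,
        forall p, I p -> I (\sum_e v e * p^`M(e))
      & forall i, exists a : J -> {mpoly K[m]},
          I (\sum_e v e * (f i)^`M(e) - \sum_j a j * f j)]) ->
  forall i, exists2 q, q.@[c] != 0 & I (q * f i).
Proof.
move=> I0 ID Ic fc fields i; apply: (krull_intersection I0 ID (c := c)) => k.
have IMl a p : I p -> I (a * p) by move=> Ip; rewrite -[_ * _]addr0; exact: ID.
have [G GP] : exists G : 'M[K]_m, forall v, (v <= G)%MS <->
    (exists2 p, I p & v = gradient c p).
  apply: subspace_rowspace => [|a _ _ [p Ip ->] [q Iq ->]].
    by exists 0 => //; apply/rowP => e; rewrite !mxE mderiv0 meval0.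
  exists (a%:MP * p + q); first exact: ID.
  by apply/rowP => e; rewrite !mxE mul_mpolyC mderivD mderivZ mevalD mevalZ.
(* pi projects onto the tangent space; 1 - pi has its rows in the span of the gradients *)
pose pi := 1%:M - pinvmx G *m G.
have pi_tangent j : tangent c I (fun e => pi e j).
  move=> p Ip; have /submxP[w pw] : (gradient c p <= G)%MS by apply/GP; exists p.
  have : gradient c p *m pi = 0 by rewrite pw mulmxBr mulmx1 mulmxA mulmxKpV ?subrr ?submxMl.
  move=> /rowP/(_ j); rewrite mxE [X in _ = X -> _]mxE => g0; rewrite -[RHS]g0; apply: eq_bigr => e _.
  by rewrite mulrC; congr (_ * _); rewrite mxE.
have copi e : exists2 p, I p & forall j, (p^`M(j)).@[c] = (e == j)%:R - pi e j.
  have /GP[p Ip gp] : (row e (1%:M - pi) <= G)%MS.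
    by rewrite /pi opprB addrC subrK row_mul submxMl.
  exists p => // j; have /rowP/(_ j) := gp; rewrite [X in _ = X -> _]mxE => <-.
  by rewrite mxE [LHS]mxE; congr (_ + _); rewrite ?mxE.
have copi_modpow e : modpow c I 2 (centered c e - \sum_j pi e j *: centered c j).
  have [p Ip gp] := copi e.
  have -> : centered c e - \sum_j pi e j *: centered c j =
      p - (p - \sum_j (p^`M(j)).@[c] *: centered c j).
    rewrite opprB [RHS]addrC subrK; under [RHS]eq_bigr do rewrite gp scalerBl.
    rewrite sumrB; congr (_ - _).
    rewrite (bigD1 e) //= eqxx scale1r big1 ?addr0 // => j ej.
    by rewrite eq_sym (negPf ej) scale0r.
  apply: modpowB => //; first exact: I_modpow.
  by apply: maxpow_modpow => //; apply: maxpow2_taylor => //; exact: Ic.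
elim: k i => [i|k IHk i]; first by exists (f i); rewrite subrr.
case: k IHk => [_|k IHk].
  by apply: maxpow_modpow => //; apply/maxpow1P.
have [phi [kphi Iphi]] := IHk i.
(* freezing the coefficients of the vector field at c changes the derivative
   only by a term of order k + 1 *)
have dirV V : tangent c I V -> modpow c I k.+1 (\sum_e V e *: phi^`M(e)).
  move=> /fields[v [vV vI vf]]; have [a fa] := vf i.
  have -> : \sum_e V e *: phi^`M(e) =
     (\sum_e v e * (f i)^`M(e) - \sum_j a j * f j) + \sum_j a j * f j
     - \sum_e v e * (f i - phi)^`M(e) - \sum_e (v e - (V e)%:MP) * phi^`M(e).
    rewrite subrK -!sumrB; apply: eq_bigr => e _.
    by rewrite mderivB mulrBr mulrBl opprB addrCA subrr addr0 mul_mpolyC opprB addrCA subrr addr0.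
  apply: modpowB => //; last first.
    apply: maxpow_modpow => //; apply: maxpow_sum => e.
    rewrite -[k.+1]/(1 + k)%N; apply: maxpowM; last exact: maxpow_mderiv.
    by apply/maxpow1P; rewrite mevalB mevalC vV subrr.
  apply: modpowB => //; last by apply: I_modpow => //; exact: vI.
  apply: modpowD => //; first exact: I_modpow.
  by apply: modpow_sum => // j; apply: modpowMl => //; exact: IHk.
have Ephi : modpow c I k.+2 (\sum_e centered c e * phi^`M(e)).
  have -> : \sum_e centered c e * phi^`M(e) =
     \sum_j centered c j * (\sum_e pi e j *: phi^`M(e)) +
     \sum_e (centered c e - \sum_j pi e j *: centered c j) * phi^`M(e).
    under [X in X + _]eq_bigr do rewrite mulr_sumr.
    rewrite exchange_big /= -big_split; apply: eq_bigr => e _ /=.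
    rewrite (mulrBl _ (centered c e)) mulr_suml addrC -addrA [X in _ + X]addrC [X in _ + X](_ : _ = 0) ?addr0 //.
    apply/eqP; rewrite subr_eq0; apply/eqP; apply: eq_bigr => j _.
    by rewrite -scalerAl -scalerAr.
  apply: modpowD => //; apply: modpow_sum => // j.
    have [psi [kpsi Ipsi]] := dirV _ (pi_tangent j).
    exists (centered c j * psi); split; first exact: maxpowX.
    by rewrite -mulrBr; exact: IMl.
  by rewrite -[k.+2]/(2 + k)%N; apply: modpowM => //; exact: maxpow_mderiv.
have kphi' : modpow c I k.+2 (phi *+ k.+1).
  rewrite -[_ *+ _](subrK (\sum_e centered c e * phi^`M(e))) -opprB.
  apply: modpowD => //; rewrite -mulN1r; apply: modpowMl => //.
  by apply: maxpow_modpow => //; exact: maxpow_euler.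
have -> : f i = (k.+1%:R^-1)%:MP * (phi *+ k.+1) + (f i - phi).
  by rewrite mul_mpolyC -scaler_nat scalerA mulVf ?pnatr_eq0 // scale1r addrC subrK.
by apply: modpow_lin => //; exact: I_modpow.
Qed.

(** * Linear substitutions *)

Section LinearSubstitution.
Variable K : fieldType.

Lemma mderiv_comp (m k : nat) (t : k.-tuple {mpoly K[m]}) p j :
  (p \mPo t)^`M(j) = \sum_i (p^`M(i) \mPo t) * (tnth t i)^`M(j).
Proof.
elim/mpoly_ring_ind: p => [c|i|p q IHp IHq|p q IHp IHq].
- by rewrite comp_mpolyC mderivC big1 // => i _; rewrite mderivC comp_mpoly0 mul0r.
- rewrite comp_mpolyXU -tnth_nth (bigD1 i) //= big1 ?addr0 => [|l li].
    rewrite mderivX mnm1E eqxx scale1r (_ : (U_(i) - U_(i))%MM = 0%MM).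
      by rewrite mpolyX0 comp_mpoly1 mul1r.
    by apply/mnmP => a; rewrite mnmBE mnm0E subnn.
  by rewrite mderivX mnm1E eq_sym (negPf li) scale0r comp_mpoly0 mul0r.
- rewrite comp_mpolyD mderivD IHp IHq -big_split; apply: eq_bigr => i _ /=.
  by rewrite mderivD comp_mpolyD mulrDl.
- rewrite rmorphM /= mderivM IHp IHq mulr_suml mulr_sumr -big_split.
  apply: eq_bigr => i _ /=; rewrite mderivM rmorphD !rmorphM /= mulrDl.
  by rewrite mulrAC mulrA.
Qed.

(** [linsub L p] is the function x |-> p (L x). *)
Definition linsub (m k : nat) (L : 'M[K]_(k, m)) (p : {mpoly K[k]}) : {mpoly K[m]} :=
  p \mPo [tuple \sum_j L i j *: 'X_j | i < k].

Section Fixed.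
Variables (m k : nat) (L : 'M[K]_(k, m)).

HB.instance Definition _ := GRing.LRMorphism.copy (linsub L)
  (comp_mpoly [tuple \sum_j L i j *: 'X_j | i < k]).

Lemma linsubC c : linsub L c%:MP = c%:MP.
Proof. exact: comp_mpolyC. Qed.

Lemma linsubX i : linsub L 'X_i = \sum_j L i j *: 'X_j.
Proof. by rewrite /linsub comp_mpolyXU -tnth_nth tnth_mktuple. Qed.

Lemma meval_linsub p v : (linsub L p).@[v] = p.@[fun i => \sum_j L i j * v j].
Proof.
rewrite comp_mpoly_meval; apply: meval_eq => i; rewrite tnth_mktuple raddf_sum.
by apply: eq_bigr => j _ /=; rewrite mevalZ mevalXU.
Qed.

Lemma mderiv_linsub p j : (linsub L p)^`M(j) = \sum_i L i j *: linsub L p^`M(i).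
Proof.
rewrite mderiv_comp; apply: eq_bigr => i _.
rewrite tnth_mktuple (linear_sum (mderiv j)) (bigD1 j) //= big1 ?addr0 => [|l lj].
  rewrite mderivZ mderivX mnm1E eqxx scale1r (_ : (U_(j) - U_(j))%MM = 0%MM).
    by rewrite mpolyX0 mulrC -scalerAl mul1r.
  by apply/mnmP => a; rewrite mnmBE mnm0E subnn.
by rewrite mderivZ mderivX mnm1E (negPf lj) scale0r scaler0.
Qed.

End Fixed.

Lemma linsub_comp (m k l : nat) (L : 'M[K]_(k, m)) (L' : 'M[K]_(l, k)) p :
  linsub L (linsub L' p) = linsub (L' *m L) p.
Proof.
elim/mpoly_ring_ind: p => [c|i|p q IHp IHq|p q IHp IHq].
- by rewrite !linsubC.
- rewrite !linsubX linear_sum /=.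
  under eq_bigr do rewrite linearZ /= linsubX scaler_sumr.
  rewrite exchange_big; apply: eq_bigr => j _ /=.
  by rewrite mxE scaler_suml; apply: eq_bigr => a _; rewrite scalerA.
- by rewrite !rmorphD /= IHp IHq.
- by rewrite !rmorphM /= IHp IHq.
Qed.

Lemma linsub1 m (p : {mpoly K[m]}) : linsub 1%:M p = p.
Proof.
elim/mpoly_ring_ind: p => [c|i|p q IHp IHq|p q IHp IHq].
- by rewrite !linsubC.
- rewrite linsubX (bigD1 i) //= mxE eqxx scale1r big1 ?addr0 // => j ji.
  by rewrite mxE eq_sym (negPf ji) scale0r.
- by rewrite !rmorphD /= IHp IHq.
- by rewrite !rmorphM /= IHp IHq.
Qed.

End LinearSubstitution.

(** * Linear differential systems on a connected group *)

Section ConnectedGroup.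
Variables (K : numFieldType) (n : nat) (A : set 'M[K]_n.+1).
Hypotheses (algA : algebraic_group A) (conA : zariski_connected A).
Local Notation N := (n.+1 * n.+1)%N.

Definition right_translate (g : 'M[K]_n.+1) : {mpoly K[N]} -> {mpoly K[N]} :=
  linsub (lin_mx (mulmxr g))^T.

Lemma lin_mx_mxvecE (F : {linear 'M[K]_n.+1 -> 'M[K]_n.+1}) (U : 'M[K]_n.+1) e :
  \sum_a (lin_mx F)^T e a * mxvec U 0 a = mxvec (F U) 0 e.
Proof.
by rewrite -mul_vec_lin mxE; apply: eq_bigr => a _; rewrite mxE mulrC.
Qed.

Lemma mxeval_right_translate g p h : mxeval (right_translate g p) h = mxeval p (h *m g).
Proof.
by rewrite /mxeval meval_linsub; apply: meval_eq => e; rewrite lin_mx_mxvecE.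
Qed.

(** The derivative of p at g in the direction U. With U g in place of U this is
    the right invariant vector field attached to U. *)
Definition dir_deriv (U : 'M[K]_n.+1) (p : {mpoly K[N]}) g : K :=
  \sum_e mxvec U 0 e * mxeval p^`M(e) g.

Lemma dir_deriv_right_translate U g p h :
  dir_deriv U (right_translate g p) h = dir_deriv (U *m g) p (h *m g).
Proof.
rewrite /dir_deriv.
under eq_bigr do rewrite mderiv_linsub /mxeval raddf_sum mulr_sumr.
rewrite exchange_big; apply: eq_bigr => e _ /=.
rewrite -[U *m g]/(mulmxr g U) -lin_mx_mxvecE mulr_suml; apply: eq_bigr => a _.
by rewrite mevalZ -/(right_translate g _) -/(mxeval _ h) mxeval_right_translate mulrCA mulrA.
Qed.

(** Right translation carries the tangent space at 1, by which the Lie algebra is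
    defined, to the tangent space at g. *)
Lemma lie_of_group_right_field U p g : lie_of_group A U -> A g ->
  (forall h, A h -> mxeval p h = 0) -> dir_deriv (U *m g) p g = 0.
Proof.
move=> AU Ag pA; rewrite -[g in dir_deriv _ _ g]mul1mx -dir_deriv_right_translate.
apply: AU => h Ah; rewrite mxeval_right_translate pA //.
by have [_ _ AM _ _] := algA; exact: AM.
Qed.

Lemma mxeval_lin a b (q r : {mpoly K[N]}) g :
  mxeval (a *: q - b *: r) g = a * mxeval q g - b * mxeval r g.
Proof. by rewrite /mxeval mevalB !mevalZ. Qed.

Lemma dir_deriv_lin U a b (q r : {mpoly K[N]}) g :
  dir_deriv U (a *: q - b *: r) g = a * dir_deriv U q g - b * dir_deriv U r g.
Proof.
rewrite /dir_deriv !mulr_sumr -sumrB; apply: eq_bigr => e _.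
by rewrite mderivB !mderivZ mxeval_lin mulrBr; congr (_ - _); rewrite mulrCA.
Qed.

(** The common zero set F of the solutions is open in A: around each of its
    points [linear_system_vanishing] makes them vanish. Openness is phrased as
    closedness of the complement, cut out by the q with q f i = 0 on A. *)
Lemma connected_linear_system (J : finType) (f : J -> {mpoly K[N]}) :
  (forall U, lie_of_group A U -> exists a : J -> J -> K, forall i g, A g ->
     dir_deriv (U *m g) (f i) g = \sum_j a i j * mxeval (f j) g) ->
  (forall i, mxeval (f i) 1%:M = 0) -> forall i g, A g -> mxeval (f i) g = 0.
Proof.
move=> sys f1; have [Aunit A1 AM AV _] := algA.
pose I p := forall h, A h -> mxeval p h = 0.
have I0 : I 0 by move=> h _; exact: meval0.
have ID a p q : I p -> I q -> I (a * p + q).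
  move=> Ip Iq h Ah; rewrite /mxeval mevalD mevalM.
  by have := Ip h Ah; have := Iq h Ah; rewrite /mxeval => -> ->; rewrite mulr0 addr0.
pose F := [set g | forall i, mxeval (f i) g = 0].
pose Q := [set q | forall i, I (q * f i)].
pose F' := [set g | forall q, Q q -> mxeval q g = 0].
have Fcl : zariski_closed F.
  exists (range f); apply/seteqP; split=> [g Fg _ [i _ <-]|g Fg i]; first exact: Fg.
  by apply: Fg; exists i.
have Fcl' : zariski_closed F' by exists Q.
have AFF' : A `<=` F `|` F'.
  move=> g Ag; have [Fg|nFg] := pselect (F g); [by left|right] => q Qq.
  apply: contrapT => /eqP q0; apply: nFg => i; have := Qq i g Ag.
  by rewrite /mxeval mevalM => /eqP; rewrite mulf_eq0 (negPf q0) => /eqP.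
have disj : A `&` F `&` F' = set0.
  rewrite -subset0 => g [[Ag Fg] F'g].
  have /choice[q qP] : forall i, exists q, mxeval q g != 0 /\ I (q * f i).
    move=> i; suff [q qg Iq] : exists2 q, q.@[mxvec g 0] != 0 & I (q * f i) by exists q.
    move: i; apply: linear_system_vanishing => // [p Ip|V tV]; first exact: Ip.
    pose U := vec_mx (\row_e V e) *m invmx g.
    have Ug : mxvec (U *m g) = \row_e V e by rewrite /U mulmxKV ?vec_mxK //; exact: Aunit.
    have AU : lie_of_group A U.
      move=> p Ip; rewrite -/(dir_deriv U p 1%:M) /U -(mulmxV (Aunit _ Ag)).
      rewrite -dir_deriv_right_translate -[RHS](tV (right_translate (invmx g) p)).
        by apply: eq_bigr => e _; rewrite vec_mxK mxE.
      by move=> h Ah; rewrite mxeval_right_translate Ip //; apply: AM => //; exact: AV.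
    pose v (e : 'I_N) := linsub (lin_mx (@mulmx K n.+1 n.+1 n.+1 U))^T 'X_e.
    have vE (e : 'I_N) h : (v e).@[mxvec h 0] = mxvec (U *m h) 0 e.
      by rewrite meval_linsub mevalXU lin_mx_mxvecE.
    have DE p h : mxeval (\sum_e v e * p^`M(e)) h = dir_deriv (U *m h) p h.
      by rewrite /mxeval raddf_sum; apply: eq_bigr => e _ /=; rewrite mevalM vE.
    have [a fa] := sys U AU.
    exists v; split=> [e|p Ip h Ah|i].
    - by rewrite vE Ug mxE.
    - by rewrite DE lie_of_group_right_field.
    - exists (fun j => (a i j)%:MP) => h Ah.
      rewrite /mxeval mevalB -!/(mxeval _ h) DE fa // [X in _ - X](_ : _ = \sum_j a i j * mxeval (f j) h) ?subrr //.
      by rewrite /mxeval raddf_sum; apply: eq_bigr => j _ /=; rewrite mevalM mevalC.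
  have : mxeval (\prod_i q i) g != 0.
    by rewrite /mxeval rmorph_prod; apply/prodf_neq0 => i _; have [] := qP i.
  case/negP; apply/eqP; apply: F'g => i h Ah.
  have [_ Iq] := qP i; rewrite (bigD1 i) //= -mulrA mulrCA /mxeval mevalM.
  by have := Iq h Ah; rewrite /mxeval => ->; rewrite mulr0.
have [AF i g Ag|AF'] := conA Fcl Fcl' AFF' disj; first exact: AF.
have : (A `&` F `&` F') 1%:M by split; [split|exact: AF'].
by rewrite disj.
Qed.

End ConnectedGroup.

(** * The action of gl(W) on polynomials *)

Section GlAction.
Variables (K : fieldType) (n : nat).
Implicit Types (U V : 'M[K]_n) (P Q : {mpoly K[n]}).

Lemma mderivXU i j : ('X_i : {mpoly K[n]})^`M(j) = (i == j)%:R.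
Proof.
rewrite mderivX mnm1E; case: eqVneq => [->|_]; last by rewrite scale0r.
by rewrite scale1r (_ : (U_(j) - U_(j))%MM = 0%MM) ?mpolyX0 //; apply/mnmP => i'; rewrite mnmBE mnm0E subnn.
Qed.

Lemma gl_act_is_linear U : linear (gl_act U).
Proof.
move=> a P Q; rewrite /gl_act scalerN -opprD; congr (- _).
rewrite scaler_sumr -big_split; apply: eq_bigr => i _ /=.
rewrite scaler_sumr -big_split; apply: eq_bigr => j _ /=.
by rewrite mderivD mderivZ mulrDr scalerDr -scalerAr !scalerA [U i j * a]mulrC.
Qed.
HB.instance Definition _ U := GRing.isLinear.Build K {mpoly K[n]} {mpoly K[n]} _
  (gl_act U) (gl_act_is_linear U).

Lemma gl_act0 U : gl_act U 0 = 0.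
Proof. exact: (linear0 (gl_act U)). Qed.

Lemma gl_actD U P Q : gl_act U (P + Q) = gl_act U P + gl_act U Q.
Proof. exact: (linearD (gl_act U)). Qed.

Lemma gl_actN U P : gl_act U (- P) = - gl_act U P.
Proof. exact: (linearN (gl_act U)). Qed.

Lemma gl_actZ U a P : gl_act U (a *: P) = a *: gl_act U P.
Proof. exact: (linearZZ (gl_act U)). Qed.

Lemma gl_act_sum U (J : finType) (F : J -> {mpoly K[n]}) :
  gl_act U (\sum_j F j) = \sum_j gl_act U (F j).
Proof. exact: (linear_sum (gl_act U)). Qed.

Lemma gl_act_linear_l P : linear (fun U => gl_act U P).
Proof.
move=> a U V; rewrite /gl_act scalerN -opprD; congr (- _).
rewrite scaler_sumr -big_split; apply: eq_bigr => i _ /=.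
rewrite scaler_sumr -big_split; apply: eq_bigr => j _ /=.
by rewrite !mxE scalerDl scalerA.
Qed.

Lemma gl_act0l P : gl_act 0 P = 0.
Proof. by have := @gl_act_linear_l P (-1) 0 0; rewrite scaler0 addr0 scaleN1r addNr. Qed.

Lemma gl_actZl a U P : gl_act (a *: U) P = a *: gl_act U P.
Proof. by have := @gl_act_linear_l P a U 0; rewrite addr0 gl_act0l addr0. Qed.

Lemma gl_actDl U V P : gl_act (U + V) P = gl_act U P + gl_act V P.
Proof. by have := @gl_act_linear_l P 1 U V; rewrite !scale1r. Qed.

Lemma gl_actBl U V P : gl_act (U - V) P = gl_act U P - gl_act V P.
Proof. by rewrite gl_actDl -scaleN1r gl_actZl scaleN1r. Qed.

Lemma gl_actC U c : gl_act U c%:MP = 0.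
Proof.
rewrite /gl_act big1 ?oppr0 // => i _; rewrite big1 // => j _.
by rewrite mderivC mulr0 scaler0.
Qed.

Lemma gl_actX U k : gl_act U 'X_k = - \sum_j U k j *: 'X_j.
Proof.
rewrite /gl_act (bigD1 k) //= [X in _ + X]big1 ?addr0 => [|i ik]; last first.
  by rewrite big1 // => j _; rewrite mderivXU eq_sym (negPf ik) mulr0 scaler0.
by congr (- _); apply: eq_bigr => j _; rewrite mderivXU eqxx mulr1.
Qed.

Lemma gl_actM U P Q : gl_act U (P * Q) = gl_act U P * Q + P * gl_act U Q.
Proof.
rewrite /gl_act mulNr mulrN -opprD; congr (- _).
rewrite mulr_suml mulr_sumr -big_split; apply: eq_bigr => i _ /=.
rewrite mulr_suml mulr_sumr -big_split; apply: eq_bigr => j _ /=.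
by rewrite mderivM mulrDr scalerDr -scalerAl -scalerAr -mulrA [P * (_ * _)]mulrCA.
Qed.

Lemma gl_act_lie U V P :
  gl_act (lie U V) P = gl_act U (gl_act V P) - gl_act V (gl_act U P).
Proof.
elim/mpoly_ring_ind: P => [c|k|P Q IHP IHQ|P Q IHP IHQ].
- by rewrite !gl_actC subr0.
- rewrite !gl_actX !gl_actN !gl_act_sum.
  have E (X Y : 'M[K]_n) : \sum_i gl_act X (Y k i *: 'X_i) = - \sum_j (Y *m X) k j *: 'X_j.
    under eq_bigr do rewrite gl_actZ gl_actX scalerN scaler_sumr.
    rewrite sumrN; congr (- _); rewrite exchange_big; apply: eq_bigr => j _ /=.
    by rewrite mxE scaler_suml; apply: eq_bigr => i _; rewrite scalerA.
  rewrite !E !opprK /lie /= /mxlie -sumrB -sumrN; apply: eq_bigr => j _.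
  by rewrite -scalerBl -scaleNr 3!mxE opprB mxE.
- by rewrite !gl_actD IHP IHQ opprD addrACA.
- rewrite !gl_actM IHP IHQ !gl_actD !gl_actM.
  move: (gl_act U (gl_act V P)) (gl_act V (gl_act U P)) => a b.
  move: (gl_act U (gl_act V Q)) (gl_act V (gl_act U Q)) => d e.
  by move: (gl_act U P) (gl_act V P) (gl_act U Q) (gl_act V Q) => a' b' d' e'; ring.
Qed.

(** In particular, for k invertible, the substitution of k intertwines U with
    its conjugate by k. *)
Lemma gl_act_linsub (k U V : 'M[K]_n) P : k *m V = U *m k ->
  gl_act V (linsub k P) = linsub k (gl_act U P).
Proof.
move=> kV; elim/mpoly_ring_ind: P => [c|i|P Q IHP IHQ|P Q IHP IHQ].
- by rewrite linsubC !gl_actC linear0.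
- have E X : \sum_j k i j *: gl_act X 'X_j = - \sum_l (k *m X) i l *: 'X_l.
    under eq_bigr do rewrite gl_actX scalerN scaler_sumr.
    rewrite sumrN; congr (- _); rewrite exchange_big; apply: eq_bigr => j _ /=.
    by rewrite mxE scaler_suml; apply: eq_bigr => a _; rewrite scalerA.
  rewrite linsubX gl_act_sum; under eq_bigr do rewrite gl_actZ.
  rewrite E kV gl_actX (linearN (linsub k)) (linear_sum (linsub k)) /=; congr (- _).
  under [RHS]eq_bigr do rewrite (linearZZ (linsub k)) /= linsubX scaler_sumr.
  rewrite exchange_big; apply: eq_bigr => j _ /=.
  by rewrite mxE scaler_suml; apply: eq_bigr => a _; rewrite scalerA.
- by rewrite gl_actD !(linearD (linsub k)) /= gl_actD IHP IHQ.
- by rewrite rmorphM /= !gl_actM IHP IHQ rmorphD !rmorphM.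
Qed.

Lemma mcoeff_gl_act1 P m : (gl_act 1%:M P)@_m = - (mdeg m)%:R * P@_m.
Proof.
have E : gl_act 1%:M P = - \sum_i 'X_i * P^`M(i).
  rewrite /gl_act; congr (- _); apply: eq_bigr => i _.
  rewrite (bigD1 i) //= mxE eqxx scale1r big1 ?addr0 // => j ji.
  by rewrite mxE eq_sym (negPf ji) scale0r.
have XE i a : 'X_i * ('X_[a] : {mpoly K[n]})^`M(i) = (a i)%:R *: 'X_[a].
  rewrite mderivX -scalerAr -mpolyXD; case: (posnP (a i)) => [->|ai].
    by rewrite !scale0r.
  congr (_ *: 'X_[_]); apply/mnmP => j; rewrite mnmDE mnmBE mnm1E.
  by case: eqVneq => [<-|_]; rewrite ?subnKC ?subn0.
rewrite E mcoeffN mulNr; congr (- _); rewrite {1}(mpolyE P).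
under eq_bigr => i _.
  rewrite (linear_sum (mderiv i)) /= mulr_sumr.
  under eq_bigr do rewrite mderivZ -scalerAr XE scalerA mulrC -scalerA.
  over.
rewrite exchange_big /= [in RHS](mpolyE P) !raddf_sum /= mulr_sumr; apply: eq_bigr => a _.
rewrite -scaler_suml mcoeffZ !mcoeffZ mcoeffX.
case: eqVneq => [->|_]; last by rewrite !mulr0.
by rewrite [in RHS]big_tuple.
Qed.

End GlAction.

(** ** Homogeneous polynomials as eigenvectors of the identity *)

Section Homogeneous.
Variables (K : numFieldType) (n p : nat).
Implicit Types P Q : {mpoly K[n]}.

Lemma dhomog_eulerP P : reflect (gl_act 1%:M P = - p%:R *: P) (P \is p.-homog).
Proof.
apply: (iffP idP) => [hP|hP].
  apply/mpolyP => m; rewrite mcoeff_gl_act1 mcoeffZ.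
  have [->//|mp] := eqVneq (mdeg m) p.
  by rewrite (dhomog_nemf_coeff hP mp) !mulr0.
apply/dhomogP => m; rewrite mcoeff_msupp => Pm /=.
have := congr1 (mcoeff m) hP; rewrite mcoeff_gl_act1 mcoeffZ => /(mulIf Pm)/oppr_inj/eqP.
by rewrite eqr_nat => /eqP.
Qed.

Lemma gl_act_scalar t P : P \is p.-homog -> gl_act t%:M P = - (t * p%:R) *: P.
Proof. by move=> /dhomog_eulerP hP; rewrite -scalemx1 gl_actZl hP scalerA mulrN. Qed.

Lemma linsub_homog (k : 'M[K]_n) P : P \is p.-homog -> linsub k P \is p.-homog.
Proof.
move=> /dhomog_eulerP hP; apply/dhomog_eulerP.
by rewrite (@gl_act_linsub _ _ k 1%:M) ?mulmx1 ?mul1mx // hP (linearZZ (linsub k)).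
Qed.

End Homogeneous.

(** * The Fischer form *)

Section Fischer.
Variables (K : fieldType) (n : nat).
Implicit Types P Q : {mpoly K[n]}.

(** Composed with conjugation it is the Fischer, or Bombieri, inner product, for
    which monomials are orthogonal and X_i is adjoint to d_i. *)
Definition fischer Q P : K := (diffop Q P)@_0.

Definition mnm_fact (m : 'X_{1..n}) : nat := (\prod_i (m i)`!)%N.

Lemma fischer_sum_bounded w Q P : (msize Q <= w)%N ->
  fischer Q P = \sum_(k : 'X_{1..n < w}) Q@_k * P@_k * (mnm_fact k)%:R.
Proof.
move=> Qw; rewrite /fischer /diffop raddf_sum /=.
under eq_bigr => k _.
  rewrite mcoeffZ mcoeff_mderivm addm0.
  under [X in _ *+ X]eq_bigr do rewrite ffactnn.
  rewrite -/(mnm_fact k) -mulr_natr mulrA.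
  over.
set I : subFinType _ := 'X_{1..n < w}.
rewrite (big_mksub I) ?msupp_uniq //=; first last.
  by move=> x /msize_mdeg_lt /leq_trans; apply.
by rewrite big_rmcond //= => j /memN_msupp_eq0 ->; rewrite !mul0r.
Qed.

Lemma fischerC Q P : fischer Q P = fischer P Q.
Proof.
rewrite (@fischer_sum_bounded (maxn (msize Q) (msize P))) ?leq_maxl //.
rewrite (@fischer_sum_bounded (maxn (msize Q) (msize P)) P) ?leq_maxr //.
by apply: eq_bigr => k _; rewrite [Q@_k * _]mulrC.
Qed.

Lemma fischer_is_scalar Q : scalar (fischer Q).
Proof.
move=> a P P'; rewrite /fischer /diffop -mcoeffZ -mcoeffD scaler_sumr -big_split.
congr (_@__); apply: eq_bigr => k _ /=.
by rewrite mderivmD mderivmZ scalerDr !scalerA mulrC.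
Qed.
HB.instance Definition _ Q := GRing.isLinear.Build K {mpoly K[n]} K _ (fischer Q)
  (fischer_is_scalar Q).

Lemma fischer0r Q : fischer Q 0 = 0. Proof. exact: (linear0 (fischer Q)). Qed.
Lemma fischerDr Q P P' : fischer Q (P + P') = fischer Q P + fischer Q P'.
Proof. exact: (linearD (fischer Q)). Qed.
Lemma fischerNr Q P : fischer Q (- P) = - fischer Q P.
Proof. exact: (linearN (fischer Q)). Qed.
Lemma fischerBr Q P P' : fischer Q (P - P') = fischer Q P - fischer Q P'.
Proof. exact: (linearB (fischer Q)). Qed.
Lemma fischerZr Q a P : fischer Q (a *: P) = a * fischer Q P.
Proof. exact: (scalarZ (fischer Q)). Qed.
Lemma fischer_sumr Q (J : finType) (F : J -> {mpoly K[n]}) :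
  fischer Q (\sum_j F j) = \sum_j fischer Q (F j).
Proof. exact: (linear_sum (fischer Q)). Qed.

Lemma fischer0l P : fischer 0 P = 0. Proof. by rewrite fischerC fischer0r. Qed.
Lemma fischerDl Q Q' P : fischer (Q + Q') P = fischer Q P + fischer Q' P.
Proof. by rewrite !(fischerC _ P) fischerDr. Qed.
Lemma fischerNl Q P : fischer (- Q) P = - fischer Q P.
Proof. by rewrite !(fischerC _ P) fischerNr. Qed.
Lemma fischerBl Q Q' P : fischer (Q - Q') P = fischer Q P - fischer Q' P.
Proof. by rewrite !(fischerC _ P) fischerBr. Qed.
Lemma fischerZl a Q P : fischer (a *: Q) P = a * fischer Q P.
Proof. by rewrite !(fischerC _ P) fischerZr. Qed.
Lemma fischer_suml P (J : finType) (F : J -> {mpoly K[n]}) :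
  fischer (\sum_j F j) P = \sum_j fischer (F j) P.
Proof. by rewrite fischerC fischer_sumr; apply: eq_bigr => j _; rewrite fischerC. Qed.

Lemma fischer_monomial m P : fischer 'X_[m] P = P@_m * (mnm_fact m)%:R.
Proof.
rewrite /fischer /diffop msuppX big_seq1 mcoeffX eqxx scale1r mcoeff_mderivm addm0.
by under eq_bigr do rewrite ffactnn; rewrite mulr_natr.
Qed.

Lemma fischer_mulX i Q P : fischer ('X_i * Q) P = fischer Q P^`M(i).
Proof.
have mono m : fischer ('X_i * 'X_[m]) P = fischer 'X_[m] P^`M(i).
  rewrite -mpolyXD !fischer_monomial mcoeff_mderiv addmC -[_ *+ (m i).+1]mulr_natr -mulrA.
  congr (_ * _); rewrite -natrM; congr (_%:R).
  rewrite /mnm_fact (bigD1 i) //= [in RHS](bigD1 i) //= mulnA.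
  rewrite mnmDE mnm1E eqxx addn1 factS; congr (_ * _)%N.
  by apply: eq_bigr => j /negPf ji; rewrite mnmDE mnm1E eq_sym ji addn0.
rewrite (mpolyE Q) mulr_sumr; elim: (msupp Q : seq _) => [|m s IHs].
  by rewrite !big_nil !fischer0l.
by rewrite !big_cons !fischerDl IHs -scalerAr !fischerZl mono.
Qed.

Lemma fischer_gl_act Q U P : fischer Q (gl_act U P) = fischer (gl_act U^T Q) P.
Proof.
rewrite /gl_act fischerNr fischerNl !fischer_sumr fischer_suml; congr (- _).
under eq_bigr do rewrite fischer_sumr.
under [RHS]eq_bigr do rewrite fischer_suml.
rewrite exchange_big; apply: eq_bigr => i _; apply: eq_bigr => j _ /=.
by rewrite fischerZr fischerZl mxE fischer_mulX fischerC fischer_mulX fischerC.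
Qed.

(** The property passes to products of polynomials q only in a form
    relative to the remaining factor Q, hence the predicate R of the proof. *)
Lemma fischer_linsub (k : 'M[K]_n) Q P :
  fischer Q (linsub k P) = fischer (linsub k^T Q) P.
Proof.
pose R q := forall Q, (forall P, fischer Q (linsub k P) = fischer (linsub k^T Q) P) ->
  forall P, fischer (q * Q) (linsub k P) = fischer (linsub k^T (q * Q)) P.
suff RQ : R Q.
  rewrite -[Q]mulr1; apply: RQ => {}P.
  rewrite rmorph1 -mpolyX0 !fischer_monomial; congr (_ * _).
  elim/mpoly_ring_ind: P => [c|i|p q IHp IHq|p q IHp IHq].
  - by rewrite linsubC.
  - rewrite linsubX raddf_sum big1 ?mcoeffX /= => [|j _].
      by case: eqP => // /(congr1 mdeg); rewrite mdeg1 mdeg0.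
    rewrite mcoeffZ mcoeffX; case: eqP => [/(congr1 mdeg)|_]; last by rewrite mulr0.
    by rewrite mdeg1 mdeg0.
  - by rewrite rmorphD /= !mcoeffD IHp IHq.
  - by rewrite rmorphM !rmorphM /= IHp IHq.
elim/mpoly_ring_ind: Q => [c|i|p q Rp Rq|p q Rp Rq] Q QE {}P.
- by rewrite rmorphM /= linsubC !mul_mpolyC !fischerZl QE.
- rewrite fischer_mulX mderiv_linsub fischer_sumr rmorphM /= linsubX mulr_suml fischer_suml.
  apply: eq_bigr => l _.
  by rewrite fischerZr QE -scalerAl fischerZl fischer_mulX mxE.
- by rewrite mulrDl fischerDl Rp // Rq // -fischerDl -rmorphD.
- by rewrite -mulrA; apply: Rp => // P'; exact: Rq.
Qed.

End Fischer.

Section Hermitian.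
Variables (C : numClosedFieldType) (n : nat).
Implicit Types (P Q : {mpoly C[n]}) (U k : 'M[C]_n).

Definition mconj P : {mpoly C[n]} := map_mpoly Num.conj P.
HB.instance Definition _ := GRing.RMorphism.copy mconj (map_mpoly Num.conj).

Definition mxadj m1 m2 (U : 'M[C]_(m1, m2)) := (map_mx Num.conj U)^T.

Lemma mcoeff_mconj P m : (mconj P)@_m = (P@_m)^*.
Proof. by rewrite mcoeff_map_mpoly. Qed.

Lemma mconjK : involutive mconj.
Proof. by move=> P; apply/mpolyP => m; rewrite !mcoeff_mconj conjCK. Qed.

Lemma mconjZ a P : mconj (a *: P) = a^* *: mconj P.
Proof. by apply/mpolyP => m; rewrite !mcoeff_mconj !mcoeffZ rmorphM mcoeff_mconj. Qed.

Lemma mconjX i : mconj 'X_i = 'X_i.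
Proof. by apply/mpolyP => m; rewrite mcoeff_mconj mcoeffX rmorph_nat. Qed.

Lemma mconj_mderiv P i : mconj P^`M(i) = (mconj P)^`M(i).
Proof. by apply/mpolyP => m; rewrite !mcoeff_mderiv !mcoeff_mconj mcoeff_mderiv rmorphMn. Qed.

Lemma mconj_gl_act U P : mconj (gl_act U P) = gl_act (map_mx Num.conj U) (mconj P).
Proof.
rewrite /gl_act rmorphN /= rmorph_sum; congr (- _); apply: eq_bigr => i _ /=.
rewrite rmorph_sum; apply: eq_bigr => j _ /=.
by rewrite mconjZ mxE rmorphM /= mconjX mconj_mderiv.
Qed.

Lemma mconj_homog p P : P \is p.-homog -> mconj P \is p.-homog.
Proof.
move=> hP; apply/dhomogP => m; rewrite mcoeff_msupp mcoeff_mconj conjC_eq0.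
by rewrite -mcoeff_msupp; apply: dhomog_mf.
Qed.

Lemma fischer_mconj P Q : fischer (mconj P) (mconj Q) = (fischer P Q)^*.
Proof.
rewrite (@fischer_sum_bounded _ _ (maxn (msize P) (msize (mconj P)))) ?leq_maxr //.
rewrite (@fischer_sum_bounded _ _ (maxn (msize P) (msize (mconj P)))) ?leq_maxl //.
rewrite rmorph_sum; apply: eq_bigr => k _ /=.
by rewrite !mcoeff_mconj !rmorphM rmorph_nat.
Qed.

Lemma fischer_conj_ge0 P : 0 <= fischer (mconj P) P.
Proof.
rewrite (@fischer_sum_bounded _ _ (msize (mconj P))) //; apply: sumr_ge0 => k _.
by rewrite mcoeff_mconj mulrC mulr_ge0 ?ler0n // mulrC mul_conjC_ge0.
Qed.

Lemma fischer_conj_eq0 P : (fischer (mconj P) P == 0) = (P == 0).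
Proof.
apply/idP/eqP => [|->]; last by rewrite fischer0r.
rewrite fischerC (@fischer_sum_bounded _ _ (msize P)) // psumr_eq0 => [/allP P0|k _]; last first.
  by rewrite mcoeff_mconj mulr_ge0 ?ler0n // mul_conjC_ge0.
apply/mpolyP => m; rewrite mcoeff0; apply/eqP.
have [mw|mw] := ltnP (mdeg m) (msize P); last first.
  by apply: contraTT mw => Pm; rewrite -ltnNge msize_mdeg_lt // mcoeff_msupp.
have := P0 (BMultinom mw) (mem_index_enum _); rewrite /= mcoeff_mconj.
rewrite mulf_eq0 mul_conjC_eq0 pnatr_eq0 => /orP[//|].
by rewrite -leqn0 leqNgt prodn_gt0 // => i; exact: fact_gt0.
Qed.

Lemma fischer_conj_gl_act P U Q :
  fischer (mconj P) (gl_act U Q) = fischer (mconj (gl_act (mxadj U) P)) Q.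
Proof.
rewrite fischer_gl_act mconj_gl_act; congr (fischer (gl_act _ _) _).
by apply/matrixP => i j; rewrite !mxE conjCK.
Qed.

End Hermitian.

(** * Polynomial functions on orbits *)

Lemma poly_fun_eq0 (K : numFieldType) (q : {poly K}) : (forall t, q.[t] = 0) -> q = 0.
Proof.
move=> q0; apply/eqP; apply: contraT => nq.
have := max_poly_roots (rs := [seq (i%:R : K) | i <- iota 0 (size q)]) nq.
rewrite size_map size_iota ltnn => h; suff: false by []; apply: h.
  by apply/allP => _ /mapP[i _ ->]; rewrite /root q0.
by rewrite map_inj_uniq ?iota_uniq // => i j /eqP; rewrite eqr_nat => /eqP.
Qed.

(** By induction on the degree: the partial derivatives of a function vanishing
    everywhere vanish everywhere. *)
Lemma mpoly_fun_eq0 (K : numFieldType) n (p : {mpoly K[n]}) : (forall v, p.@[v] = 0) -> p = 0.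
Proof.
have [w] := ubnP (msize p); elim: w p => // w IHw p pw p0.
(* lineX restricts a polynomial to the line through v along the i-th axis *)
have dp0 i v : (p^`M(i)).@[v] = 0.
  pose lineX (q : {mpoly K[n]}) : {poly K} :=
    mmap polyC (fun j => (v j)%:P + (i == j)%:R *: 'X) q.
  have lineE q t : (lineX q).[t] = q.@[fun j => v j + (i == j)%:R * t].
    rewrite /lineX; elim/mpoly_ring_ind: q => [c|j|q r IHq IHr|q r IHq IHr].
    - by rewrite mmapC mevalC hornerC.
    - by rewrite mmapX mmap1U mevalXU hornerD hornerC hornerZ hornerX.
    - by rewrite mmapD hornerD IHq IHr mevalD.
    - by rewrite rmorphM hornerM IHq IHr mevalM.
  have lineD q : (lineX q)^`() = lineX q^`M(i).
    rewrite /lineX; elim/mpoly_ring_ind: q => [c|j|q r IHq IHr|q r IHq IHr].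
    - by rewrite mmapC derivC mderivC mmap0.
    - rewrite mderivXU mmapX mmap1U derivD derivC add0r derivZ derivX (eq_sym j).
      by rewrite scaler_nat rmorph_nat.
    - by rewrite mmapD derivD IHq IHr mderivD mmapD.
    - by rewrite rmorphM derivM IHq IHr mderivM mmapD !rmorphM.
  have line0 : lineX p = 0 by apply: poly_fun_eq0 => t; rewrite lineE.
  have := lineE p^`M(i) 0; rewrite -lineD line0 deriv0 horner0 => ->.
  by apply: meval_eq => j; rewrite mulr0 addr0.
have [d0|p0'] := altP (p =P (p@_0)%:MP).
  by have := p0 (fun=> 0); rewrite d0 mevalC => ->; rewrite mpolyC0.
have dp i : p^`M(i) = 0.
  apply: IHw => //; apply: (@leq_trans (msize p)); last by rewrite -ltnS.
  have [->|nd] := eqVneq p^`M(i) 0.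
    by rewrite msize0 lt0n msize_poly_eq0; apply: contraNneq p0' => ->; rewrite mcoeff0 mpolyC0.
  have := mlead_supp nd; rewrite mcoeff_msupp mcoeff_mderiv => h.
  have : p@_(mlead p^`M(i) + U_(i)) != 0 by apply: contraNneq h => ->; rewrite mul0rn.
  by rewrite -mcoeff_msupp => /msize_mdeg_lt; rewrite mdegD mdeg1 addn1 mlead_deg.
case/eqP: p0'; apply/mpolyP => m; rewrite mcoeffC.
have [->|m0] := eqVneq m 0%MM; first by rewrite mulr1.
rewrite ?(negPf m0) mulr0.
have [i mi] : exists i, (0 < m i)%N.
  apply: contrapT => nm; case/eqP: m0; apply/mnmP => i; rewrite mnm0E.
  by apply/eqP; rewrite -leqn0 leqNgt; apply/negP => mi; apply: nm; exists i.
have mE : m = (m - U_(i) + U_(i))%MM.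
  by apply/mnmP => j; rewrite mnmDE mnmBE mnm1E; case: eqVneq => [<-|_]; rewrite ?subnK // subn0 addn0.
have := congr1 (mcoeff (m - U_(i))) (dp i); rewrite mcoeff_mderiv -mE mcoeff0.
by move/eqP; rewrite mulrn_eq0 /= => /eqP.
Qed.

Section Orbit.
Variables (K : numFieldType) (n : nat).
Local Notation N := (n.+1 * n.+1)%N.
Implicit Types (x : 'cV[K]_n.+1) (Q : {mpoly K[n.+1]}).

(** The entry e of F g, as a polynomial in g. *)
Definition linform (F : {linear 'M[K]_n.+1 -> 'M[K]_n.+1}) (e : 'I_N) : {mpoly K[N]} :=
  linsub (lin_mx F)^T 'X_e.

Lemma mxeval_linform F e g : mxeval (linform F e) g = mxvec (F g) 0 e.
Proof. by rewrite /mxeval meval_linsub mevalXU lin_mx_mxvecE. Qed.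

Lemma dir_deriv_linform F e V g : dir_deriv V (linform F e) g = mxvec (F V) 0 e.
Proof.
rewrite -lin_mx_mxvecE; apply: eq_bigr => a _; rewrite mulrC; congr (_ * _).
rewrite mderiv_linsub (bigD1 e) //= big1 ?addr0 => [|i ie].
  by rewrite mderivXU eqxx rmorph1 /mxeval mevalZ meval1 mulr1.
by rewrite mderivXU eq_sym (negPf ie) rmorph0 scaler0.
Qed.

(** The function g |-> Q (g x). *)
Definition orbit_poly x Q : {mpoly K[N]} :=
  linsub (\matrix_(i, e) (vec_mx (delta_mx 0 e) *m x) i 0) Q.

Lemma orbit_poly_lin x (g : 'M[K]_n.+1) i :
  \sum_e (vec_mx (delta_mx 0 e) *m x) i 0 * mxvec g 0 e = (g *m x) i 0.
Proof.
rewrite -{2}[g]mxvecK {2}[mxvec g]row_sum_delta linear_sum mulmx_suml summxE.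
by apply: eq_bigr => e _; rewrite linearZ /= -scalemxAl [RHS]mxE mulrC.
Qed.

Lemma mxeval_orbit_poly x Q g : mxeval (orbit_poly x Q) g = veval Q (g *m x).
Proof.
rewrite /mxeval meval_linsub; apply: meval_eq => i.
by rewrite -orbit_poly_lin; apply: eq_bigr => e _; rewrite mxE.
Qed.

Lemma veval_gl_act U Q x : veval (gl_act U Q) x = - \sum_i (U *m x) i 0 * veval Q^`M(i) x.
Proof.
rewrite /veval /gl_act mevalN; congr (- _); rewrite raddf_sum; apply: eq_bigr => i _ /=.
rewrite raddf_sum mxE mulr_suml; apply: eq_bigr => j _ /=.
by rewrite mevalZ mevalM mevalXU mulrA.
Qed.

Lemma dir_deriv_orbit_poly x Q U g :
  dir_deriv (U *m g) (orbit_poly x Q) g = - veval (gl_act U Q) (g *m x).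
Proof.
rewrite veval_gl_act opprK /dir_deriv.
under eq_bigr do rewrite mderiv_linsub /mxeval raddf_sum mulr_sumr.
rewrite exchange_big; apply: eq_bigr => i _ /=.
rewrite mulmxA -orbit_poly_lin mulr_suml; apply: eq_bigr => e _.
rewrite mevalZ -/(orbit_poly x _) -/(mxeval _ g) mxeval_orbit_poly mxE.
by rewrite mulrCA mulrA.
Qed.

End Orbit.

(** * Prehomogeneous spaces: from the group to the annihilator of P *)

Definition annihilator (K : fieldType) (n : nat) (P : {mpoly K[n]}) (U : 'M[K]_n) :=
  gl_act U P = 0.

Section Prehomogeneous.
Variables (C : numClosedFieldType) (n p : nat) (A : set 'M[C]_n.+1) (P : {mpoly C[n.+1]}).
Hypotheses (algA : algebraic_group A) (conA : zariski_connected A).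
Hypotheses (irrA : irreducible_module A) (preA : prehomogeneous A).
Hypotheses (homP : P \is p.-homog) (fundP : fundamental_relative_invariant A P).
Hypothesis lieA : lie_of_group A = [set U | exists mu : C, gl_act U P = mu *: P].


Local Notation stab := (annihilator P).

Lemma fundamental_neq0 : P != 0.
Proof. by have [[]] := fundP. Qed.

(** An irreducible polynomial is not a unit, hence not a constant. *)
Lemma fundamental_degree : p != 0%N.
Proof.
have [[P0 /negP nu _] _] := fundP; apply/eqP => p0; apply: nu.
have PE : P = (P@_0)%:MP.
  apply/mpolyP => m; rewrite mcoeffC; have [<-|m0] := eqVneq 0%MM m; first by rewrite mulr1.
  rewrite mulr0 (dhomog_nemf_coeff homP) //= p0 mdeg_eq0 eq_sym.
  by [].
rewrite PE; apply: (rmorph_unit (@mpolyC n.+1 C)); rewrite unitfE.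
by apply: contraNneq P0 => c0; rewrite PE c0 mpolyC0.
Qed.

(** By Euler's formula Id acts on P as - p, so that a = C Id + s. *)
Lemma lie_stab U : lie_of_group A U -> exists mu,
  gl_act U P = mu *: P /\ stab (U + (mu / p%:R)%:M).
Proof.
rewrite lieA => -[mu muP]; exists mu; split=> //.
rewrite /annihilator gl_actDl muP (gl_act_scalar _ homP) divfK ?pnatr_eq0 ?fundamental_degree //.
by rewrite scaleNr subrr.
Qed.

Lemma stab_lie U : stab U -> lie_of_group A U.
Proof. by rewrite lieA => U0; exists 0; rewrite scale0r. Qed.

Lemma relative_invariant_linsub (G : set 'M[C]_n.+1) (Q : {mpoly C[n.+1]}) :
  relative_invariant G (Q, 1) -> exists2 chi, rational_character G chi &
    forall g, G g -> linsub g Q = chi g *: Q.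
Proof.
move=> [_ _ [chi ratchi relQ]]; exists chi => // g Gg.
apply/eqP; rewrite -subr_eq0; apply/eqP; apply: mpoly_fun_eq0 => v.
pose x : 'cV[C]_n.+1 := \col_i v i.
have := relQ g x Gg; rewrite /veval !meval1 !mulr1 => Qx.
rewrite mevalB mevalZ meval_linsub; apply/eqP; rewrite subr_eq0; apply/eqP.
rewrite [RHS](_ : _ = chi g * Q.@[fun i => x i 0]); last first.
  by congr (_ * _); apply: meval_eq => i; rewrite mxE.
by rewrite -Qx; apply: meval_eq => i; rewrite mxE; apply: eq_bigr => j _; rewrite !mxE.
Qed.

Lemma group_linsub g : A g -> exists2 chi, chi != 0 & linsub g P = chi *: P.
Proof.
move=> Ag; have [_ /relative_invariant_linsub[chi [chi0 _ _] chiP]] := fundP.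
by exists (chi g); [exact: chi0|exact: chiP].
Qed.

Lemma stab_conj g U : A g -> stab U -> stab (g *m U *m invmx g).
Proof.
move=> Ag U0; have [Au _ _ AV _] := algA; have gu : g \in unitmx by exact: Au.
have [chi chi0 gP] := group_linsub Ag.
have E : gl_act U (linsub g P) = linsub g (gl_act (g *m U *m invmx g) P).
  by apply: gl_act_linsub; rewrite mulmxKV.
move: E; rewrite gP gl_actZ U0 scaler0 => /esym/(congr1 (linsub (invmx g))).
by rewrite linsub_comp mulmxV // linsub1 rmorph0.
Qed.

Lemma connected_linear_matrix (F : {linear 'M[C]_n.+1 -> 'M[C]_n.+1}) :
  (forall U, lie_of_group A U -> exists W, forall g, F (U *m g) = W *m F g) ->
  F 1%:M = 0 -> forall g, A g -> F g = 0.
Proof.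
move=> FU F1 g Ag; apply: (can_inj mxvecK); apply/rowP => e; rewrite linear0 mxE.
rewrite -mxeval_linform; move: e g Ag; apply: connected_linear_system => // [U AU|e].
  have [W FW] := FU U AU; exists (fun e j => (lin_mx (mulmx W))^T e j) => e g Ag.
  rewrite dir_deriv_linform FW -[W *m F g]/(mulmx W (F g)) -lin_mx_mxvecE.
  by apply: eq_bigr => j _; rewrite mxeval_linform.
by rewrite mxeval_linform F1 linear0 mxE.
Qed.

Lemma group_image_irreducible (D : 'M[C]_n.+1) :
  (forall g, A g -> exists Z, g *m D = D *m Z) -> D = 0 \/ D \in unitmx.
Proof.
move=> gD; pose S := limg (linfun (@mulmx C n.+1 n.+1 1 D)).
have SP x : reflect (exists u, x = D *m u) (x \in S).
  apply: (iffP memv_imgP) => [[u _ ->]|[u ->]]; exists u; rewrite ?memvf ?lfunE //.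
have [|S0|SV] := irrA (S := S).
- move=> g x Ag /SP[u ->]; have [Z DZ] := gD g Ag.
  by apply/SP; exists (Z *m u); rewrite !mulmxA DZ.
- left; apply/matrixP => i j; have : D *m delta_mx j 0 \in S by apply/SP; exists (delta_mx j 0).
  by rewrite S0 memv0 -colE => /eqP/matrixP/(_ i 0); rewrite !mxE.
- right; have /choice[u uP] : forall j : 'I_n.+1, exists u : 'cV_n.+1, delta_mx j 0 = D *m u.
    by move=> j; apply/SP; rewrite SV memvf.
  suff /mulmx1_unit[] : D *m (\matrix_(i, j) u j i 0) = 1%:M by [].
  apply/matrixP => i j; rewrite !mxE; have /matrixP/(_ i 0) := uP j.
  by rewrite !mxE eqxx andbT => ->; apply: eq_bigr => a _; rewrite mxE.
Qed.

(** With pi a projection onto the image of k, the function (1 - pi) g pi solves a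
    linear system and vanishes at 1; so A preserves the image of k. *)
Lemma stab_image_irreducible (k : 'M[C]_n.+1) :
  (forall U, stab U -> exists Z, U *m k = k *m Z) -> k = 0 \/ k \in unitmx.
Proof.
move=> Uk; have [pi [G [piE pik]]] : exists pi G : 'M[C]_n.+1, pi = k *m G /\ pi *m k = k.
  by exists (k *m pinvmx k), (pinvmx k); rewrite mulmxKpV.
have pipi : (1%:M - pi) *m pi = 0 by rewrite mulmxBl mul1mx {3}piE mulmxA pik -piE subrr.
pose F : {linear 'M[C]_n.+1 -> 'M[C]_n.+1} := mulmxr pi \o mulmx (1%:M - pi).
have FE g : F g = (1%:M - pi) *m g *m pi by [].
have F0 : forall g, A g -> F g = 0.
  apply: connected_linear_matrix => [U AU|]; last by rewrite FE mulmx1 pipi.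
  exists ((1%:M - pi) *m U) => g.
  have [mu [_ /Uk[Z UZ]]] := lie_stab AU.
  have U0 : (1%:M - pi) *m U *m pi = 0.
    have Uk' : U *m k = k *m (Z - (mu / p%:R)%:M).
      by rewrite mulmxBr -UZ mulmxDl mul_scalar_mx mul_mx_scalar addrK.
    have Upi : U *m pi = k *m ((Z - (mu / p%:R)%:M) *m G).
      by rewrite piE (mulmxA U) Uk' mulmxA.
    have pk : (1%:M - pi) *m k = 0 by rewrite mulmxBl mul1mx pik subrr.
    by rewrite -mulmxA Upi (mulmxA (1%:M - pi)) pk mul0mx.
  by rewrite !FE !mulmxA [X in _ = X *m _ *m _]mulmxBr mulmx1 U0 subr0.
apply: group_image_irreducible => g Ag; exists (G *m g *m k).
have := F0 g Ag; rewrite FE => /(congr1 (mulmx^~ k)); rewrite mul0mx -mulmxA pik.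
by rewrite mulmxBl mul1mx mulmxBl => /eqP; rewrite subr_eq0 => /eqP ->; rewrite piE !mulmxA.
Qed.

(** The commutator g M - M g solves a linear system, so M commutes with A and
    Schur's lemma applies. *)
Lemma stab_centralizer_scalar (M : 'M[C]_n.+1) :
  (forall U, stab U -> U *m M = M *m U) -> exists c, M = c%:M.
Proof.
move=> UM; pose F : {linear 'M[C]_n.+1 -> 'M[C]_n.+1} := mulmxr M \- mulmx M.
have FE g : F g = g *m M - M *m g by [].
have F0 : forall g, A g -> F g = 0.
  apply: connected_linear_matrix => [U AU|]; last by rewrite FE mul1mx mulmx1 subrr.
  exists U => g; have [mu [_ /UM]] := lie_stab AU.
  rewrite mulmxDl mulmxDr mul_scalar_mx mul_mx_scalar => /addIr MU.
  by rewrite !FE mulmxBr !mulmxA MU.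
have [//|c] := @eigenvalue_closed C _ M; rewrite /eigenvalue => cM.
exists c; have [||Mu] := @group_image_irreducible (M - c%:M).
- move=> g Ag; exists g; have := F0 g Ag; rewrite FE => /eqP; rewrite subr_eq0 => /eqP gM.
  by rewrite mulmxBr mulmxBl gM mul_mx_scalar mul_scalar_mx.
- by move=> /eqP; rewrite subr_eq0 => /eqP.
- by case/negP: cM; rewrite /eigenspace kermx_eq0 row_free_unit.
Qed.

(** Multiply Q by an equation of the complement of the orbit. *)
Lemma orbit_dense x0 (Q : {mpoly C[n.+1]}) : zariski_open [set g *m x0 | g in A] ->
  (forall g, A g -> veval Q (g *m x0) = 0) -> Q = 0.
Proof.
move=> [F FE] Q0; have [_ A1 _ _ _] := algA.
have [f Ff fx0] : exists2 f, F f & mxeval f x0 != 0.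
  apply: contrapT => nf; have : (~` [set g *m x0 | g in A]) x0.
    rewrite FE => f Ff; apply/eqP; apply: contrapT => /negP fx0.
    by apply: nf; exists f.
  by apply; exists 1%:M; rewrite ?mul1mx.
pose f' : {mpoly C[n.+1]} := linsub (\matrix_(e, i) mxvec (delta_mx i 0 : 'cV[C]_n.+1) 0 e) f.
have f'E (x : 'cV_n.+1) : veval f' x = mxeval f x.
  rewrite /veval meval_linsub; apply: meval_eq => e.
  rewrite {2}(matrix_sum_delta x) (exchange_big _ _ _ _) big_ord1 linear_sum summxE.
  by apply: eq_bigr => i _; rewrite linearZ !mxE mulrC.
suff /eqP : Q * f' = 0.
  rewrite mulf_eq0 => /orP[/eqP//|/eqP f0]; case/eqP: fx0.
  by rewrite -f'E f0 /veval meval0.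
apply: mpoly_fun_eq0 => v; rewrite mevalM; pose x : 'cV[C]_n.+1 := \col_i v i.
have vE q : q.@[v] = veval q x by apply: meval_eq => i; rewrite mxE.
rewrite !vE f'E; have [[g Ag gx]|nx] := pselect ([set g *m x0 | g in A] x).
  by rewrite -gx Q0 ?mul0r.
by have : (~` [set g *m x0 | g in A]) x by []; rewrite FE => /(_ f Ff) ->; rewrite mulr0.
Qed.

(** Q and P have the same infinitesimal character under a, so that
    Q (g x0) P (x0) - P (g x0) Q (x0) solves a linear system with zero initial
    value: Q / P is constant on the open orbit. *)
Lemma stab_invariants Q : Q \is p.-homog -> (forall U, stab U -> gl_act U Q = 0) ->
  exists c, Q = c *: P.
Proof.
move=> homQ Q0; have [x0 openx0] := preA.
have inv_orbit g : A g -> veval P x0 * veval Q (g *m x0) - veval Q x0 * veval P (g *m x0) = 0.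
  move=> Ag; pose f := veval P x0 *: orbit_poly x0 Q - veval Q x0 *: orbit_poly x0 P.
  have fE h : mxeval f h = veval P x0 * veval Q (h *m x0) - veval Q x0 * veval P (h *m x0).
    by rewrite mxeval_lin !mxeval_orbit_poly.
  rewrite -fE; move: g Ag; apply: (connected_linear_system algA conA (f := fun _ : unit => f) _ _ tt).
    move=> U AU; have [mu [muP U0]] := lie_stab AU; exists (fun _ _ => - mu) => _ g Ag.
    have muQ : gl_act U Q = mu *: Q.
      have := Q0 _ U0; rewrite gl_actDl (gl_act_scalar _ homQ) divfK.
        by move/eqP; rewrite scaleNr subr_eq0 => /eqP.
      by rewrite pnatr_eq0 fundamental_degree.
    rewrite /f dir_deriv_lin -/f !dir_deriv_orbit_poly muP muQ (bigD1 tt) //= big1 ?addr0 => [|[]//].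
    rewrite fE /veval !mevalZ; ring.
  by move=> _; rewrite fE !mul1mx mulrC subrr.
have Px0 : veval P x0 != 0.
  apply/eqP => Px0; case/eqP: fundamental_neq0; apply: orbit_dense openx0 _ => g Ag.
  have [_ [_ _ [chi _ relP]]] := fundP.
  by have := relP g x0 Ag; rewrite /veval !meval1 !mulr1 => ->; rewrite -/(veval P x0) Px0 mulr0.
exists (veval Q x0 / veval P x0).
have : veval P x0 *: Q - veval Q x0 *: P = 0.
  apply: orbit_dense openx0 _ => g Ag; rewrite /veval mevalB !mevalZ; exact: inv_orbit.
move=> /eqP; rewrite subr_eq0 => /eqP/(congr1 (fun q => (veval P x0)^-1 *: q)).
by rewrite !scalerA mulVf // scale1r mulrC.
Qed.

End Prehomogeneous.

(** * Traceless matrices, first variations, Frobenius norm *)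

Lemma det_1_mul (K : comNzRingType) n (u : 'cV[K]_n) (v : 'rV[K]_n) :
  \det (1%:M + u *m v) = 1 + (v *m u) 0 0.
Proof.
have E1 : block_mx 1%:M (- v) u 1%:M =
    block_mx 1%:M 0 u 1%:M *m block_mx (1%:M : 'M_1) (- v) 0 (1%:M + u *m v).
  rewrite mulmx_block !(mul1mx, mul0mx, mulmx1, mulmx0, addr0) mulmxN; congr block_mx.
  by rewrite addrCA addNr addr0.
have E2 : block_mx 1%:M (- v) u 1%:M =
    block_mx (1%:M : 'M_1) (- v) 0 1%:M *m block_mx (1%:M + v *m u) 0 u 1%:M.
  by rewrite mulmx_block !(mul1mx, mul0mx, mulmx1, mulmx0, add0r) mulNmx addrK.
have := E1; rewrite {1}E2 => /(congr1 determinant).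
rewrite !det_mulmx !det_lblock !det_ublock !det1 !mul1r !mulr1 => <-.
by rewrite det_mx11 !mxE.
Qed.

(** The traceless matrices are spanned by the square-zero matrices u v of rank
    one; these are convenient because 1 + t u v has determinant 1 for all t. *)
Lemma trace_functional (K : fieldType) n (L : 'M[K]_n.+1 -> K) : scalar L ->
  (forall (u : 'cV[K]_n.+1) (v : 'rV[K]_n.+1), v *m u = 0 -> L (u *m v) = 0) ->
  forall U, L U = L (delta_mx 0 0) * \tr U.
Proof.
move=> linL L0 U.
pose fL : {scalar 'M[K]_n.+1} := HB.pack L (GRing.isLinear.Build K _ K _ L linL).
have LE : L = fL by [].
have dE i j : delta_mx i j = (delta_mx i 0 : 'cV[K]_n.+1) *m (delta_mx 0 j : 'rV[K]_n.+1) by rewrite mul_delta_mx.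
have offdiag i j : i != j -> L (delta_mx i j) = 0.
  move=> ij; rewrite dE L0 //; apply/matrixP => a b.
  by rewrite mul_delta_mx_cond eq_sym (negPf ij) mxE.
have diag i : L (delta_mx i i) = L (delta_mx 0 0).
  have [->//|i0] := eqVneq i 0.
  (* (e_i + e_0) (e_i - e_0)^T links two diagonal entries *)
  have := L0 (delta_mx i 0 + delta_mx 0 0) (delta_mx 0 i - delta_mx 0 0).
  have -> : (delta_mx i 0 + delta_mx 0 0 : 'cV[K]_n.+1) *m (delta_mx 0 i - delta_mx 0 0 : 'rV_n.+1) =
    delta_mx i i - delta_mx i 0 + (delta_mx 0 i - delta_mx 0 0).
    by rewrite mulmxDl !mulmxBr !mul_delta_mx.
  rewrite LE !linearD !linearN /= (offdiag i 0) // (offdiag 0 i) 1?eq_sym // subr0 sub0r => h.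
  apply/eqP; rewrite -subr_eq0; apply/eqP; apply: h.
  rewrite !mulmxBl !mul_delta_mx_cond (eq_sym 0) (negPf i0) !eqxx !mulr0n !mulr1n.
  by rewrite subr0 sub0r subrr.
rewrite {1}(matrix_sum_delta U) LE (linear_sum fL) mulr_sumr; apply: eq_bigr => i _.
rewrite (linear_sum fL) (bigD1 i) //= big1 ?addr0 => [|j ji].
  by rewrite [L _](scalarZ fL) /= diag mulrC.
by rewrite [L _](scalarZ fL) /= offdiag ?mulr0 // eq_sym.
Qed.

Section FirstOrder.
Variables (C : numClosedFieldType).

(** Compare t and - t for a small positive t. *)
Lemma first_order_zero (a : C) (q : {poly C}) :
  (forall t, t \is Num.real -> 0 <= t * a + t ^+ 2 * q.[t]) -> a = 0.
Proof.
move=> qge0; apply/eqP; apply: contraT => a0.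
pose B := \sum_(i < size q) `|q`_i|.
have B0 : 0 <= B by apply: sumr_ge0 => i _.
have qB t : `|t| <= 1 -> `|q.[t]| <= B.
  move=> t1; rewrite horner_coef; apply: le_trans (ler_norm_sum _ _ _) _.
  apply: ler_sum => i _; rewrite normrM normrX ler_piMr // exprn_ile1 //.
pose t := `|a| / (`|a| + 3 * B + 1).
have den : 0 < `|a| + 3 * B + 1 by rewrite ltr_wpDl // addr_ge0 ?mulr_ge0.
have t0 : 0 < t by rewrite divr_gt0 ?normr_gt0.
have t1 : t <= 1 by rewrite ler_pdivrMr // mul1r -addrA lerDl addr_ge0 ?mulr_ge0.
have nt : `|t| = t by rewrite ger0_norm // ltW.
have u0 : 0 <= a + t * q.[t].
  have := qge0 t (ger0_real (ltW t0)).
  by rewrite (_ : _ + _ = t * (a + t * q.[t])) ?pmulr_rge0 //; ring.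
have v0 : 0 <= - a + t * q.[- t].
  have := qge0 (- t); rewrite realN => /(_ (ger0_real (ltW t0))).
  by rewrite (_ : _ + _ = t * (- a + t * q.[- t])) ?pmulr_rge0 //; ring.
have q1 : `|q.[t]| <= B by rewrite qB ?nt.
have q2 : `|q.[- t]| <= B by rewrite qB ?normrN ?nt.
have uv : a + t * q.[t] <= t * (2 * B).
  apply: (@le_trans _ _ ((a + t * q.[t]) + (- a + t * q.[- t]))); first by rewrite lerDl.
  rewrite addrACA subrr add0r -mulrDr ler_wpM2l ?(ltW t0) //.
  have qr : q.[t] + q.[- t] \is Num.real.
    apply: ger0_real; rewrite -(pmulr_rge0 _ t0) mulrDr.
    have := addr_ge0 u0 v0; by rewrite addrACA subrr add0r.
  apply: le_trans (real_ler_norm qr) _; apply: le_trans (ler_normD _ _) _.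
  by rewrite mulrDl mul1r lerD.
have : `|a| <= t * (3 * B).
  rewrite -[a](addrK (t * q.[t])); apply: le_trans (ler_normB _ _) _.
  rewrite ger0_norm // normrM nt.
  have -> : t * (3 * B) = t * (2 * B) + t * B by ring.
  by apply: lerD => //; rewrite ler_wpM2l ?(ltW t0).
move=> h; suff: `|a| < `|a| by rewrite ltxx.
apply: le_lt_trans h _.
rewrite /t mulrAC ltr_pdivrMr // ltr_pM2l ?normr_gt0 //.
by rewrite -addrA addrCA ltrDl ltr_wpDl ?ltr01.
Qed.

Lemma real_order (x y : C) : 0 <= x -> 0 <= y -> x <= y \/ y < x.
Proof. by move=> x0 y0; have [|] := real_leP (ger0_real x0) (ger0_real y0); [left|right]. Qed.

Lemma le_of_perturbation (a b N : C) : 0 <= N -> 0 <= a -> 0 <= b ->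
  (forall e, 0 < e -> a <= b + e * N) -> a <= b.
Proof.
move=> N0 a0 b0 le; have [//|lt] := real_order a0 b0.
have D0 : 0 < a - b by rewrite subr_gt0.
have N1 : 0 < N + 1 by rewrite ltr_wpDl.
have := le ((a - b) / (N + 1)); rewrite divr_gt0 // => /(_ isT).
rewrite -lerBlDl mulrAC ler_pdivlMr // ler_pM2l // => h.
by have lt1 : N < N + 1 by [rewrite ltrDl]; have := lt_le_trans lt1 h; rewrite ltxx.
Qed.

End FirstOrder.

Section NormSquare.
Variable C : numClosedFieldType.

Lemma mxadjK m n (X : 'M[C]_(m, n)) : mxadj (mxadj X) = X.
Proof. by apply/matrixP => i j; rewrite !mxE conjCK. Qed.

Lemma mxadjM m n l (X : 'M[C]_(m, n)) (Y : 'M_(n, l)) : mxadj (X *m Y) = mxadj Y *m mxadj X.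
Proof. by rewrite /mxadj map_mxM trmx_mul. Qed.

Lemma mxadjB m n (X Y : 'M[C]_(m, n)) : mxadj (X - Y) = mxadj X - mxadj Y.
Proof. by apply/matrixP => i j; rewrite !mxE rmorphB. Qed.

Lemma mxadjD m n (X Y : 'M[C]_(m, n)) : mxadj (X + Y) = mxadj X + mxadj Y.
Proof. by apply/matrixP => i j; rewrite !mxE rmorphD. Qed.

Lemma mxadjZ m n a (X : 'M[C]_(m, n)) : mxadj (a *: X) = a^* *: mxadj X.
Proof. by apply/matrixP => i j; rewrite !mxE rmorphM. Qed.

Lemma mxadj1 n : mxadj (1%:M : 'M[C]_n) = 1%:M.
Proof. by apply/matrixP => i j; rewrite !mxE eq_sym rmorph_nat. Qed.

Lemma mxtrace_mxadj n (X : 'M[C]_n) : \tr (mxadj X) = (\tr X)^*.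
Proof. by rewrite /mxadj mxtrace_tr rmorph_sum; apply: eq_bigr => i _; rewrite mxE. Qed.

(** The squared Frobenius norm. *)
Definition nrm2 m n (X : 'M[C]_(m, n)) : C := \tr (X *m mxadj X).

Lemma nrm2E m n (X : 'M[C]_(m, n)) : nrm2 X = \sum_i \sum_j X i j * (X i j)^*.
Proof.
by apply: eq_bigr => i _; rewrite mxE; apply: eq_bigr => j _; rewrite !mxE.
Qed.

Lemma nrm2_ge0 m n (X : 'M[C]_(m, n)) : 0 <= nrm2 X.
Proof. by rewrite nrm2E; do 2!apply: sumr_ge0 => ? _; exact: mul_conjC_ge0. Qed.

Lemma nrm2_entry m n (X : 'M[C]_(m, n)) i j : X i j * (X i j)^* <= nrm2 X.
Proof.
rewrite nrm2E (bigD1 i) //= (bigD1 j) //= -addrA lerDl addr_ge0 //.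
  by apply: sumr_ge0 => ? _; exact: mul_conjC_ge0.
by do 2!apply: sumr_ge0 => ? _; exact: mul_conjC_ge0.
Qed.

Lemma nrm2_eq0 m n (X : 'M[C]_(m, n)) : nrm2 X = 0 -> X = 0.
Proof.
move=> X0; apply/matrixP => i j; rewrite mxE; apply/eqP.
by rewrite -mul_conjC_eq0 eq_le mul_conjC_ge0 andbT -X0 nrm2_entry.
Qed.

Lemma nrm2_mxadj m n (X : 'M[C]_(m, n)) : nrm2 (mxadj X) = nrm2 X.
Proof. by rewrite /nrm2 mxadjK mxtrace_mulC. Qed.

Lemma nrm2Z m n a (X : 'M[C]_(m, n)) : nrm2 (a *: X) = a * a^* * nrm2 X.
Proof. by rewrite /nrm2 mxadjZ -scalemxAl -scalemxAr scalerA linearZ. Qed.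

(** Cauchy-Schwarz, from the norm of |z|^2 X - X z z^*. *)
Lemma nrm2_mul_col m n (X : 'M[C]_(m, n)) (z : 'cV_n) : nrm2 (X *m z) <= nrm2 X * nrm2 z.
Proof.
have [z0|z0] := eqVneq (nrm2 z) 0.
  by rewrite (nrm2_eq0 z0) mulmx0 /nrm2 !mul0mx !linear0 mulr0.
have zp : 0 < nrm2 z by rewrite lt0r z0 nrm2_ge0.
have zz : mxadj z *m z = (nrm2 z)%:M.
  by rewrite [LHS]mx11_scalar /nrm2 mxtrace_mulC /mxtrace big_ord1.
have zr : (nrm2 z)^* = nrm2 z by apply/conj_Creal; rewrite ger0_real // ltW.
have := nrm2_ge0 (nrm2 z *: X - X *m z *m mxadj z).
have -> : nrm2 (nrm2 z *: X - X *m z *m mxadj z) = nrm2 z * (nrm2 X * nrm2 z - nrm2 (X *m z)).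
  set Y := X *m z.
  have e1 : X *m mxadj (Y *m mxadj z) = Y *m mxadj Y by rewrite mxadjM mxadjK mulmxA.
  have e2 : Y *m mxadj z *m mxadj X = Y *m mxadj Y by rewrite {3}/Y mxadjM mulmxA.
  have e3 : Y *m mxadj z *m mxadj (Y *m mxadj z) = nrm2 z *: (Y *m mxadj Y).
    by rewrite mxadjM mxadjK mulmxA -(mulmxA Y) zz mul_mx_scalar -scalemxAl.
  rewrite {1}/nrm2 mxadjB mxadjZ mulmxBl !mulmxBr zr -!scalemxAl -!scalemxAr e1 e2 e3.
  by rewrite !linearB !linearZ /= -/(nrm2 X) -/(nrm2 Y); ring.
by rewrite pmulr_rge0 // subr_ge0.
Qed.

End NormSquare.

(** * The Kempf-Ness argument *)

Section KempfNess.
Variables (C : numClosedFieldType) (n : nat) (P : {mpoly C[n.+1]}).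
Implicit Types (k U V N : 'M[C]_n.+1) (x : {mpoly C[n.+1]}).

Lemma linsub_taylor N x : exists rho : {poly {mpoly C[n.+1]}}, forall t,
  linsub (1%:M + t *: N) x = x - t *: gl_act N x + t ^+ 2 *: rho.[t%:MP].
Proof.
elim/mpoly_ring_ind: x => [c|i|p q [r rE] [s sE]|p q [r rE] [s sE]].
- by exists 0 => t; rewrite linsubC gl_actC scaler0 subr0 horner0 scaler0 addr0.
- exists 0 => t; rewrite horner0 scaler0 addr0 gl_actX scalerN opprK linsubX.
  under eq_bigr do rewrite mxE scalerDl [(t *: N) _ _]mxE -scalerA.
  rewrite big_split /= scaler_sumr; congr (_ + _).
  rewrite (bigD1 i) //= mxE eqxx scale1r big1 ?addr0 // => j ji.
  by rewrite mxE eq_sym (negPf ji) scale0r.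
- exists (r + s) => t; rewrite (rmorphD (linsub _)) /= rE sE gl_actD hornerD.
  by rewrite !scalerDr opprD; ring.
- pose a := gl_act N p; pose b := gl_act N q.
  exists ((a * b)%:P + p%:P * s + q%:P * r - 'X * (a%:P * s + b%:P * r) + 'X^2 * (r * s)) => t.
  rewrite (rmorphM (linsub _)) /= rE sE gl_actM !hornerE /= -/a -/b.
  rewrite -!mul_mpolyC !rmorphXn /=; ring.
Qed.

Lemma fischer_poly (r s : {poly {mpoly C[n.+1]}}) : exists q : {poly C},
  forall t, t \is Num.real -> fischer (mconj r.[t%:MP]) s.[t%:MP] = q.[t].
Proof.
exists (\sum_(i < size r) \sum_(j < size s) (fischer (mconj r`_i) s`_j)%:P * 'X^(i + j)).
move=> t tr; rewrite [r.[_]]horner_coef [s.[_]]horner_coef rmorph_sum /= fischer_suml horner_sum.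
apply: eq_bigr => i _; rewrite fischer_sumr horner_sum; apply: eq_bigr => j _.
rewrite hornerM hornerC hornerXn -!rmorphXn /= mulrC mul_mpolyC mconjZ fischerZl.
rewrite [s`_j * _]mulrC mul_mpolyC fischerZr exprD rmorphXn /=.
by rewrite (conj_Creal tr); ring.
Qed.

(** The squared norm of P o k, with a penalty that keeps k bounded. *)
Definition energy (e : C) k : C := fischer (mconj (linsub k P)) (linsub k P) + e * nrm2 k.

(** Up to a factor - 2 and a real part, the derivative of the energy along
    k (1 + t U). *)
Definition moment (e : C) k U : C :=
  fischer (mconj (linsub k P)) (gl_act U (linsub k P)) - e * \tr (k *m U *m mxadj k).

Lemma fischer_conj_sym x y : fischer (mconj x) y = (fischer (mconj y) x)^*.
Proof. by rewrite -fischer_mconj mconjK fischerC. Qed.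

Lemma fischer_expand x b r t : t \is Num.real ->
  fischer (mconj (x - t *: b + t ^+ 2 *: r)) (x - t *: b + t ^+ 2 *: r) =
  fischer (mconj x) x - t * (fischer (mconj x) b + fischer (mconj b) x)
  + t ^+ 2 * (fischer (mconj b) b + fischer (mconj x) r + fischer (mconj r) x
      - t * (fischer (mconj b) r + fischer (mconj r) b) + t ^+ 2 * fischer (mconj r) r).
Proof.
move=> tr.
have -> : mconj (x - t *: b + t ^+ 2 *: r) = mconj x - t *: mconj b + t ^+ 2 *: mconj r.
  by rewrite rmorphD rmorphB /= !mconjZ rmorphXn /= (conj_Creal tr).
rewrite !(fischerDl, fischerDr, fischerNl, fischerNr, fischerZl, fischerZr).
move: (fischer (mconj x) x) (fischer (mconj x) b) (fischer (mconj b) x) => b1 b2 b3.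
move: (fischer (mconj b) b) (fischer (mconj x) r) (fischer (mconj r) x) => b4 b5 b6.
move: (fischer (mconj b) r) (fischer (mconj r) b) (fischer (mconj r) r) => b7 b8 b9.
ring.
Qed.

Lemma moment_critical_re e k N : e \is Num.real -> \det k = 1 ->
  (forall t, \det (1%:M + t *: N) = 1) ->
  (forall k', \det k' = 1 -> energy e k <= energy e k') ->
  moment e k N + (moment e k N)^* = 0.
Proof.
move=> er k1 N1 kmin; set x := linsub k P.
have [rho rhoE] := linsub_taylor N x.
have [q0 q0E] := fischer_poly rho rho.
have [q1 q1E] := fischer_poly x%:P rho.
have [q1' q1'E] := fischer_poly rho x%:P.
have [q2 q2E] := fischer_poly (gl_act N x)%:P rho.
have [q2' q2'E] := fischer_poly rho (gl_act N x)%:P.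
apply/eqP; rewrite -oppr_eq0; apply/eqP.
apply: (@first_order_zero _ _ ((fischer (mconj (gl_act N x)) (gl_act N x) + e * nrm2 (k *m N))%:P
   + q1 + q1' - 'X * (q2 + q2') + 'X^2 * q0)) => t tr.
have := kmin (k *m (1%:M + t *: N)); rewrite det_mulmx k1 N1 mulr1 => /(_ erefl).
rewrite -subr_ge0; congr (0 <= _).
have nE : nrm2 (k *m (1%:M + t *: N)) = nrm2 k + t * (\tr (k *m N *m mxadj k) + (\tr (k *m N *m mxadj k))^*)
    + t ^+ 2 * nrm2 (k *m N).
  rewrite -mxtrace_mxadj !mxadjM mxadjK /nrm2 mulmxDr mulmx1 -scalemxAr mxadjD mxadjZ (conj_Creal tr).
  rewrite mulmxDl !mulmxDr -!scalemxAl -!scalemxAr scalerA !linearD !linearZ /= mxadjM !mulmxA.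
  by move: (\tr _) (\tr _) (\tr _) (\tr _) => a1 a2 a3 a4; ring.
have xE : linsub (k *m (1%:M + t *: N)) P = x - t *: gl_act N x + t ^+ 2 *: rho.[t%:MP].
  by rewrite -linsub_comp rhoE.
rewrite /energy nE xE -/x.
rewrite fischer_expand // !hornerE /= -(q0E t tr) -(q1E t tr) -(q1'E t tr) -(q2E t tr) -(q2'E t tr).
rewrite !hornerC /moment -/x rmorphB rmorphM /= (conj_Creal er).
rewrite -(fischer_conj_sym (gl_act N x) x).
move: (nrm2 k) (nrm2 (k *m N)) (\tr _) => a1 a2 a3.
move: (gl_act N x) (rho.[_]) => b r.
move: (fischer (mconj x) x) (fischer (mconj x) b) (fischer (mconj b) x) => b1 b2 b3.
move: (fischer (mconj b) b) (fischer (mconj x) r) (fischer (mconj r) x) => b4 b5 b6.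
move: (fischer (mconj b) r) (fischer (mconj r) b) (fischer (mconj r) r) => b7 b8 b9.
ring.
Qed.

Lemma moment_linear e k : scalar (moment e k).
Proof.
move=> a U V; rewrite /moment gl_actDl gl_actZl fischerDr fischerZr.
rewrite mulmxDr mulmxDl -scalemxAr -scalemxAl linearD linearZ /=; ring.
Qed.

(** Variations along N and i N give the real and imaginary parts. *)
Lemma moment_critical e k U : e \is Num.real -> \det k = 1 ->
  (forall k', \det k' = 1 -> energy e k <= energy e k') -> \tr U = 0 -> moment e k U = 0.
Proof.
move=> er k1 kmin trU.
rewrite (trace_functional (@moment_linear e k)) ?trU ?mulr0 // => u v vu.
have N1 a t : \det (1%:M + t *: (a *: (u *m v))) = 1.
  by rewrite scalerA scalemxAl det_1_mul -scalemxAr vu scaler0 mxE addr0.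
have re := moment_critical_re er k1 (N1 1) kmin.
have im := moment_critical_re er k1 (N1 'i) kmin.
move: re im; rewrite scale1r; set m := moment e k (u *m v).
have -> : moment e k ('i *: (u *m v)) = 'i * m.
  have := @moment_linear e k 'i (u *m v) 0; rewrite addr0 => ->.
  by rewrite (_ : moment e k 0 = 0) ?addr0 // /moment gl_act0l fischer0r mulmx0 mul0mx linear0 mulr0 subrr.
rewrite rmorphM /= conjCi mulNr -mulrBr => re /eqP; rewrite mulf_eq0 (negPf (neq0Ci C)) /= subr_eq0 => /eqP mm.
by move/eqP: re; rewrite -mm -mulr2n mulrn_eq0 => /eqP.
Qed.

(** For V = k^-1 U k one has V.x = 0, hence |V^*.x|^2 = <[V, V^*].x, x>, and the
    bracket is traceless so that criticality evaluates the right hand side. *)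
Lemma critical_stab e k U : \det k = 1 -> (forall V, \tr V = 0 -> moment e k V = 0) ->
  gl_act U P = 0 -> let V := invmx k *m U *m k in
  fischer (mconj (gl_act (mxadj V) (linsub k P))) (gl_act (mxadj V) (linsub k P)) =
  e * (nrm2 (U *m k) - nrm2 (V *m mxadj k)).
Proof.
move=> k1 crit U0 V; set x := linsub k P.
have ku : k \in unitmx by rewrite unitmxE k1 unitr1.
have kV : k *m V = U *m k by rewrite /V !mulmxA mulmxV // mul1mx.
have Vx : gl_act V x = 0 by rewrite (gl_act_linsub _ kV) U0 rmorph0.
have trL : \tr (lie V (mxadj V)) = 0 by rewrite /lie /= /mxlie linearB /= mxtrace_mulC subrr.
have := crit _ trL; rewrite /moment -/x gl_act_lie Vx gl_act0 subr0 fischer_conj_gl_act.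
move=> /eqP; rewrite subr_eq0 => /eqP ->; congr (_ * _).
clearbody V; rewrite /lie /= /mxlie mulmxBr mulmxBl linearB /= -kV /nrm2 !mxadjM mxadjK !mulmxA.
by congr (_ - _); rewrite -(mulmxA (k *m mxadj V)) mxtrace_mulC !mulmxA.
Qed.

(** A consequence of [critical_stab] that is homogeneous in k and does not
    involve k^-1, so that it survives in the limit of k / |k|: it makes the
    kernel of k^* stable under U^*. *)
Lemma critical_bound e k U (w : 'cV[C]_n.+1) : 0 < e -> \det k = 1 ->
  (forall V, \tr V = 0 -> moment e k V = 0) -> gl_act U P = 0 ->
  nrm2 (k *m mxadj k *m mxadj U *m w) <= nrm2 (U *m k) * nrm2 (mxadj k *m w).
Proof.
move=> e0 k1 crit U0.
have ku : k \in unitmx by rewrite unitmxE k1 unitr1.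
have := fischer_conj_ge0 (gl_act (mxadj (invmx k *m U *m k)) (linsub k P)).
rewrite (critical_stab k1 crit U0) pmulr_rge0 // subr_ge0 => le.
apply: le_trans (ler_wpM2r (nrm2_ge0 _) le).
rewrite -(nrm2_mxadj (_ *m mxadj k)).
have -> : k *m mxadj k *m mxadj U *m w =
    mxadj (invmx k *m U *m k *m mxadj k) *m (mxadj k *m w).
  have kk : mxadj (invmx k) *m mxadj k = 1%:M by rewrite -mxadjM mulmxV // mxadj1.
  by rewrite !mxadjM mxadjK !mulmxA -(mulmxA _ _ (mxadj k)) kk mulmx1.
exact: nrm2_mul_col.
Qed.

Lemma adjoint_bound_scale (s : C) k U (w : 'cV[C]_n.+1) :
  nrm2 (k *m mxadj k *m mxadj U *m w) <= nrm2 (U *m k) * nrm2 (mxadj k *m w) ->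
  nrm2 (s *: k *m mxadj (s *: k) *m mxadj U *m w) <=
    nrm2 (U *m (s *: k)) * nrm2 (mxadj (s *: k) *m w).
Proof.
rewrite mxadjZ -!scalemxAl -!scalemxAr -!scalemxAl !scalerA !nrm2Z.
move: (nrm2 (_ *m w)) (nrm2 (U *m k)) (nrm2 (_ *m w)) => c b a le.
have s0 : 0 <= (s * s^*) ^+ 2 by rewrite exprn_ge0 // mul_conjC_ge0.
rewrite rmorphM /= !conjCK.
have -> : s * s^* * (s^* * s) * a = (s * s^*) ^+ 2 * a by ring.
have -> : s * s^* * b * (s^* * s * c) = (s * s^*) ^+ 2 * (b * c) by ring.
exact: ler_wpM2l.
Qed.

Lemma critical_stab_adjoint k U : \det k = 1 -> (forall V, \tr V = 0 -> moment 0 k V = 0) ->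
  gl_act U P = 0 -> gl_act (mxadj (invmx k *m U *m k)) (linsub k P) = 0.
Proof.
move=> k1 crit U0; apply/eqP; rewrite -fischer_conj_eq0.
by rewrite (critical_stab k1 crit U0) mul0r.
Qed.

End KempfNess.

(** * Existence of the minimum *)

Section PolyFunctions.
Variables (C : numClosedFieldType) (n : nat).
Local Notation polyfun := (@mxpolyfun C n).

Lemma mxpolyfun_ext (f g : 'M[C]_n -> C) : f =1 g -> polyfun f -> polyfun g.
Proof. by move=> /funext ->. Qed.

Lemma mxpolyfun_sum (J : Type) (s : seq J) (Q : pred J) (F : J -> 'M[C]_n -> C) :
  (forall j, polyfun (F j)) -> polyfun (fun k => \sum_(j <- s | Q j) F j k).
Proof.
move=> polF; elim: s => [|j s IHs].
  by apply: mxpolyfun_ext (mxpolyfun_cst _ 0) => k; rewrite big_nil.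
case Qj: (Q j); last by apply: mxpolyfun_ext IHs => k; rewrite big_cons Qj.
by apply: mxpolyfun_ext (mxpolyfun_add (polF j) IHs) => k; rewrite big_cons Qj.
Qed.

Lemma mxpolyfun_prod (J : Type) (s : seq J) (F : J -> 'M[C]_n -> C) :
  (forall j, polyfun (F j)) -> polyfun (fun k => \prod_(j <- s) F j k).
Proof.
move=> polF; elim: s => [|j s IHs].
  by apply: mxpolyfun_ext (mxpolyfun_cst _ 1) => k; rewrite big_nil.
by apply: mxpolyfun_ext (mxpolyfun_mul (polF j) IHs) => k; rewrite big_cons.
Qed.

Lemma mxpolyfun_opp f : polyfun f -> polyfun (fun k => - f k).
Proof.
move=> pf; apply: mxpolyfun_ext (mxpolyfun_mul (mxpolyfun_cst _ (-1)) pf) => k.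
by rewrite mulN1r.
Qed.

Lemma mxpolyfun_sub f g : polyfun f -> polyfun g -> polyfun (fun k => f k - g k).
Proof. by move=> pf pg; apply: mxpolyfun_add => //; exact: mxpolyfun_opp. Qed.

Lemma mxpolyfun_det : polyfun (fun k => \det k).
Proof.
rewrite /determinant; apply: mxpolyfun_sum => s; apply: mxpolyfun_mul; first exact: mxpolyfun_cst.
by apply: mxpolyfun_prod => i; exact: mxpolyfun_entry.
Qed.

Definition mxpolymap m1 m2 (F : 'M[C]_n -> 'M[C]_(m1, m2)) := forall i j, polyfun (fun k => F k i j).

Lemma mxpolymap_id : mxpolymap (fun k => k).
Proof. by move=> i j; exact: mxpolyfun_entry. Qed.

Lemma mxpolymap_cst m1 m2 (X : 'M[C]_(m1, m2)) : mxpolymap (fun=> X).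
Proof. by move=> i j; exact: mxpolyfun_cst. Qed.

Lemma mxpolymap_mul m1 m2 m3 (F : 'M[C]_n -> 'M[C]_(m1, m2)) (G : 'M[C]_n -> 'M[C]_(m2, m3)) :
  mxpolymap F -> mxpolymap G -> mxpolymap (fun k => F k *m G k).
Proof.
move=> pF pG i j; have := @mxpolyfun_sum _ (index_enum _) predT (fun a k => F k i a * G k a j)
  (fun a => mxpolyfun_mul (pF i a) (pG a j)).
by apply: mxpolyfun_ext => k; rewrite mxE.
Qed.

Lemma mxpolymap_adj m1 m2 (F : 'M[C]_n -> 'M[C]_(m1, m2)) :
  mxpolymap F -> mxpolymap (fun k => mxadj (F k)).
Proof.
by move=> pF i j; apply: mxpolyfun_ext (mxpolyfun_conj (pF j i)) => k; rewrite !mxE.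
Qed.

Lemma mxpolyfun_nrm2 m1 m2 (F : 'M[C]_n -> 'M[C]_(m1, m2)) :
  mxpolymap F -> polyfun (fun k => nrm2 (F k)).
Proof.
move=> pF; rewrite /nrm2; apply: mxpolyfun_sum => i.
by have := mxpolymap_mul pF (mxpolymap_adj pF) i i.
Qed.

Lemma mxpolyfun_mcoeff_linsub (P : {mpoly C[n]}) m : polyfun (fun k => (linsub k P)@_m).
Proof.
elim/mpoly_ring_ind: P m => [c|i|P Q IHP IHQ|P Q IHP IHQ] m.
- by apply: mxpolyfun_ext (mxpolyfun_cst _ (c%:MP@_m)) => k; rewrite linsubC.
- have := @mxpolyfun_sum _ (index_enum _) predT (fun j k => k i j * ('X_j : {mpoly C[n]})@_m)
    (fun j => mxpolyfun_mul (mxpolyfun_entry C i j) (mxpolyfun_cst _ _)).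
  apply: mxpolyfun_ext => k; rewrite linsubX raddf_sum; apply: eq_bigr => j _.
  by rewrite /= mcoeffZ.
- by apply: mxpolyfun_ext (mxpolyfun_add (IHP m) (IHQ m)) => k; rewrite rmorphD mcoeffD.
- pose F (a : 'X_{1..n < (mdeg m).+1, (mdeg m).+1}) k := (linsub k P)@_(val a.1) * (linsub k Q)@_(val a.2).
  have polF a : polyfun (F a) by apply: mxpolyfun_mul; [exact: IHP|exact: IHQ].
  have := mxpolyfun_sum (index_enum _) (fun a : 'X_{1..n < (mdeg m).+1, (mdeg m).+1} =>
    m == (val a.1 + val a.2)%MM) polF.
  by apply: mxpolyfun_ext => k; rewrite rmorphM mcoeffM.
Qed.

Lemma mxpolyfun_fischer_linsub p (P : {mpoly C[n]}) : P \is p.-homog ->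
  polyfun (fun k => fischer (mconj (linsub k P)) (linsub k P)).
Proof.
move=> hP; pose F (m : 'X_{1..n < p.+1}) k := ((linsub k P)@_m)^* * (linsub k P)@_m * (mnm_fact m)%:R.
have := @mxpolyfun_sum _ (index_enum _) predT F (fun m => mxpolyfun_mul (mxpolyfun_mul
   (mxpolyfun_conj (mxpolyfun_mcoeff_linsub P m)) (mxpolyfun_mcoeff_linsub P m)) (mxpolyfun_cst _ _)).
apply: mxpolyfun_ext => k; rewrite (@fischer_sum_bounded _ _ p.+1).
  by apply: eq_bigr => m _; rewrite mcoeff_mconj.
have [->|nz] := eqVneq (mconj (linsub k P)) 0; first by rewrite msize0.
rewrite -(mlead_deg nz) ltnS.
by rewrite (dhomog_mf (mconj_homog (linsub_homog k hP)) (mlead_supp nz)).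
Qed.

End PolyFunctions.

Section Minimum.
Variables (R : realType) (n p : nat) (P : {mpoly R[i][n.+1]}).
Local Notation C := R[i].
Hypothesis homP : P \is p.-homog.
Hypothesis irrP : forall k : 'M[C]_n.+1,
  (forall U, gl_act U P = 0 -> exists Z, U *m k = k *m Z) -> k = 0 \/ k \in unitmx.

Lemma nrm2_entry_le (k : 'M[C]_n.+1) M i j : nrm2 k <= M -> `|k i j| <= 1 + M.
Proof.
move=> kM; have := le_trans (nrm2_entry k i j) kM; rewrite -normCK => kij.
have M0 : 0 <= M by apply: le_trans kij; rewrite exprn_ge0.
have [k1|k1] := real_order (normr_ge0 (k i j)) ler01; first by apply: le_trans k1 _; rewrite lerDl.
apply: le_trans (_ : _ <= `|k i j| ^+ 2) _; last by rewrite (le_trans kij) // lerDr.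
by rewrite expr2 ler_peMr // ltW.
Qed.

Lemma energy_ge0 e (k : 'M[C]_n.+1) : 0 <= e -> 0 <= energy P e k.
Proof. by move=> e0; rewrite addr_ge0 ?fischer_conj_ge0 ?mulr_ge0 ?nrm2_ge0. Qed.

Lemma energyE e (k : 'M[C]_n.+1) : energy P e k = energy P 0 k + e * nrm2 k.
Proof. by rewrite /energy mul0r addr0. Qed.

Lemma mxpolyfun_energy e : mxpolyfun (energy P e).
Proof.
apply: mxpolyfun_add; first exact: mxpolyfun_fischer_linsub homP.
apply: mxpolyfun_mul; first exact: mxpolyfun_cst.
by apply: mxpolyfun_nrm2; exact: mxpolymap_id.
Qed.

Lemma energy_min_ball e M : 0 <= e -> (exists k : 'M[C]_n.+1, \det k = 1 /\ nrm2 k <= M) ->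
  exists k : 'M[C]_n.+1, [/\ \det k = 1, nrm2 k <= M &
    forall k', \det k' = 1 -> nrm2 k' <= M -> energy P e k <= energy P e k'].
Proof.
move=> e0 [k1 [k1d k1M]].
pose Cs := [set c | c = (fun k : 'M[C]_n.+1 => \det k - 1) \/ c = (fun k => 1 - \det k) \/
  c = (fun k => M - nrm2 k)].
pose S := [set k : 'M[C]_n.+1 | \det k = 1 /\ nrm2 k <= M].
have SE : S = [set k | forall c, Cs c -> 0 <= c k].
  apply/seteqP; split=> [k [kd kM] c [->|[->|->]]|k kC].
  - by rewrite kd subrr.
  - by rewrite kd subrr.
  - by rewrite subr_ge0.
  - split; last by have := kC (fun k => M - nrm2 k) (or_intror (or_intror erefl)); rewrite subr_ge0.
    have h1 : 0 <= \det k - 1 := kC (fun k => \det k - 1) (or_introl erefl).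
    have h2 : 0 <= 1 - \det k := kC (fun k => 1 - \det k) (or_intror (or_introl erefl)).
    by apply/eqP; rewrite -subr_eq0 eq_le h1 andbT -oppr_ge0 opprB.
have polC c : Cs c -> mxpolyfun c.
  have pdet := mxpolyfun_det C n.+1; have pnrm := mxpolyfun_nrm2 (@mxpolymap_id C n.+1).
  have pcst := @mxpolyfun_cst C n.+1.
  by move=> [->|[->|->]]; [exact: mxpolyfun_sub pdet (pcst 1)|exact: mxpolyfun_sub (pcst 1) pdet|
    exact: mxpolyfun_sub (pcst M) pnrm].
have [|||k [kd kM] kmin] := @ExtremeValue.mxpolyfun_min R n.+1 S Cs (energy P e) (1 + M) _ SE polC (mxpolyfun_energy e).
- by exists k1.
- by move=> k i j [_ kM]; exact: nrm2_entry_le.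
- by move=> k _; apply: ger0_real; exact: energy_ge0.
by exists k; split; [exact: kd|exact: kM|move=> k' kd' kM'; exact: (kmin k' (conj kd' kM'))].
Qed.

Lemma energy_min e : 0 < e -> exists k : 'M[C]_n.+1, \det k = 1 /\
  forall k', \det k' = 1 -> energy P e k <= energy P e k'.
Proof.
move=> e0; pose M := energy P e 1%:M / e.
have M1 : nrm2 (1%:M : 'M[C]_n.+1) <= M.
  by rewrite ler_pdivlMr // mulrC lerDr fischer_conj_ge0.
have [|k [kd kM kmin]] := energy_min_ball (M := M) (ltW e0); first by exists 1%:M; rewrite det1.
exists k; split=> [|k' kd']; first exact: kd.
have M0 : 0 <= M by apply: le_trans M1; exact: nrm2_ge0.
have [kM'|kM'] := real_order (nrm2_ge0 k') M0; first exact: kmin.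
apply: le_trans (kmin 1%:M _ M1) _; first by rewrite det1.
have -> : energy P e 1%:M = e * M by rewrite mulrC divfK ?gt_eqF.
apply: (@le_trans _ _ (e * nrm2 k')); first by rewrite ler_pM2l ?ltW.
by rewrite lerDr fischer_conj_ge0.
Qed.

(** The matrices of norm 1 satisfying [critical_bound] form a compact set without
    singular elements: the image of a singular one would be preserved by s. *)
Lemma critical_det_bound : exists2 d : C, 0 < d & forall k : 'M[C]_n.+1, nrm2 k = 1 ->
  (forall U (w : 'cV_n.+1), gl_act U P = 0 ->
    nrm2 (k *m mxadj k *m mxadj U *m w) <= nrm2 (U *m k) * nrm2 (mxadj k *m w)) ->
  d <= \det k * (\det k)^*.
Proof.
pose S := [set k : 'M[C]_n.+1 | nrm2 k = 1 /\ forall U (w : 'cV_n.+1), gl_act U P = 0 ->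
    nrm2 (k *m mxadj k *m mxadj U *m w) <= nrm2 (U *m k) * nrm2 (mxadj k *m w)].
have [[k1 k1S]|S0] := pselect (S !=set0); last first.
  by exists 1 => // k k1 kU; case: S0; exists k.
pose cU (Uw : 'M[C]_n.+1 * 'cV[C]_n.+1) (k : 'M[C]_n.+1) := nrm2 (Uw.1 *m k) * nrm2 (mxadj k *m Uw.2) -
  nrm2 (k *m mxadj k *m mxadj Uw.1 *m Uw.2).
pose Cs := [set c | c = (fun k : 'M[C]_n.+1 => nrm2 k - 1) \/ c = (fun k => 1 - nrm2 k) \/
  exists2 Uw, gl_act Uw.1 P = 0 & c = cU Uw].
have SE : S = [set k | forall c, Cs c -> 0 <= c k].
  apply/seteqP; split=> [k [kd kU] c [->|[->|[[U w] U0 ->]]]|k kC].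
  - by rewrite kd subrr.
  - by rewrite kd subrr.
  - by rewrite subr_ge0; exact: kU.
  - split=> [|U w U0].
      have h1 : 0 <= nrm2 k - 1 := kC (fun k => nrm2 k - 1) (or_introl erefl).
      have h2 : 0 <= 1 - nrm2 k := kC (fun k => 1 - nrm2 k) (or_intror (or_introl erefl)).
      by apply/eqP; rewrite -subr_eq0 eq_le h1 andbT -oppr_ge0 opprB.
    by rewrite -subr_ge0; apply: (kC (cU (U, w))); right; right; exists (U, w).
have polC c : Cs c -> mxpolyfun c.
  have pid := @mxpolymap_id C n.+1.
  have pnrm := mxpolyfun_nrm2 pid; have pcst := @mxpolyfun_cst C n.+1.
  have padj := mxpolymap_adj pid; have pmx m1 m2 := @mxpolymap_cst C n.+1 m1 m2.
  move=> [->|[->|[[U w] _ ->]]]; first exact: mxpolyfun_sub pnrm (pcst 1).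
    exact: mxpolyfun_sub (pcst 1) pnrm.
  apply: mxpolyfun_sub.
    exact: mxpolyfun_mul (mxpolyfun_nrm2 (mxpolymap_mul (pmx _ _ U) pid))
      (mxpolyfun_nrm2 (mxpolymap_mul padj (pmx _ _ w))).
  exact: mxpolyfun_nrm2 (mxpolymap_mul (mxpolymap_mul (mxpolymap_mul pid padj) (pmx _ _ (mxadj U)))
    (pmx _ _ w)).
pose F (k : 'M[C]_n.+1) := \det k * (\det k)^*.
have polF : mxpolyfun F.
  by apply: mxpolyfun_mul; [|apply: mxpolyfun_conj]; exact: mxpolyfun_det.
have [|||k [kn kU] kmin] := @ExtremeValue.mxpolyfun_min R n.+1 S Cs F (1 + 1) _ SE polC polF.
- by exists k1.
- by move=> k i j [k1n _]; apply: nrm2_entry_le; rewrite k1n.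
- by move=> k _; apply: ger0_real; exact: mul_conjC_ge0.
exists (F k); last first.
  by move=> k' k1' kU'; have := kmin k' (conj k1' kU').
rewrite lt0r mul_conjC_ge0 andbT mul_conjC_eq0; apply/negP => /eqP k0.
have [|k00|] := @irrP k.
- move=> U U0; have kerU (w : 'cV_n.+1) : mxadj k *m w = 0 -> mxadj k *m mxadj U *m w = 0.
    move=> w0; have := kU U w U0; rewrite w0 [X in _ * X](_ : _ = 0) ?mulr0; last first.
      by rewrite /nrm2 mul0mx linear0.
    move=> le0; have k0w : k *m mxadj k *m mxadj U *m w = 0.
      by apply: nrm2_eq0; apply/eqP; rewrite eq_le le0 nrm2_ge0.
    apply: nrm2_eq0; rewrite -nrm2_mxadj /nrm2 mxadjK !mxadjM !mxadjK.
    rewrite -!mulmxA (mulmxA k) (mulmxA (k *m _)) in k0w *.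
    by rewrite k0w !mulmx0 linear0.
  suff /submxP[Z UZ] : ((U *m k)^T <= k^T)%MS.
    by exists Z^T; apply: trmx_inj; rewrite UZ trmx_mul trmxK.
  rewrite submxE; apply/eqP/matrixP => i j; rewrite [RHS]mxE.
  pose w : 'cV[C]_n.+1 := map_mx Num.conj (cokermx k^T *m delta_mx j 0).
  have kw : mxadj k *m w = 0.
    by rewrite /mxadj map_trmx -map_mxM mulmxA mulmx_coker mul0mx map_mx0.
  have := kerU w kw; rewrite -mxadjM /mxadj map_trmx -map_mxM mulmxA -colE.
  move=> /matrixP/(_ i 0); rewrite mxE [X in _ X = _ -> _]mxE [X in _ = X -> _]mxE => /eqP.
  by rewrite conjC_eq0 => /eqP.
- by move: kn; rewrite k00 /nrm2 mul0mx linear0 => /esym/eqP; rewrite oner_eq0.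
- by rewrite unitmxE k0 unitr0.
Qed.

(** By [critical_det_bound] the minimisers of the penalised energies have norms
    bounded independently of the penalty e; so a minimum of the norm over a
    large ball is a minimum over all matrices of determinant 1. *)
Lemma norm_min : exists k : 'M[C]_n.+1, \det k = 1 /\
  forall k', \det k' = 1 -> energy P 0 k <= energy P 0 k'.
Proof.
have [d d0 dP] := critical_det_bound.
pose M := 1 + d^-1.
have M0 : 0 <= M by rewrite addr_ge0 // invr_ge0 ltW.
(* 1 = det k = |k|^N det (k / |k|) bounds |k| *)
have bound e k : 0 < e -> \det k = 1 ->
    (forall k', \det k' = 1 -> energy P e k <= energy P e k') -> nrm2 k <= M.
  move=> e0 k1 kmin.
  have crit V : \tr V = 0 -> moment P e k V = 0.
    by apply: moment_critical => //; rewrite ger0_real // ltW.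
  have k0 : nrm2 k != 0.
    apply: contra_eq_neq k1 => /nrm2_eq0 ->; rewrite det0 eq_sym oner_neq0 //.
  have kp : 0 < nrm2 k by rewrite lt0r k0 nrm2_ge0.
  pose s := sqrtC (nrm2 k)^-1.
  have s0 : 0 <= s by rewrite sqrtC_ge0 invr_ge0 ltW.
  have ss : s * s^* = (nrm2 k)^-1.
    by rewrite (conj_Creal (ger0_real s0)) -expr2 sqrtCK.
  have := dP (s *: k); rewrite nrm2Z ss mulVf // => /(_ erefl) dk.
  have {dk} : d <= \det (s *: k) * (\det (s *: k))^*.
    by apply: dk => U w U0; apply: adjoint_bound_scale; exact: critical_bound crit U0.
  rewrite detZ k1 mulr1 rmorphXn -exprMn ss exprVn => dle.
  have [k_le1|k_gt1] := real_order (nrm2_ge0 k) ler01.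
    by apply: le_trans k_le1 _; rewrite lerDl invr_ge0 ltW.
  apply: (@le_trans _ _ (nrm2 k ^+ n.+1)).
    by rewrite exprS ler_peMr ?(ltW kp) // exprn_ege1 // ltW.
  apply: (@le_trans _ _ d^-1); last by rewrite lerDr.
  by rewrite -[X in X <= _]invrK lef_pV2 // posrE ?invr_gt0 exprn_gt0.
have [k1 [k1d k1min]] := energy_min (ltr01 : 0 < (1 : C)).
have [|k [kd kM kmin]] := energy_min_ball (M := M) (lexx 0).
  by exists k1; split=> //; exact: (bound 1).
exists k; split=> [|k' kd']; first exact: kd.
apply: (le_of_perturbation (nrm2_ge0 k')) => [||e e0]; rewrite ?energy_ge0 //.
have [ke [ked kemin]] := energy_min e0.
apply: le_trans (kmin _ ked (bound _ _ e0 ked kemin)) _.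
rewrite -energyE; apply: le_trans (kemin _ kd').
by rewrite [leRHS]energyE lerDl mulr_ge0 ?nrm2_ge0 // ltW.
Qed.

End Minimum.

(** * The dual invariant *)

Section Dual.
Variables (C : numClosedFieldType) (n p : nat) (A : set 'M[C]_n.+1) (P : {mpoly C[n.+1]}).
Hypotheses (algA : algebraic_group A) (conA : zariski_connected A).
Hypotheses (irrA : irreducible_module A) (preA : prehomogeneous A).
Hypotheses (homP : P \is p.-homog) (fundP : fundamental_relative_invariant A P).
Hypothesis lieA : lie_of_group A = [set U | exists mu : C, gl_act U P = mu *: P].
Variable k : 'M[C]_n.+1.
Hypotheses (k1 : \det k = 1) (crit : forall V, \tr V = 0 -> moment P 0 k V = 0).
Local Notation stab := (annihilator P).
Implicit Types (U V : 'M[C]_n.+1) (Q Y : {mpoly C[n.+1]}).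

(** The polynomial representing Q |-> <Q o k, P o k>. *)
Definition dual_invariant : {mpoly C[n.+1]} := linsub k^T (mconj (linsub k P)).

Lemma metric_unit : k \in unitmx.
Proof. by rewrite unitmxE k1 unitr1. Qed.
Hint Resolve metric_unit : core.

Definition conjk U := invmx k *m U *m k.

Lemma mul_conjk U : k *m conjk U = U *m k.
Proof. by rewrite /conjk !mulmxA mulmxV // mul1mx. Qed.

Lemma dual_invariantE Q : fischer dual_invariant Q = fischer (mconj (linsub k P)) (linsub k Q).
Proof. by rewrite fischer_linsub. Qed.

Lemma dual_invariant_stab U Q : stab U -> fischer dual_invariant (gl_act U Q) = 0.
Proof.
move=> U0; rewrite dual_invariantE -(gl_act_linsub _ (mul_conjk U)) fischer_conj_gl_act.
by rewrite (critical_stab_adjoint k1 crit U0) rmorph0 fischer0l.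
Qed.

Lemma dual_invariant_traceless U : \tr U = 0 -> fischer dual_invariant (gl_act U P) = 0.
Proof.
move=> trU; rewrite dual_invariantE -(gl_act_linsub _ (mul_conjk U)).
have := crit (V := conjk U); rewrite /moment mul0r subr0; apply.
by rewrite /conjk mxtrace_mulC mulmxA mulmxV // mul1mx.
Qed.

Lemma dual_invariant_neq0 : fischer dual_invariant P != 0.
Proof.
rewrite dual_invariantE fischer_conj_eq0; apply: contraNneq (fundamental_neq0 fundP) => x0.
by rewrite -(linsub1 P) -(mulmxV metric_unit) -linsub_comp x0 rmorph0.
Qed.

(** Evaluate the linear form of the dual invariant on U.P, where U is split into
    its traceless and scalar parts. *)
Lemma stab_traceless U : stab U -> \tr U = 0.
Proof.
move=> U0; set t := \tr U / n.+1%:R.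
have := dual_invariant_traceless (U := U - t%:M).
rewrite linearB /= mxtrace_scalar -mulr_natr divfK ?pnatr_eq0 // subrr => /(_ erefl).
rewrite gl_actBl U0 sub0r (gl_act_scalar _ homP) -scaleNr opprK fischerZr.
move/eqP; rewrite !mulf_eq0 (negPf dual_invariant_neq0) pnatr_eq0.
by rewrite (negPf (fundamental_degree homP fundP)) !orbF invr_eq0 pnatr_eq0 orbF => /eqP.
Qed.

Lemma stab_lin a U V : stab U -> stab V -> stab (a *: U + V).
Proof. by rewrite /annihilator => U0 V0; rewrite gl_actDl gl_actZl U0 V0 scaler0 addr0. Qed.

Lemma stab_bracket U V : lie_of_group A U -> lie_of_group A V -> stab (lie U V).
Proof.
rewrite lieA => -[a UP] [b VP]; rewrite /annihilator gl_act_lie UP VP !gl_actZ UP VP.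
by rewrite !scalerA mulrC subrr.
Qed.

Lemma stab_adjoint U : stab U -> stab (k *m mxadj (conjk U) *m invmx k).
Proof.
move=> U0; set W := k *m _ *m _.
have kW : k *m mxadj (conjk U) = W *m k by rewrite /W -[RHS]mulmxA mulVmx ?mulmx1.
have := critical_stab_adjoint k1 crit U0; rewrite -/(conjk U) (gl_act_linsub _ kW).
move=> /(congr1 (linsub (invmx k))).
by rewrite linsub_comp mulmxV // linsub1 rmorph0.
Qed.

Lemma fischer_homog_nondeg Y : Y \is p.-homog ->
  (forall Q, Q \is p.-homog -> fischer Y Q = 0) -> Y = 0.
Proof.
move=> homY Y0; have := Y0 _ (mconj_homog homY); rewrite fischerC => /eqP.
by rewrite fischer_conj_eq0 => /eqP.
Qed.

Lemma dual_homog : dual_invariant \is p.-homog.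
Proof. by apply: linsub_homog; apply: mconj_homog; exact: linsub_homog. Qed.

(** In the metric given by k, the orthogonal of s.V consists of the vectors
    killed by the adjoints of s, which are again the elements of s. *)
Lemma dual_invariant_unique Y : Y \is p.-homog ->
  (forall U Q, stab U -> Q \is p.-homog -> fischer Y (gl_act U Q) = 0) ->
  exists c, Y = c *: dual_invariant.
Proof.
move=> homY YU.
have kTu : k^T \in unitmx by rewrite unitmx_tr.
pose z := mconj (linsub (invmx k^T) Y).
have homz : z \is p.-homog by apply: mconj_homog; exact: linsub_homog.
have YE : Y = linsub k^T (mconj z) by rewrite /z mconjK linsub_comp mulVmx ?linsub1.
have Vz U : stab U -> gl_act (mxadj (conjk U)) z = 0.
  move=> U0; have UY : gl_act U^T Y = 0.
    apply: fischer_homog_nondeg => [|Q homQ]; first exact: (gl_act_homog U^T (DHomog homY)).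
    by rewrite -fischer_gl_act YU.
  have kT : k^T *m U^T = (conjk U)^T *m k^T by rewrite -!trmx_mul mul_conjk.
  have : gl_act (conjk U)^T (mconj z) = 0.
    have := UY; rewrite YE (gl_act_linsub _ kT) => /(congr1 (linsub (invmx k^T))).
    by rewrite linsub_comp mulmxV ?linsub1 ?rmorph0.
  move=> /(congr1 (@mconj C n.+1)); rewrite mconj_gl_act mconjK rmorph0.
  by rewrite /mxadj map_trmx.
have [|U U0|c zc] := stab_invariants algA conA preA homP fundP lieA (Q := linsub (invmx k) z).
- exact: linsub_homog.
- have := Vz _ (stab_adjoint U0).
  have -> : mxadj (conjk (k *m mxadj (conjk U) *m invmx k)) = conjk U.
    by rewrite {1}/conjk !mulmxA mulVmx // mul1mx mulmxKV // mxadjK.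
  move=> Uz; rewrite (gl_act_linsub (U := conjk U)) ?Uz ?rmorph0 //.
  by rewrite /conjk mulmxK.
exists c^*; rewrite /dual_invariant YE.
have -> : z = c *: linsub k P.
  by rewrite -(linearZZ (linsub k)) -zc /= linsub_comp mulVmx ?linsub1 ?metric_unit.
by rewrite mconjZ (linearZZ (linsub k^T)).
Qed.

(** A normalises s, hence preserves the line of linear forms killing s.V; the
    scalar is found by evaluation at P. *)
Lemma dual_group_linsub g : A g -> exists c,
  linsub (invmx g)^T dual_invariant = c *: dual_invariant /\ linsub (invmx g) P = c *: P.
Proof.
move=> Ag; have [Au _ _ AV _] := algA; have gu : g \in unitmx by exact: Au.
have [c _ gP] := group_linsub fundP (AV _ Ag).
have [|U Q U0 homQ|d dE] := @dual_invariant_unique (linsub (invmx g)^T dual_invariant).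
- exact: linsub_homog dual_homog.
- rewrite -fischer_linsub -(@gl_act_linsub _ _ (invmx g) U (g *m U *m invmx g)).
    exact/dual_invariant_stab/(stab_conj algA fundP).
  by rewrite !mulmxA mulVmx // mul1mx.
exists c; split=> //; rewrite dE; congr (_ *: _).
have := fischer_linsub (invmx g) dual_invariant P.
rewrite gP dE fischerZl fischerZr => /eqP.
by rewrite (inj_eq (mulIf dual_invariant_neq0)) => /eqP.
Qed.

Lemma dual_invariant_relative : relative_invariant (dual_group A) (dual_invariant, 1).
Proof.
have [Au A1 AM AV _] := algA.
have [_ /relative_invariant_linsub[chi [chi0 chiM [q [d qE]]] chiP]] := fundP.
have trA h : dual_group A h -> A h^T by move=> [g Ag <-]; rewrite trmxK; exact: AV.
split; [|exact: oner_neq0|exists (fun h => chi h^T)].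
- by apply: contraNneq dual_invariant_neq0 => /= ->; rewrite fischer0l.
- split=> [h /trA|h h' /trA Ah /trA Ah'|]; first exact: chi0.
    by rewrite trmx_mul chiM // mulrC.
  exists (linsub (lin_mx (@trmx C n.+1 n.+1))^T q), d => h /trA Ah.
  rewrite qE // det_tr; congr (_ / _).
  by rewrite /mxeval meval_linsub; apply: meval_eq => e; rewrite lin_mx_mxvecE.
- move=> h x Ah; have [g Ag gh] := Ah; rewrite /veval /= !meval1 !mulr1.
  have [c [cE cP]] := dual_group_linsub Ag.
  have cchi : c = chi h^T.
    have := chiP _ (trA _ Ah); rewrite -gh trmxK cP => /eqP.
    by rewrite -subr_eq0 -scalerBl scaler_eq0 (negPf (fundamental_neq0 fundP)) orbF subr_eq0 => /eqP.
  rewrite -cchi -mevalZ -cE gh meval_linsub; apply: meval_eq => i; rewrite mxE.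
  by [].
Qed.

(** Conjugation of the coefficients and invertible substitutions are ring
    automorphisms, and they carry P to the dual invariant. *)
Lemma dual_invariant_irreducible : irreducible_mpoly dual_invariant.
Proof.
have kTu : k^T \in unitmx by rewrite unitmx_tr.
pose phi : {rmorphism {mpoly C[n.+1]} -> {mpoly C[n.+1]}} := linsub k^T \o @mconj C n.+1 \o linsub k.
pose psi : {rmorphism {mpoly C[n.+1]} -> {mpoly C[n.+1]}} :=
  linsub (invmx k) \o @mconj C n.+1 \o linsub (invmx k^T).
have phiK : cancel phi psi.
  by move=> Q; rewrite /phi /psi /= linsub_comp mulmxV // linsub1 mconjK linsub_comp mulmxV // linsub1.
have psiK : cancel psi phi.
  by move=> Q; rewrite /phi /psi /= linsub_comp mulVmx // linsub1 mconjK linsub_comp mulVmx // linsub1.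
have [[P0 nuP irrP] _] := fundP.
split=> [||Q Q' QQ'].
- by apply: contraNneq dual_invariant_neq0 => ->; rewrite fischer0l.
- by apply: contra nuP => /(rmorph_unit psi); rewrite -[dual_invariant]/(phi P) phiK.
- have : P = psi Q * psi Q' by rewrite -rmorphM -QQ' -[dual_invariant]/(phi P) phiK.
  by move=> /irrP[] /(rmorph_unit phi); rewrite psiK; [left|right].
Qed.

(** In the orthonormal coordinates given by k, where adjoints are conjugate
    transposes. *)
Definition cstab U := stab (k *m U *m invmx k).

Lemma cstab_conjk U : stab U -> cstab (conjk U).
Proof. by move=> U0; rewrite /cstab mul_conjk mulmxK. Qed.

Lemma conj_lie U V : k *m lie U V *m invmx k = lie (k *m U *m invmx k) (k *m V *m invmx k).
Proof.
rewrite /lie /= /mxlie mulmxBr mulmxBl !mulmxA.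
by rewrite !mulmxKV.
Qed.

Lemma cstab_lin a U V : cstab U -> cstab V -> cstab (a *: U + V).
Proof.
move=> U0 V0; rewrite /cstab mulmxDr mulmxDl -scalemxAr -scalemxAl; exact: stab_lin.
Qed.

Lemma cstab_lie U V : cstab U -> cstab V -> cstab (lie U V).
Proof. by move=> U0 V0; rewrite /cstab conj_lie; apply: stab_bracket; exact: (stab_lie lieA). Qed.

Lemma cstab_adj U : cstab U -> cstab (mxadj U).
Proof.
move=> /stab_adjoint; rewrite /cstab /conjk !mulmxA mulVmx // mul1mx.
by rewrite mulmxKV.
Qed.

Lemma cstab_center U : cstab U -> (forall V, cstab V -> lie U V = 0) -> U = 0.
Proof.
move=> U0 Uc; set M := k *m U *m invmx k.
have [|c Mc] := stab_centralizer_scalar algA conA irrA homP fundP lieA (M := M).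
  move=> V V0; have := Uc _ (cstab_conjk V0).
  move=> /(congr1 (fun X => k *m X *m invmx k)); rewrite conj_lie mul_conjk mulmxK // mulmx0 mul0mx.
  by move/eqP; rewrite subr_eq0 => /eqP.
have trM : \tr M = 0 by exact: stab_traceless.
move: trM; rewrite Mc mxtrace_scalar => /eqP; rewrite -mulr_natr mulf_eq0 pnatr_eq0 orbF => /eqP c0.
have : M = 0 by rewrite Mc c0 -scalemx1 scale0r.
move=> /(congr1 (fun X => invmx k *m X *m k)); rewrite /M mulmx0 mul0mx !mulmxA.
by rewrite mulVmx // mul1mx mulmxKV.
Qed.

Lemma mxtrace_mul_adj U V : \tr (U *m mxadj V) = (mxvec U *m mxadj (mxvec V)) 0 0.
Proof.
have -> : \tr (U *m mxadj V) = \sum_i \sum_j U i j * (V i j)^*.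
  by apply: eq_bigr => i _; rewrite mxE; apply: eq_bigr => j _; rewrite !mxE.
rewrite pair_bigA mxE (reindex _ (curry_mxvec_bij _ _)) /=; apply: eq_bigr => -[i j] _ /=.
by rewrite !mxE !mxvecE.
Qed.

(** Let D be a subspace containing the brackets of a. The component m of an
    element of s orthogonal to D is orthogonal to [[m, V], V^*], so that
    |[m, V]| = 0 for all V in s: m is central in s, hence a traceless scalar. *)
Lemma stab_derived : derived_algebra (lie_of_group A) = stab.
Proof.
apply/seteqP; split.
  apply: smallest_sub.
    by split=> [|a U V U0 V0]; [rewrite /annihilator gl_act0l|exact: stab_lin].
  by move=> _ [U [V [AU AV ->]]]; exact: stab_bracket.
move=> U0 stabU0; rewrite /derived_algebra /smallest => D /= [[D0 Dlin] Dlie].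
pose S (v : 'rV[C]_(n.+1 * n.+1)) := let X := k *m vec_mx v *m invmx k in D X /\ stab X.
have [G GS] : exists G : 'M[C]_(n.+1 * n.+1), forall v, (v <= G)%MS <-> S v.
  apply: subspace_rowspace => [|a u v [Du su] [Dv sv]]; rewrite /S.
    by rewrite linear0 mulmx0 mul0mx; split=> //; rewrite /annihilator gl_act0l.
  by rewrite linearP /= mulmxDr mulmxDl -scalemxAr -scalemxAl; split; [exact: Dlin|exact: stab_lin].
pose u := mxvec (conjk U0).
(* y G is the orthogonal projection of u on the row space of G *)
have [y yE] : exists y, u *m mxadj G = y *m (G *m mxadj G).
  apply/submxP; rewrite submxE -mulmxA.
  suff -> : mxadj G *m cokermx (G *m mxadj G) = 0 by rewrite mulmx0.
  apply: nrm2_eq0; rewrite /nrm2 mxtrace_mulC mxadjM mxadjK -mulmxA (mulmxA G).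
  by rewrite mulmx_coker mulmx0 linear0.
pose m := vec_mx (u - y *m G).
have mG : mxvec m *m mxadj G = 0 by rewrite vec_mxK mulmxBl yE mulmxA subrr.
have Sy : S (y *m G) by apply/GS; exact: submxMl.
have cm : cstab m.
  rewrite /m linearB /= addrC -scaleN1r; apply: cstab_lin; first by case: Sy.
  by rewrite mxvecK; exact: cstab_conjk.
have orth V W : cstab V -> cstab W -> \tr (m *m mxadj (lie V W)) = 0.
  move=> V0 W0; have /submxP[w wG] : (mxvec (lie V W) <= G)%MS.
    apply/GS; rewrite /S mxvecK; split; last exact: cstab_lie.
    rewrite conj_lie; apply: Dlie; exists (k *m V *m invmx k), (k *m W *m invmx k).
    by split=> //; exact: (stab_lie lieA).
  by rewrite mxtrace_mul_adj wG mxadjM mulmxA mG mul0mx mxE.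
have m0 : m = 0.
  apply: cstab_center => // V V0.
  have := orth (lie m V) (mxadj V) (cstab_lie cm V0) (cstab_adj V0).
  set L := lie m V => h; apply: nrm2_eq0.
  have -> : nrm2 L = \tr ((m *m V - V *m m) *m mxadj L) by [].
  clearbody L; move: h; rewrite /lie /= /mxlie mxadjB !mxadjM mxadjK mulmxBr linearB /= => h.
  rewrite mulmxBl linearB /= -h; congr (_ - _); first by rewrite mulmxA.
  by rewrite -(mulmxA V) mxtrace_mulC -mulmxA.
have : u = y *m G.
  by apply/eqP; rewrite -subr_eq0 -[_ - _]vec_mxK -/m m0 linear0.
move=> uG; have [] : S u by rewrite uG.
by rewrite /u mxvecK mul_conjk mulmxK.
Qed.

Lemma transpose_variables : exists2 T : {mpoly C[n.+1 * n.+1]} -> {mpoly C[n.+1 * n.+1]},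
  forall q g, mxeval (T q) g = mxeval q g^T &
  forall V q, dir_deriv V (T q) 1%:M = dir_deriv V^T q 1%:M.
Proof.
pose T : {mpoly C[n.+1 * n.+1]} -> {mpoly C[n.+1 * n.+1]} := linsub (lin_mx (@trmx C n.+1 n.+1))^T.
have evT q g : mxeval (T q) g = mxeval q g^T.
  by rewrite /mxeval meval_linsub; apply: meval_eq => e; rewrite lin_mx_mxvecE.
exists T => // V q.
rewrite /dir_deriv; under eq_bigr do rewrite mderiv_linsub /mxeval raddf_sum mulr_sumr.
rewrite exchange_big; apply: eq_bigr => e _ /=.
rewrite -[V^T]/(trmx V) -lin_mx_mxvecE mulr_suml; apply: eq_bigr => a _.
by rewrite mevalZ -/(T _) -/(mxeval _ _) evT trmx1 mulrCA mulrA.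
Qed.

(** Ps (g^T v) / Ps (g^T w) is constant on A; differentiating at 1, Ps is an
    eigenvector of the transposes of the elements of a, hence is killed by those
    of [a, a]. *)
Lemma fundamental_dual_stab (Ps : {mpoly C[n.+1]}) U :
  fundamental_relative_invariant (dual_group A) Ps -> stab U -> gl_act U^T Ps = 0.
Proof.
move=> [[Ps0 _ _] /relative_invariant_linsub[chi _ chiPs]] U0.
have [_ _ _ AV _] := algA.
have trA g : A g -> dual_group A g^T.
  by move=> Ag; exists (invmx g); [exact: AV|rewrite invmxK].
have [w w0] : exists w : 'cV_n.+1, veval Ps w != 0.
  apply: contrapT => now; case/eqP: Ps0; apply: mpoly_fun_eq0 => v.
  apply: contrapT => /eqP v0; apply: now; exists (\col_i v i).
  by rewrite (_ : veval _ _ = Ps.@[v]) //; apply: meval_eq => i; rewrite mxE.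
have [T evT dT] := transpose_variables.
have eig V : lie_of_group A V -> exists mu, gl_act V^T Ps = mu *: Ps.
  move=> AV'; exists (veval (gl_act V^T Ps) w / veval Ps w).
  apply/eqP; rewrite -subr_eq0; apply/eqP; apply: mpoly_fun_eq0 => v.
  pose x : 'cV[C]_n.+1 := \col_i v i.
  have vE q : q.@[v] = veval q x by apply: meval_eq => i; rewrite mxE.
  rewrite vE /veval mevalB mevalZ -!/(veval _ x).
  pose f := veval Ps w *: T (orbit_poly x Ps) - veval Ps x *: T (orbit_poly w Ps).
  have fA g : A g -> mxeval f g = 0.
    move=> Ag; rewrite mxeval_lin !evT !mxeval_orbit_poly.
    have ev z : veval Ps (g^T *m z) = chi g^T * veval Ps z.
      rewrite /veval -mevalZ -(chiPs _ (trA _ Ag)) meval_linsub.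
      by apply: meval_eq => i; rewrite mxE.
    by rewrite !ev; ring.
  have := AV' f fA; rewrite -/(dir_deriv V f 1%:M).
  rewrite /f dir_deriv_lin.
  rewrite !dT -[V^T]mulmx1 !dir_deriv_orbit_poly !mul1mx mulmx1 !mulrN opprK.
  move=> /eqP; rewrite addrC subr_eq0 => /eqP h.
  by rewrite mulrAC -(mulrC (veval Ps x)) h mulrAC mulfV // mul1r subrr.
have : derived_algebra (lie_of_group A) U by rewrite stab_derived.
suff : derived_algebra (lie_of_group A) `<=` [set V | gl_act V^T Ps = 0] by apply.
apply: smallest_sub.
  split=> [|a V W /= V0 W0]; first by rewrite /= linear0 gl_act0l.
  by rewrite linearP /= gl_actDl gl_actZl V0 W0 scaler0 addr0.
move=> _ [V [W [/eig[a Va] /eig[b Wb] ->]]] /=.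
have -> : (lie V W)^T = lie W^T V^T.
  by rewrite /lie /= /mxlie linearB /= !trmx_mul.
rewrite gl_act_lie Va Wb !gl_actZ Va Wb !scalerA mulrC subrr //.
Qed.

End Dual.

(** * Graded Lie algebras *)

Section LieBasics.
Variables (K : fieldType) (L : lieAlgType K).
Implicit Types x y z : L.

Lemma lieDl x y z : lie (x + y) z = lie x z + lie y z.
Proof. by have := @lie_linearl K L z 1 x y; rewrite !scale1r. Qed.

Lemma lieDr x y z : lie z (x + y) = lie z x + lie z y.
Proof. by have := @lie_linearr K L z 1 x y; rewrite !scale1r. Qed.

Lemma lie0l z : lie (0 : L) z = 0.
Proof. by have := @lie_linearl K L z (-1) 0 0; rewrite scaler0 addr0 scaleN1r addNr. Qed.

Lemma lie0r z : lie z (0 : L) = 0.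
Proof. by have := @lie_linearr K L z (-1) 0 0; rewrite scaler0 addr0 scaleN1r addNr. Qed.

Lemma lieZl a x z : lie (a *: x) z = a *: lie x z.
Proof. by have := @lie_linearl K L z a x 0; rewrite !addr0 lie0l addr0. Qed.

Lemma lieZr a x z : lie z (a *: x) = a *: lie z x.
Proof. by have := @lie_linearr K L z a x 0; rewrite !addr0 lie0r addr0. Qed.

Lemma lieNr x z : lie z (- x) = - lie z x.
Proof. by rewrite -scaleN1r lieZr scaleN1r. Qed.

Lemma lieC x y : lie x y = - lie y x.
Proof.
apply/eqP; rewrite -addr_eq0; have := liexx (x + y).
by rewrite lieDl !lieDr !liexx addr0 add0r => ->.
Qed.

Lemma lie_suml (I : Type) (s : seq I) (F : I -> L) z :
  lie (\sum_(i <- s) F i) z = \sum_(i <- s) lie (F i) z.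
Proof. by elim: s => [|i s IHs]; rewrite ?big_nil ?lie0l // !big_cons lieDl IHs. Qed.

Lemma lie_sumr (I : Type) (s : seq I) (F : I -> L) z :
  lie z (\sum_(i <- s) F i) = \sum_(i <- s) lie z (F i).
Proof. by elim: s => [|i s IHs]; rewrite ?big_nil ?lie0r // !big_cons lieDr IHs. Qed.

Lemma lie_derivation x y z : lie x (lie y z) = lie (lie x y) z + lie y (lie x z).
Proof.
have /eqP := lie_jacobi x y z.
rewrite -addrA addr_eq0 => /eqP ->; rewrite opprD addrC (lieC z (lie x y)) opprK.
by rewrite (lieC z x) lieNr opprK.
Qed.

End LieBasics.

Section Grading.
Variables (K : numFieldType) (L : lieAlgType K) (G : int -> set L).
Hypothesis gradG : lie_grading G.

Lemma grading0 i : G i 0. Proof. by have [+ _ _ _] := gradG => /(_ i)[]. Qed.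

Lemma gradingP i a x y : G i x -> G i y -> G i (a *: x + y).
Proof. by have [+ _ _ _] := gradG => /(_ i)[_]; exact. Qed.

Lemma gradingZ i a x : G i x -> G i (a *: x).
Proof. by move=> Gx; rewrite -[_ *: _]addr0; apply: gradingP => //; exact: grading0. Qed.

Lemma grading_lie i j x y : G i x -> G j y -> G (i + j) (lie x y).
Proof. by have [_ + _ _] := gradG; apply. Qed.

Lemma grading_three x y z : G (-1) x -> G 0 y -> G 1 z -> x + y + z = 0 ->
  [/\ x = 0, y = 0 & z = 0].
Proof.
move=> Gx Gy Gz xyz0; have [_ _ _ uniqG] := gradG.
pose c (i : int) := if i == -1 then x else if i == 0 then y else if i == 1 then z else 0.
have Gc i : G i (c i).
  rewrite /c; case: eqP => [->//|_]; case: eqP => [->//|_]; case: eqP => [->//|_].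
  exact: grading0.
have c0 := uniqG [:: -1; 0; 1] c isT Gc.
have /c0 {}c0 : \sum_(i <- [:: -1; 0; 1]) c i = 0 by rewrite !big_cons big_nil addr0 addrA.
by split; [exact: (c0 (-1))|exact: (c0 0)|exact: (c0 1)].
Qed.

Definition components (z : L) (c : int -> L) := exists s : seq int,
  [/\ uniq s, forall i, G i (c i), forall i, i \notin s -> c i = 0 & z = \sum_(i <- s) c i].

Lemma components_extend (s s' : seq int) (c : int -> L) : uniq s -> uniq s' ->
  {subset s <= s'} -> (forall i, i \notin s -> c i = 0) ->
  \sum_(i <- s') c i = \sum_(i <- s) c i.
Proof.
move=> us us' ss' c0; rewrite (bigID (mem s)) /= [X in _ + X]big1 ?addr0; last by move=> i /c0.
rewrite -big_filter; apply: perm_big; apply: uniq_perm => [||i]; rewrite ?filter_uniq //.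
by rewrite mem_filter /=; case si: (i \in s) => //=; rewrite ss'.
Qed.

Lemma components_lin a z z' c c' : components z c -> components z' c' ->
  components (a *: z + z') (fun i => a *: c i + c' i).
Proof.
move=> [s [us Gc c0 ->]] [s' [us' Gc' c0' ->]].
exists (undup (s ++ s')); split=> [||i|].
- exact: undup_uniq.
- by move=> i; apply: gradingP.
- by rewrite mem_undup mem_cat negb_or => /andP[/c0 -> /c0' ->]; rewrite scaler0 addr0.
- rewrite big_split -scaler_sumr /=; congr (_ *: _ + _); apply/esym.
    by apply: components_extend; rewrite ?undup_uniq // => i si; rewrite mem_undup mem_cat si.
  by apply: components_extend; rewrite ?undup_uniq // => i si; rewrite mem_undup mem_cat si orbT.
Qed.

Lemma components_single k z : G k z -> components z (fun i => if i == k then z else 0).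
Proof.
move=> Gz; exists [:: k]; split=> // [i|i|].
- by case: eqP => [->//|_]; exact: grading0.
- by rewrite inE => /negPf ->.
- by rewrite big_seq1 eqxx.
Qed.

(** The elements on whose components h acts as twice the degree form a
    subalgebra, so they are everything as soon as this holds on the local
    part. *)
Lemma degree_derivation (h : L) : lie_generated (local_part G) = setT ->
  (forall y, G (-1) y -> lie h y = -2 *: y) -> (forall y, G 0 y -> lie h y = 0) ->
  (forall y, G 1 y -> lie h y = 2 *: y) ->
  forall z, lie h z = 0 -> G 0 z.
Proof.
move=> genG hm h0 hp.
pose W := [set z | exists c, components z c /\ forall i, lie h (c i) = (2 * i%:~R) *: c i].
have Wlin a z z' : W z -> W z' -> W (a *: z + z').
  move=> [c [zc hc]] [c' [zc' hc']]; exists (fun i => a *: c i + c' i).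
  split=> [|i]; first exact: components_lin.
  by rewrite lieDr lieZr hc hc' scalerDr !scalerA mulrC.
have Whom k z : G k z -> lie h z = (2 * k%:~R) *: z -> W z.
  move=> Gz hz; exists (fun i => if i == k then z else 0); split; first exact: components_single.
  by move=> i; case: eqP => [->//|_]; rewrite lie0r scaler0.
have W0 : W 0 by apply: (@Whom 0); [exact: grading0|rewrite lie0r scaler0].
have WD z z' : W z -> W z' -> W (z + z') by rewrite -[z in z + z']scale1r; exact: Wlin.
have Wsub : lie_subalgebra W.
  split=> [//|_ _ [c [[s [us Gc c0 ->]] hc]] [c' [[s' [us' Gc' c0' ->]] hc']]].
  rewrite lie_suml; apply: big_ind => // i _; rewrite lie_sumr; apply: big_ind => // j _.
  apply: (@Whom (i + j)); first exact: grading_lie.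
  by rewrite lie_derivation hc hc' lieZl lieZr -scalerDl rmorphD mulrDr.
have Wall z : W z.
  have : lie_generated (local_part G) z by rewrite genG.
  apply: smallest_sub Wsub _ z => _ [y [u [t [Gy Gu Gt ->]]]].
  apply: (WD); first apply: (WD).
  - by apply: (@Whom (-1)) => //; rewrite hm // mulrN1.
  - by apply: (@Whom 0) => //; rewrite h0 // mulr0 scale0r.
  - by apply: (@Whom 1) => //; rewrite hp // mulr1.
move=> z hz; have [c [[s [us Gc c0 zE]] hc]] := Wall z.
have [_ _ _ uniqG] := gradG.
have ci0 i : i != 0 -> c i = 0.
  move=> i0; have [si|/c0//] := boolP (i \in s).
  have := uniqG s (fun i => (2 * i%:~R) *: c i) us (fun i => gradingZ _ (Gc i)).
  have -> : \sum_(i <- s) (2 * i%:~R) *: c i = 0.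
    by rewrite -[RHS]hz zE lie_sumr; apply: eq_bigr => j _; rewrite hc.
  move=> /(_ erefl i si)/eqP; rewrite scaler_eq0 mulf_eq0 pnatr_eq0 intr_eq0 (negPf i0) /=.
  by move/eqP.
rewrite zE; apply: big_ind => [|x y Gx Gy|i _]; first exact: grading0.
  by rewrite -[x]scale1r; exact: gradingP.
by have [->//|/ci0 ->] := eqVneq i 0; exact: grading0.
Qed.

End Grading.

(** * Invariant forms on gl(W) *)

Section InvariantForm.
Variables (K : numFieldType) (n : nat) (B0 : 'M[K]_n.+1 -> 'M[K]_n.+1 -> K).
Hypothesis formB : nondeg_invariant_form B0.

Lemma rank1_square_zero_bracket (u : 'cV[K]_n.+1) (v : 'rV[K]_n.+1) : v *m u = 0 ->
  exists X Y : 'M[K]_n.+1, u *m v = lie X Y.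
Proof.
move=> vu; have [->|u0] := eqVneq u 0.
  by exists 0, 0; rewrite mul0mx /lie /= /mxlie mul0mx subrr.
have [w wu] : exists w : 'rV_n.+1, w *m u = 1%:M.
  have [i ui] : exists i, u i 0 != 0.
    apply: contrapT => nu; case/eqP: u0; apply/matrixP => i j; rewrite ord1 mxE.
    by apply: contrapT => /eqP ui; apply: nu; exists i.
  exists ((u i 0)^-1 *: delta_mx 0 i); apply/matrixP => a b.
  rewrite -scalemxAl -rowE !ord1 !mxE mulVf //.
exists (u *m w), (u *m v); rewrite /lie /= /mxlie.
by rewrite !mulmxA -(mulmxA u w u) wu mulmx1 -(mulmxA u v u) vu mulmx0 mul0mx subr0.
Qed.

(** By invariance Id is orthogonal to all brackets, hence to sl(W). *)
Lemma invariant_form_scalar : exists2 c, c != 0 & forall U, B0 1%:M U = c * \tr U.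
Proof.
have [Bl Bs Bi Bn] := formB.
have Br x : scalar (B0 x) by move=> a y z; rewrite !(Bs x) Bl.
have B10 X Y : B0 1%:M (lie X Y) = 0.
  rewrite -Bi (_ : lie 1%:M X = 0).
    by have := Bl Y (-1) 0 0; rewrite scaler0 addr0 mulN1r addNr.
  by rewrite /lie /= /mxlie mul1mx mulmx1 subrr.
have BE U : B0 1%:M U = B0 1%:M (delta_mx 0 0) * \tr U.
  by apply: trace_functional => // u v /rank1_square_zero_bracket[X [Y ->]].
exists (B0 1%:M (delta_mx 0 0)) => //; apply/eqP => c0.
have /eqP := Bn 1%:M (fun U => etrans (BE U) (etrans (congr1 (fun c => c * \tr U) c0) (mul0r _))).
by rewrite -[_ == _]/((1 : 'M[K]_n.+1) == 0) oner_eq0.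
Qed.

End InvariantForm.

(** * The subalgebra generated by an sl(2)-triple *)

Section Sl2Span.
Variables (K : numFieldType) (L : lieAlgType K) (y h x : L).
Hypothesis tri : sl2_triple y h x.

Definition triple_comb (a b c : K) : L := a *: y + b *: h + c *: x.
Local Notation comb := triple_comb.

Lemma triple_combD a b c a' b' c' : comb a b c + comb a' b' c' = comb (a + a') (b + b') (c + c').
Proof. by rewrite /comb !scalerDl -addrACA [X in X + _ = _]addrACA. Qed.

Lemma triple_combZ e a b c : e *: comb a b c = comb (e * a) (e * b) (e * c).
Proof. by rewrite /comb !scalerDr !scalerA. Qed.

Lemma triple_comb_y : y = comb 1 0 0. Proof. by rewrite /comb scale1r !scale0r !addr0. Qed.
Lemma triple_comb_h : h = comb 0 1 0. Proof. by rewrite /comb scale1r !scale0r add0r addr0. Qed.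
Lemma triple_comb_x : x = comb 0 0 1. Proof. by rewrite /comb scale1r !scale0r !add0r. Qed.

Lemma triple_comb_bracket a b c a' b' c' :
  lie (comb a b c) (comb a' b' c') =
  comb (2 * (a * b' - b * a')) (a * c' - c * a') (2 * (b * c' - c * b')).
Proof.
have [hx hy yx] := tri.
have xh : lie x h = - 2 *: x by rewrite lieC hx scaleNr.
have yh : lie y h = 2 *: y by rewrite lieC hy scaleNr opprK.
have xy : lie x y = (- 1) *: h by rewrite lieC yx scaleN1r.
rewrite {1 2}/comb !lieDl !lieDr !lieZl !lieZr !liexx hx hy yx xh yh xy.
rewrite [in LHS]triple_comb_y [in LHS]triple_comb_h [in LHS]triple_comb_x.
rewrite !scaler0 !triple_combZ !addr0 !add0r !triple_combD.
by congr comb; ring.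
Qed.

Lemma lie_generated_triple : lie_generated [set y; h; x] = [set z | exists a b c, z = comb a b c].
Proof.
apply/seteqP; split.
  apply: smallest_sub.
    split; first split.
    - by exists 0, 0, 0; rewrite /comb !scale0r !addr0.
    - move=> e _ _ [a [b [c ->]]] [a' [b' [c' ->]]].
      by exists (e * a + a'), (e * b + b'), (e * c + c'); rewrite triple_combZ triple_combD.
    - move=> _ _ [a [b [c ->]]] [a' [b' [c' ->]]]; rewrite triple_comb_bracket.
      by eexists; eexists; eexists.
  move=> z /= [[->|->]|->].
  - by exists 1, 0, 0; exact: triple_comb_y.
  - by exists 0, 1, 0; exact: triple_comb_h.
  - by exists 0, 0, 1; exact: triple_comb_x.
move=> _ [a [b [c ->]]] D /= [[[D0 Dlin] _] DG].
have [Dy Dh Dx] : [/\ D y, D h & D x] by split; apply: DG; [left; left|left; right|right].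
rewrite /comb -addrA; apply: (Dlin) => //; apply: (Dlin) => //.
by rewrite -[_ *: _]addr0; apply: Dlin.
Qed.

(** With the sign convention [y, x] = h, the standard triple e, h, f of sl(2) is
    x, h, - y. *)
Lemma isomorphic_sl2_triple : (forall a b c, comb a b c = 0 -> [/\ a = 0, b = 0 & c = 0]) ->
  isomorphic_sl2 (lie_generated [set y; h; x]).
Proof.
move=> free; pose phi (M : 'M[K]_2) : L := comb (- M 1 0) (M 0 0) (M 0 1).
have linphi : linear phi.
  by move=> a U V; rewrite /phi triple_combZ triple_combD !mxE; congr comb; ring.
pose f : {linear 'M[K]_2 -> L} := HB.pack phi (GRing.isLinear.Build K _ _ _ phi linphi).
have fE M : f M = phi M by [].
have tr2 (U : 'M[K]_2) : \tr U = 0 -> U 1 1 = - U 0 0.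
  by rewrite /mxtrace !big_ord_recl big_ord0 addr0 => /eqP; rewrite addrC addr_eq0 => /eqP <-; congr (U _ _); apply: val_inj.
have ord1 : lift ord0 ord0 = 1 :> 'I_2 by apply: val_inj.
exists f; split=> [U V trU trV|U trU|].
- rewrite !fE /phi triple_comb_bracket /lie /= /mxlie !mxE !big_ord_recl !big_ord0.
  rewrite !ord1 !(tr2 U trU) !(tr2 V trV).
  by congr comb; ring.
- rewrite fE => /free[/eqP u10 u00 u01]; rewrite oppr_eq0 in u10.
  apply/matrixP => i j; rewrite mxE.
  have i01 (a : 'I_2) : a = 0 \/ a = 1.
    by case: a => -[|[|//]] ?; [left|right]; exact: val_inj.
  case: (i01 i) => ->; case: (i01 j) => -> //; first exact/eqP.
  by rewrite tr2 // u00 oppr0.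
- rewrite lie_generated_triple; apply/seteqP; split=> [_ [a [b [c ->]]]|_ [U _ <-]].
    pose M : 'M[K]_2 := \matrix_(i, j) (if i == 0 then if j == 0 then b else c
                                       else if j == 0 then - a else - b).
    exists M; last by rewrite fE /phi !mxE opprK.
    by rewrite /= /mxtrace !big_ord_recl big_ord0 !mxE /= addr0 subrr.
  by exists (- U 1 0), (U 0 0), (U 0 1).
Qed.

End Sl2Span.

(** * Lie algebras of polynomial type *)

Section DualForms.
Variables (C : numClosedFieldType) (n p : nat).
Implicit Types X Q : dhomog n.+1 C p.

Lemma dual_formE Q X : dual_form Q X = fischer Q X.
Proof. by rewrite lfunE. Qed.

Lemma fischer_dhomog_inj Q Q' : (forall X, fischer Q X = fischer Q' X) -> Q = Q'.
Proof.
move=> QQ'; apply: val_inj; apply/eqP; rewrite /= -subr_eq0; apply/eqP.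
apply: (@fischer_homog_nondeg _ _ p) => [|X homX].
  exact: (dhomog_is_dhomog (Q - Q')).
by rewrite fischerBl (QQ' (DHomog homX)) subrr.
Qed.

(** An injective map between spaces of the same dimension. *)
Lemma dual_form_surj (Y : 'Hom(dhomog n.+1 C p, C^o)) : exists Q, Y = dual_form Q.
Proof.
have linD : linear (@dual_form C n p).
  move=> a Q Q'; apply/lfunP => X; rewrite add_lfunE scale_lfunE !dual_formE.
  by rewrite fischerDl fischerZl.
pose f : {linear dhomog n.+1 C p -> 'Hom(dhomog n.+1 C p, C^o)} :=
  HB.pack (@dual_form C n p) (GRing.isLinear.Build C _ _ _ (@dual_form C n p) linD).
have fE Q : linfun f Q = dual_form Q by rewrite lfunE.
have ker0 : lker (linfun f) == 0%VS.
  apply/lker0P => Q Q'; rewrite !fE => QQ'; apply: fischer_dhomog_inj => X.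
  by rewrite -!dual_formE QQ'.
have : Y \in limg (linfun f).
  have -> : limg (linfun f) = fullv.
    apply/eqP; rewrite eqEdim subvf /= (limg_dim_eq (eqP _)) //; last by rewrite (eqP ker0) capv0.
    by rewrite !dimvf /dim /= muln1.
  exact: memvf.
by case/memv_imgP => Q _ ->; exists Q; rewrite fE.
Qed.

End DualForms.

Lemma fundamental_scale (C : numClosedFieldType) n (A : set 'M[C]_n.+1) a P : a != 0 ->
  fundamental_relative_invariant A P -> fundamental_relative_invariant A (a *: P).
Proof.
move=> a0 [[P0 nuP irrP] [_ _ [chi ratchi relP]]].
have aP : a^-1 *: (a *: P) = P by rewrite scalerA mulVf ?scale1r.
have unitZ (b : C) (Q : {mpoly C[n.+1]}) : b != 0 -> Q \is a GRing.unit -> b *: Q \is a GRing.unit.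
  move=> b0 Qu; rewrite -mul_mpolyC unitrM Qu andbT.
  by apply: (rmorph_unit (@mpolyC n.+1 C)); rewrite unitfE.
split; split=> /=.
- by rewrite scaler_eq0 negb_or a0.
- by apply: contra nuP => /(unitZ a^-1); rewrite aP invr_eq0; exact.
- move=> Q Q' E; have : P = (a^-1 *: Q) * Q' by rewrite -scalerAl -E aP.
  case/irrP => [/(unitZ a _ a0)|]; last by right.
  by rewrite scalerA mulfV // scale1r; left.
- by rewrite scaler_eq0 negb_or a0.
- exact: oner_neq0.
- exists chi => // g x Ag; have := relP g x Ag; rewrite /veval !mevalZ !meval1 !mulr1 => ->.
  by rewrite mulrCA.
Qed.

Section PolynomialType.
Variables (C : numClosedFieldType) (n p : nat).
Variables (B0 : 'M[C]_n.+1 -> 'M[C]_n.+1 -> C) (lambda : C) (g : polynomial_type p B0 lambda).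
Hypotheses (lam0 : lambda != 0) (formB : nondeg_invariant_form B0).
Implicit Types (U : 'M[C]_n.+1) (X Q : dhomog n.+1 C p).

Lemma rho_lambdaE U X : (rho_lambda p lambda U X : {mpoly C[n.+1]}) =
  gl_act (U - (\tr U / n.+1%:R)%:M) X + (lambda * (\tr U / n.+1%:R)) *: (X : {mpoly C[n.+1]}).
Proof. by rewrite /rho_lambda add_lfunE scale_lfunE id_lfunE lfunE. Qed.

Lemma rho_lambda_traceless U X : \tr U = 0 ->
  (rho_lambda p lambda U X : {mpoly C[n.+1]}) = gl_act U X.
Proof. by move=> trU; rewrite rho_lambdaE trU mul0r mulr0 scale0r addr0 -scalemx1 scale0r subr0. Qed.

Lemma rho_lambda_scalar t X : rho_lambda p lambda t%:M X = (lambda * t) *: X.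
Proof.
apply: val_inj; rewrite /= rho_lambdaE mxtrace_scalar -[t *+ _]mulr_natr mulfK ?pnatr_eq0 //.
by rewrite subrr gl_act0l add0r.
Qed.

Let G := mg_comp (m := g).
Let gradG : lie_grading G := mg_grading g.

Lemma mg_m_comp Y : G (-1) (mg_m g Y).
Proof. by rewrite /G -mg_m_range; exists Y. Qed.
Lemma mg_0_comp U : G 0 (mg_0 g U).
Proof. by rewrite /G -mg_0_range; exists U. Qed.
Lemma mg_p_comp X : G 1 (mg_p g X).
Proof. by rewrite /G -mg_p_range; exists X. Qed.

Lemma local_partP z : local_part G z <->
  exists Y U X, z = mg_m g Y + mg_0 g U + mg_p g X.
Proof.
split=> [[a [b [c [Ga Gb Gc ->]]]]|[Y [U [X ->]]]].
  move: Ga Gb Gc; rewrite /G -mg_m_range -mg_0_range -mg_p_range.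
  by move=> [Y _ <-] [U _ <-] [X _ <-]; exists Y, U, X.
exists (mg_m g Y), (mg_0 g U), (mg_p g X); split=> //.
- exact: mg_m_comp.
- exact: mg_0_comp.
- exact: mg_p_comp.
Qed.

Lemma mg_local_eq0 Y U X : mg_m g Y + mg_0 g U + mg_p g X = 0 -> [/\ Y = 0, U = 0 & X = 0].
Proof.
move=> /(grading_three gradG (mg_m_comp Y) (mg_0_comp U) (mg_p_comp X))[Y0 U0 X0].
split; [apply: (@mg_m_inj _ _ _ _ _ g)|apply: (@mg_0_inj _ _ _ _ _ g)|apply: (@mg_p_inj _ _ _ _ _ g)];
  by rewrite linear0.
Qed.

Lemma lie_scalar_p t X : lie (mg_0 g t%:M) (mg_p g X) = (lambda * t) *: mg_p g X.
Proof. by rewrite mg_0p rho_lambda_scalar linearZ. Qed.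

Lemma lie_scalar_m t Y : lie (mg_0 g t%:M) (mg_m g Y) = - (lambda * t) *: mg_m g Y.
Proof.
rewrite mg_0m -linearZ; congr (mg_m g _); apply/lfunP => X.
by rewrite /contragredient opp_lfunE comp_lfunE rho_lambda_scalar linearZ scale_lfunE scaleNr.
Qed.

Lemma lie_scalar_0 t U : lie (mg_0 g t%:M) (mg_0 g U) = 0.
Proof. by rewrite mg_00 /lie /= /mxlie mul_scalar_mx mul_mx_scalar subrr linear0. Qed.

(** The normalisation of t makes t Id act on the component of degree i as 2 i. *)
Lemma centralizer_degree t z : lambda * t = 2 -> lie (mg_0 g t%:M) z = 0 ->
  exists U, z = mg_0 g U.
Proof.
move=> lt hz; have : G 0 z.
  apply: (degree_derivation gradG (h := mg_0 g t%:M)) => //; first exact: mg_generated.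
  - by move=> y; rewrite /G -mg_m_range => -[Y _ <-]; rewrite lie_scalar_m lt.
  - by move=> y; rewrite /G -mg_0_range => -[U _ <-]; exact: lie_scalar_0.
  - by move=> y; rewrite /G -mg_p_range => -[X _ <-]; rewrite lie_scalar_p lt.
by rewrite /G -mg_0_range => -[U _ <-]; exists U.
Qed.

(** The bracket of Y and X is dual, for B0, to U |-> Y(rho(U) X), which is a
    multiple of the trace because Y kills sl(W).X. *)
Lemma lie_dual_pair c (Y : 'Hom(dhomog n.+1 C p, C^o)) X : c != 0 -> (forall U, B0 1%:M U = c * \tr U) ->
  (forall U : 'M[C]_n.+1, \tr U = 0 -> Y (gl_act_dhomog U X) = 0) ->
  lie (mg_m g Y) (mg_p g X) = mg_0 g (- (lambda * Y X / (n.+1%:R * c)))%:M.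
Proof.
move=> c0 BE Y0; have [Z XYZ BZ] := mg_pm g X Y.
rewrite lieC XYZ; have [Bl Bs _ Bn] := formB.
suff -> : Z = (lambda * Y X / (n.+1%:R * c))%:M.
  by rewrite -linearN; congr (mg_0 g _); apply/matrixP => i j; rewrite !mxE mulNrn.
set d := lambda * Y X / _; apply/eqP; rewrite -subr_eq0; apply/eqP; apply: Bn => U.
rewrite -scalemx1 -scaleNr addrC Bl BE BZ.
have -> : rho_lambda p lambda U X = gl_act_dhomog (U - (\tr U / n.+1%:R)%:M) X
    + (lambda * (\tr U / n.+1%:R)) *: X.
  by apply: val_inj; rewrite /= rho_lambdaE.
rewrite linearD linearZ /= Y0 ?add0r; last first.
  by rewrite linearB /= mxtrace_scalar -[_ *+ _]mulr_natr divfK ?pnatr_eq0 ?subrr.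
rewrite -[_ *: Y X]/(_ * Y X) /d.
have N0 : n.+1%:R != 0 :> C by rewrite pnatr_eq0.
by move: (Y X) (\tr U) (n.+1%:R : C) N0 => a b N N0; field; rewrite c0 N0.
Qed.

End PolynomialType.

(** The metric enters only through the criticality of k; its existence is the
    only analytic input. *)
Lemma dual_pair_of_critical_metric (C : numClosedFieldType) (n p : nat)
    (A : set 'M[C]_n.+1) (P : dhomog n.+1 C p)
    (B0 : 'M[C]_n.+1 -> 'M[C]_n.+1 -> C) (lambda : C)
    (g : polynomial_type p B0 lambda) (k : 'M[C]_n.+1) :
  algebraic_group A -> zariski_connected A ->
  irreducible_module A -> prehomogeneous A ->
  fundamental_relative_invariant A P ->
  lie_of_group A = [set U | exists mu : C, gl_act U P = mu *: (P : {mpoly C[n.+1]})] ->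
  \det k = 1 -> (forall V, \tr V = 0 -> moment P 0 k V = 0) ->
  lambda != 0 -> nondeg_invariant_form B0 ->
  let a' : set g := mg_0 g @` derived_algebra (lie_of_group A) in
  let bt : set g := centralizer a' in
  let y (Q : dhomog n.+1 C p) : g := mg_m g (dual_form Q) in
  let h : g := mg_0 g (2 / lambda)%:M in
  let x : g := mg_p g P in
  [/\ exists2 Ps : dhomog n.+1 C p,
        fundamental_relative_invariant (dual_group A) Ps
        & sl2_triple (y Ps) h x,
      forall Ps : dhomog n.+1 C p,
        fundamental_relative_invariant (dual_group A) Ps ->
        sl2_triple (y Ps) h x ->
        let b : set g := lie_generated [set y Ps; h; x] in
        isomorphic_sl2 b /\ b = bt `&` local_part (mg_comp (m:=g))
    & dual_pair a' bt].
Proof.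
move=> algA conA irrA preA fundP lieA k1 crit lam0 formB a' bt y h x.
have homP : (P : {mpoly C[n.+1]}) \is p.-homog := dhomog_is_dhomog P.
pose D : dhomog n.+1 C p := DHomog (dual_homog homP k).
have DP0 := dual_invariant_neq0 fundP k1.
have stabE := stab_derived algA conA irrA homP fundP lieA k1 crit.
have trstab := stab_traceless homP fundP k1 crit.
have invstab := stab_invariants algA conA preA homP fundP lieA.
have a'E : a' = mg_0 g @` annihilator P by rewrite /a' stabE.
have [c c0 BE] := invariant_form_scalar formB.
have N0 : n.+1%:R != 0 :> C by rewrite pnatr_eq0.
have lam2 : lambda * (2 / lambda) = 2 by rewrite mulrC divfK.
have killP U X : annihilator P U -> rho_lambda p lambda U X = gl_act_dhomog U X.
  by move=> U0; apply: val_inj; rewrite /= rho_lambda_traceless // trstab.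
have contra0 U (Y : 'Hom(dhomog n.+1 C p, C^o)) : annihilator P U ->
    contragredient (rho_lambda p lambda) U Y = 0 <-> forall X, Y (gl_act_dhomog U X) = 0.
  move=> U0; split=> [/lfunP + X|Y0]; first move=> /(_ X).
    by rewrite /contragredient opp_lfunE comp_lfunE killP // lfunE => /eqP; rewrite oppr_eq0 => /eqP.
  by apply/lfunP => X; rewrite /contragredient opp_lfunE comp_lfunE killP // Y0 oppr0 lfunE.
have DY (Q : dhomog n.+1 C p) e : (Q : {mpoly C[n.+1]}) = e *: dual_invariant P k ->
    (forall U X, annihilator P U -> dual_form Q (gl_act_dhomog U X) = 0) /\
    (forall U : 'M_n.+1, \tr U = 0 -> dual_form Q (gl_act_dhomog U P) = 0).
  move=> QE; split=> [U X U0|U trU]; rewrite dual_formE QE fischerZl.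
    by rewrite (dual_invariant_stab k1 crit) ?mulr0.
  by rewrite (dual_invariant_traceless k1 crit) ?mulr0.
have hx : lie h x = 2 *: x by rewrite /h /x lie_scalar_p // lam2.
have hy Q : lie h (y Q) = -2 *: y Q by rewrite /h /y lie_scalar_m // lam2.
split.
(* kappa solves lambda kappa (P^*, P) / (N c) = - 2 / lambda, N = dim W *)
- pose kappa := - (2 * n.+1%:R * c) / (lambda ^+ 2 * fischer (dual_invariant P k) P).
  have kappa0 : kappa != 0.
    by rewrite mulf_neq0 ?oppr_eq0 ?invr_eq0 ?mulf_neq0 ?expf_neq0 // pnatr_eq0.
  have PsE : (kappa *: D : {mpoly C[n.+1]}) = kappa *: dual_invariant P k by [].
  have [_ traceless0] := DY (kappa *: D) kappa PsE.
  exists (kappa *: D).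
    apply: fundamental_scale => //; split.
      exact: (dual_invariant_irreducible fundP k1).
    exact: (dual_invariant_relative algA conA preA homP fundP lieA k1 crit).
  split=> //; rewrite /y /x (lie_dual_pair g formB c0 BE traceless0) dual_formE PsE fischerZl.
  congr (mg_0 g _%:M); rewrite /kappa; move: (fischer _ _) (n.+1%:R : C) DP0 N0 => d N d0 N0.
  by field; rewrite c0 N0 lam0 d0.
- move=> Ps fundPs tri b.
  have [e PsE] : exists e, (Ps : {mpoly C[n.+1]}) = e *: dual_invariant P k.
    apply: (dual_invariant_unique algA conA preA homP fundP lieA k1 crit) => [|U Q U0 homQ].
      exact: dhomog_is_dhomog.
    rewrite fischer_gl_act.
    by rewrite (fundamental_dual_stab algA conA irrA homP fundP lieA k1 crit fundPs U0) fischer0l.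
  have e0 : e != 0.
    by have [[+ _ _] _] := fundPs; apply: contraNneq => e0; rewrite PsE e0 scale0r.
  have [Psstab _] := DY Ps e PsE.
  have Pf : fischer Ps P != 0 by rewrite PsE fischerZl mulf_neq0.
  have combE a d f : triple_comb (y Ps) h x a d f =
      mg_m g (a *: dual_form Ps) + mg_0 g (d *: (2 / lambda)%:M) + mg_p g (f *: P).
    by rewrite /triple_comb /y /h /x !linearZ.
  have free a d f : triple_comb (y Ps) h x a d f = 0 -> [/\ a = 0, d = 0 & f = 0].
    rewrite combE => /mg_local_eq0[/eqP + /eqP + /eqP].
    rewrite !scaler_eq0 => /orP[/eqP a0|/eqP Y0]; last first.
      by case/eqP: Pf; rewrite -dual_formE Y0 lfunE.
    move=> /orP[/eqP d0|/eqP/matrixP/(_ 0 0)]; last first.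
      rewrite !mxE eqxx mulr1n => /eqP; rewrite mulf_eq0 invr_eq0 (negPf lam0) pnatr_eq0 //.
    move=> /orP[/eqP f0|/eqP P0]; first by split.
    by have /eqP := fundamental_neq0 fundP; rewrite P0.
  split; first exact: isomorphic_sl2_triple tri free.
  rewrite /b (lie_generated_triple tri); apply/seteqP; split.
    move=> _ [a [d [f ->]]]; rewrite combE; split; last by apply/local_partP; do 3!eexists.
    move=> w; rewrite a'E => -[U U0 <-].
    rewrite lieC !lieDr mg_0m mg_00 mg_0p.
    have -> : contragredient (rho_lambda p lambda) U (a *: dual_form Ps) = 0.
      by apply/contra0 => // X; rewrite scale_lfunE Psstab // scaler0.
    have -> : rho_lambda p lambda U (f *: P) = 0.
      by rewrite killP //; apply: val_inj; rewrite /= gl_actZ (U0 : gl_act U P = 0) scaler0.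
    rewrite (_ : lie U _ = 0) ?linear0 ?addr0 ?oppr0 //.
    by rewrite /lie /= /mxlie scale_scalar_mx mul_scalar_mx mul_mx_scalar subrr.
  move=> z [zbt /local_partP[Y [U0 [X zE]]]].
  have comps U : annihilator P U -> [/\ contragredient (rho_lambda p lambda) U Y = 0,
      lie U U0 = 0 & rho_lambda p lambda U X = 0].
    move=> sU; apply: (@mg_local_eq0 _ _ _ _ _ g).
    rewrite -mg_0m -mg_00 -mg_0p -!lieDr -zE lieC zbt ?oppr0 //.
    by rewrite a'E; exists U.
  have [Q QY] := dual_form_surj Y.
  have [eQ QE] : exists eQ, (Q : {mpoly C[n.+1]}) = eQ *: dual_invariant P k.
    apply: (dual_invariant_unique algA conA preA homP fundP lieA k1 crit) => [|U S sU homS].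
      exact: dhomog_is_dhomog.
    have [/contra0 + _ _] := comps U sU; move=> /(_ sU (DHomog homS)).
    by rewrite QY dual_formE.
  have [d U0E] : exists d, U0 = d%:M.
    apply: (stab_centralizer_scalar algA conA irrA homP fundP lieA) => U sU.
    by have [_ /eqP + _] := comps U sU; rewrite subr_eq0 => /eqP.
  have [f XE] : exists f, (X : {mpoly C[n.+1]}) = f *: (P : {mpoly C[n.+1]}).
    apply: invstab => [|U sU]; first exact: dhomog_is_dhomog.
    by have [_ _] := comps U sU; rewrite killP // => /(congr1 val).
  exists (eQ / e), (d / (2 / lambda)), f; rewrite combE zE; congr (_ + _ + _).
  + congr (mg_m g _); rewrite QY; apply/lfunP => S; rewrite scale_lfunE !dual_formE.
    by rewrite QE PsE !fischerZl -[_ *: _]/(_ * _) mulrA divfK.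
  + congr (mg_0 g _); rewrite U0E scale_scalar_mx divfK //.
    by rewrite mulf_neq0 ?invr_eq0 // pnatr_eq0.
  + by congr (mg_p g _); apply: val_inj.
- split=> //; apply/seteqP; split=> [z zc|z za w wb]; last first.
    by rewrite lieC (wb z za) oppr0.
  have xbt : bt x.
    move=> w; rewrite a'E => -[U U0 <-]; rewrite lieC mg_0p killP //.
    by rewrite (_ : gl_act_dhomog U P = 0) ?linear0 ?oppr0 //; exact: val_inj.
  have hbt : bt h by move=> w; rewrite a'E => -[U U0 <-]; exact: lie_scalar_0.
  have hz : lie h z = 0 by rewrite lieC (zc h hbt) oppr0.
  have [U zU] := centralizer_degree lam2 hz.
  have := zc x xbt; rewrite zU mg_0p -[RHS](linear0 (mg_p g)) => /mg_p_inj/(congr1 val) /=.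
  rewrite rho_lambdaE; set t := \tr U / _ => eqP0.
  have trUt : \tr (U - t%:M) = 0.
    by rewrite linearB /= mxtrace_scalar -[_ *+ _]mulr_natr divfK ?subrr.
  have lt0 : lambda * t = 0.
    have := congr1 (fischer (dual_invariant P k)) eqP0; rewrite fischerDr fischer0r fischerZr.
    rewrite (dual_invariant_traceless k1 crit) // add0r => /eqP.
    by rewrite mulf_eq0 (negPf DP0) orbF => /eqP.
  have t0 : t = 0 by move/eqP: lt0; rewrite mulf_eq0 (negPf lam0) => /eqP.
  rewrite a'E; exists U => //; move: eqP0.
  by rewrite lt0 scale0r addr0 t0 -scalemx1 scale0r subr0.
Qed.

Theorem theorem5p2p4 (R : realType) (n p : nat)
    (A : set 'M[R[i]]_n.+1) (P : dhomog n.+1 R[i] p)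
    (B0 : 'M[R[i]]_n.+1 -> 'M[R[i]]_n.+1 -> R[i]) (lambda : R[i])
    (g : polynomial_type p B0 lambda) :
  algebraic_group A -> zariski_connected A -> reductive A ->
  zariski_dim (group_center A) 1 ->
  irreducible_module A -> prehomogeneous A -> regular A ->
  fundamental_relative_invariant A P ->
  lie_of_group A = [set U | exists mu : R[i], gl_act U P = mu *: (P : {mpoly R[i][n.+1]})] ->
  lambda != 0 -> nondeg_invariant_form B0 ->
  let a' : set g := mg_0 g @` derived_algebra (lie_of_group A) in
  let bt : set g := centralizer a' in
  let y (Q : dhomog n.+1 R[i] p) : g := mg_m g (dual_form Q) in
  let h : g := mg_0 g (2 / lambda)%:M in
  let x : g := mg_p g P in
  [/\ exists2 Ps : dhomog n.+1 R[i] p,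
        fundamental_relative_invariant (dual_group A) Ps
        & sl2_triple (y Ps) h x,
      forall Ps : dhomog n.+1 R[i] p,
        fundamental_relative_invariant (dual_group A) Ps ->
        sl2_triple (y Ps) h x ->
        let b : set g := lie_generated [set y Ps; h; x] in
        isomorphic_sl2 b /\ b = bt `&` local_part (mg_comp (m:=g))
    & dual_pair a' bt].
Proof.
move=> algA conA _ _ irrA preA _ fundP lieA lam0 formB.
have homP : (P : {mpoly R[i][n.+1]}) \is p.-homog := dhomog_is_dhomog P.
have irrP := stab_image_irreducible algA conA irrA homP fundP lieA.
have [k [k1 kmin]] := norm_min homP irrP.
apply: (dual_pair_of_critical_metric g algA conA irrA preA fundP lieA k1) => // V.
by apply: (moment_critical _ k1 kmin); exact: real0.
Qed.
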